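(* Let $u\in\mathcal{S}(\mathbb{R}^n)$ and let $\omega$ be a non-quasianalytic weight function. Then the following conditions (1)–(6) are equivalent to each other, and $u\in\mathcal{S}_\omega(\mathbb{R}^n)$ if and only if one of them is satisfied. (1) For all $\lambda>0$ and $\alpha\in\mathbb{N}_0^n$: $\sup_{x\in\mathbb{R}^n}e^{\lambda\omega(x)}|D^\alpha u(x)|<+\infty$ and $\sup_{\xi\in\mathbb{R}^n}e^{\lambda\omega(\xi)}|D^\alpha\widehat{u}(\xi)|<+\infty$. (2) For all $\lambda>0$ and $\alpha\in\mathbb{N}_0^n$: $\sup_{x\in\mathbb{R}^n}e^{\lambda\omega(x)}|x^\alpha u(x)|<+\infty$ and $\sup_{\xi\in\mathbb{R}^n}e^{\lambda\omega(\xi)}|\xi^\alpha\widehat{u}(\xi)|<+\infty$. (3) For all $\lambda>0$: $\sup_{x\in\mathbb{R}^n}e^{\lambda\omega(x)}|u(x)|<+\infty$ and $\sup_{\xi\in\mathbb{R}^n}e^{\lambda\omega(\xi)}|\widehat{u}(\xi)|<+\infty$. (4) Both of the following hold: (a) for all $\beta\in\mathbb{N}_0^n$ and $\lambda>0$ there exists $C_{\beta,\lambda}>0$ such that $$\sup_{x\in\mathbb{R}^n}|x^\beta D^\alpha u(x)|\,e^{-\lambda\varphi^*\left(\frac{|\alpha|}{\lambda}\right)}\leq C_{\beta,\lambda}\qquad\forall\alpha\in\mathbb{N}_0^n;$$ (b) for all $\alpha\in\mathbb{N}_0^n$ and $\mu>0$ there exists $C_{\alpha,\mu}>0$ such that $$\sup_{x\in\mathbb{R}^n}|x^\beta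 D^\alpha u(x)|\,e^{-\mu\varphi^*\left(\frac{|\beta|}{\mu}\right)}\leq C_{\alpha,\mu}\qquad\forall\beta\in\mathbb{N}_0^n.$$ (5) For all $\mu,\lambda>0$ there exists $C_{\mu,\lambda}>0$ such that $$\sup_{x\in\mathbb{R}^n}|x^\beta D^\alpha u(x)|\,e^{-\lambda\varphi^*\left(\frac{|\alpha|}{\lambda}\right)}e^{-\mu\varphi^*\left(\frac{|\beta|}{\mu}\right)}\leq C_{\mu,\lambda}\qquad\forall\alpha,\beta\in\mathbb{N}_0^n.$$ (6) For all $\lambda>0$ there exists $C_\lambda>0$ such that $$\sup_{x\in\mathbb{R}^n}|x^\beta D^\alpha u(x)|\,e^{-\lambda\varphi^*\left(\frac{|\alpha+\beta|}{\lambda}\right)}\leq C_\lambda\qquad\forall\alpha,\beta\in\mathbb{N}_0^n.$$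
   Context: A non-quasianalytic weight function is a continuous increasing function $\omega:[0,+\infty)\to[0,+\infty)$ such that: ($\alpha$) there is $L>0$ with $\omega(2t)\le L(\omega(t)+1)$ for all $t\ge0$; ($\beta$) $\int_1^{+\infty}\frac{\omega(t)}{t^2}dt<+\infty$; ($\gamma$) there are $a\in\mathbb{R}$, $b>0$ with $\omega(t)\ge a+b\log(1+t)$ for all $t\ge0$; ($\delta$) $\varphi:t\mapsto\omega(e^t)$ is convex. One sets $\omega(\xi)=\omega(|\xi|)$ for $\xi\in\mathbb{C}^n$. The Young conjugate of $\varphi$ is $\varphi^*(s)=\sup_{t\ge0}\{st-\varphi(t)\}$, $s\ge0$. It may take the value $+\infty$; in that case $e^{\varphi^*(s)}=+\infty$ and $e^{-\varphi^*(s)}=0$. $\mathcal{S}_\omega(\mathbb{R}^n)$ is the set of all $u\in L^1(\mathbb{R}^n)$ such that $u,\widehat u\in C^\infty(\mathbb{R}^n)$ and, for all $\lambda>0$, $\alpha\in\mathbb{N}_0^n$, $\sup_{\mathbb{R}^n}e^{\lambda\omega(x)}|D^\alpha u(x)|<+\infty$ and $\sup_{\mathbb{R}^n}e^{\lambda\omega(\xi)}|D^\alpha\widehat u(\xi)|<+\infty$. It is contained in $\mathcal{S}(\mathbb{R}^n)$. Here $\widehat u(\xi)=\int e^{-i\langle x,\xi\rangle}u(x)\,dx$, $D^\alpha=(-i)^{|\alpha|}\partial^\alpha$, $\mathbb{N}_0=\mathbb{N}\cup\{0\}$. *)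

(* Defs.v *)
From HB Require Import structures.
From mathcomp Require Import all_boot all_order all_algebra.
From mathcomp Require Import complex.
From mathcomp Require Import all_classical all_reals all_analysis.

Set Implicit Arguments.
Unset Strict Implicit.
Unset Printing Implicit Defensive.

Import Order.TTheory GRing.Theory Num.Theory.
Import numFieldNormedType.Exports.

Local Open Scope classical_set_scope.
Local Open Scope ring_scope.

(* MathComp-Analysis has no Lebesgue measure on R^n for general n: it is built
   here, as a sigma-finite measure on the product sigma-algebra of n-tuples, by
   iterating the product of measures. *)
Section LebesgueMeasureRn.
Context {R : realType}.
Local Open Scope ereal_scope.

Definition cons_tuple n (p : measurableTypeR R * n.-tuple (measurableTypeR R)) :
    n.+1.-tuple (measurableTypeR R) := [tuple of p.1 :: p.2].

Fixpoint lebesgue_measure_tuple n :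
    set (n.-tuple (measurableTypeR R)) -> \bar R :=
  match n with
  | 0%N => \d_[tuple]
  | n'.+1 => pushforward
      ((@lebesgue_measure R) \x (@lebesgue_measure_tuple n')) (@cons_tuple n')
  end.

Let measurable_cons_tuple n : measurable_fun setT (@cons_tuple n).
Proof. by apply: measurable_cons. Qed.

Let measurable_uncons n : measurable_fun setT
  (fun t : n.+1.-tuple (measurableTypeR R) => (thead t, [tuple of behead t])).
Proof.
apply/measurable_fun_pair => /=; [exact: measurable_tnth|exact: measurable_behead].
Qed.

Lemma lebesgue_measure_tuple_sigma_finite n :
  exists mu : {sigma_finite_measure set (n.-tuple (measurableTypeR R)) -> \bar R},
    mu = @lebesgue_measure_tuple n :> (set _ -> \bar R).
Proof.
elim: n => [|n [mu muE]] /=.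
  by exists (\d_[tuple] : {sigma_finite_measure set _ -> \bar R}).
rewrite -muE.
pose nu : {measure set _ -> \bar R} :=
  measure_function_pushforward__canonical__measure_function_Measure
    ((@lebesgue_measure R) \x mu) (@measurable_cons_tuple n).
have nuS : sigma_finite setT nu.
  have /sigma_finiteP[F [TF ndF Foo]] := sigma_finiteT (@lebesgue_measure R).
  have /sigma_finiteP[G [TG ndG Goo]] := sigma_finiteT mu.
  pose g (t : n.+1.-tuple (measurableTypeR R)) :=
    (thead t, [tuple of behead t]).
  exists (fun k => g @^-1` (F k `*` G k)).
    rewrite -preimage_bigcup (_ : \bigcup_k (F k `*` G k) = setT) ?preimage_setT//.
    apply/seteqP; split => // -[x t] _.
    have [i _ Fix] : (\bigcup_i F i) x by rewrite -TF.
    have [j _ Gjt] : (\bigcup_i G i) t by rewrite -TG.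
    exists (maxn i j) => //; split => /=.
      by move: x Fix; exact/subsetPset/ndF/leq_maxl.
    by move: t Gjt; exact/subsetPset/ndG/leq_maxr.
  move=> k; have [mF Fk] := Foo k; have [mG Gk] := Goo k; split.
    rewrite -[X in measurable X]setTI; apply: measurable_uncons => //.
    exact: measurableX.
  rewrite /nu /= /pushforward -comp_preimage (_ : g \o @cons_tuple n = id).
    by rewrite product_measure1E// lte_mul_pinfty// ge0_fin_numE.
  apply/funext => -[x t] /=.
  by rewrite /g /cons_tuple theadE; congr (_, _); exact/val_inj.
by exists (HB.pack_for {sigma_finite_measure set _ -> \bar R}
  (Measure.sort nu) (Measure_isSigmaFinite.Build _ _ _ _ nuS)).
Qed.

Let mu_n0 n : @lebesgue_measure_tuple n set0 = 0.
Proof. by have [mu <-] := lebesgue_measure_tuple_sigma_finite n. Qed.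

Let mu_n_ge0 n A : 0 <= @lebesgue_measure_tuple n A.
Proof. by have [mu <-] := lebesgue_measure_tuple_sigma_finite n. Qed.

Let mu_n_sigma_additive n : semi_sigma_additive (@lebesgue_measure_tuple n).
Proof.
have [mu <-] := lebesgue_measure_tuple_sigma_finite n.
exact: measure_semi_sigma_additive.
Qed.

HB.instance Definition _ n := isMeasure.Build _ _ _
  (@lebesgue_measure_tuple n) (mu_n0 n) (@mu_n_ge0 n) (@mu_n_sigma_additive n).

Let mu_n_sigma_finite n : sigma_finite setT (@lebesgue_measure_tuple n).
Proof.
by have [mu <-] := lebesgue_measure_tuple_sigma_finite n; exact: sigma_finiteT.
Qed.

HB.instance Definition _ n := Measure_isSigmaFinite.Build _ _ _
  (@lebesgue_measure_tuple n) (@mu_n_sigma_finite n).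

End LebesgueMeasureRn.

Section EuclideanSpace.
Context {R : realType} {n : nat}.
Implicit Types (x y : 'rV[R]_n) (al be : {ffun 'I_n -> nat}).

Definition dot x y : R := \sum_i x 0 i * y 0 i.

(* `|x| is the maximum norm on 'rV[R]_n, hence the Euclidean one is needed. *)
Definition enorm x : R := Num.sqrt (dot x x).

Definition mi_size al : nat := (\sum_i al i)%N.

Definition mi_pow x al : R := \prod_i x 0 i ^+ al i.

Definition row_of_tuple (t : n.-tuple (measurableTypeR R)) : 'rV[R]_n :=
  \row_i tnth t i.

Definition partial (j : 'I_n) (f : 'rV[R]_n -> R) : 'rV[R]_n -> R :=
  fun x => 'D_(delta_mx 0 j) f x.

Definition partials (s : seq 'I_n) (f : 'rV[R]_n -> R) : 'rV[R]_n -> R :=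
  foldr partial f s.

(* C^oo: all iterated partial derivatives, in any order, exist and are
   continuous. *)
Definition smooth_real (f : 'rV[R]_n -> R) : Prop :=
  forall s : seq 'I_n, continuous (partials s f) /\
    forall (j : 'I_n) x, derivable (partials s f) x (delta_mx 0 j).

Definition mi_dirs al : seq 'I_n :=
  flatten [seq nseq (al j) j | j <- enum 'I_n].

Definition re_part (u : 'rV[R]_n -> R[i]) : 'rV[R]_n -> R :=
  fun x => complex.Re (u x).
Definition im_part (u : 'rV[R]_n -> R[i]) : 'rV[R]_n -> R :=
  fun x => complex.Im (u x).

Definition smooth (u : 'rV[R]_n -> R[i]) : Prop :=
  smooth_real (re_part u) /\ smooth_real (im_part u).

(* D^al = (-i)^|al| d^al, where d^al acts on real and imaginary parts. *)
Definition Dop al (u : 'rV[R]_n -> R[i]) : 'rV[R]_n -> R[i] := fun x =>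
  (- 'i%C) ^+ mi_size al *
  (partials (mi_dirs al) (re_part u) x +i*
   partials (mi_dirs al) (im_part u) x)%C.

Definition L1 (u : 'rV[R]_n -> R[i]) : Prop :=
  (@lebesgue_measure_tuple R n).-integrable setT
     (EFin \o re_part u \o row_of_tuple) /\
  (@lebesgue_measure_tuple R n).-integrable setT
     (EFin \o im_part u \o row_of_tuple).

Definition cintegral (u : 'rV[R]_n -> R[i]) : R[i] :=
  ((\int[@lebesgue_measure_tuple R n]_(t in setT) re_part u (row_of_tuple t))%R +i*
   (\int[@lebesgue_measure_tuple R n]_(t in setT) im_part u (row_of_tuple t))%R)%C.

Definition cexpi (t : R) : R[i] := (cos t +i* sin t)%C.

Definition fourier (u : 'rV[R]_n -> R[i]) : 'rV[R]_n -> R[i] :=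
  fun xi => cintegral (fun x => cexpi (- dot x xi) * u x).

(* |x^be D^al u(x)| *)
Definition xD al be (u : 'rV[R]_n -> R[i]) (x : 'rV[R]_n) : R :=
  Normc.normc ((mi_pow x be)%:C%C * Dop al u x).

Definition schwartz (u : 'rV[R]_n -> R[i]) : Prop :=
  smooth u /\
  forall al be, (ereal_sup (range (fun x => (xD al be u x)%:E)) < +oo)%E.

End EuclideanSpace.

Section WeightFunctions.
Context {R : realType}.

(* A weight is a function on R of which only the values on [0, +oo[ are used. *)
Record weight_function (omega : R -> R) : Prop := WeightFunction {
  weight_ge0 : forall t : R, 0 <= t -> 0 <= omega t ;
  weight_continuous : {within `[0, +oo[, continuous omega} ;
  weight_nondecreasing :
    forall s t : R, 0 <= s -> s <= t -> omega s <= omega t ;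
  weight_alpha : exists2 L : R, 0 < L &
    forall t : R, 0 <= t -> omega (2 * t) <= L * (omega t + 1) ;
  weight_beta : (\int[@lebesgue_measure R]_(t in `[1%R, +oo[)
    (omega t / t ^+ 2)%:E < +oo)%E ;
  weight_gamma : exists a b : R, 0 < b /\
    forall t : R, 0 <= t -> a + b * ln (1 + t) <= omega t ;
  weight_delta : convex_function setT (fun t : R^o => omega (expR t) : R^o)
}.

(* phi^* for phi t = omega (exp t); the value +oo is possible. *)
Definition young_conj (omega : R -> R) (s : R) : \bar R :=
  ereal_sup [set (s * t - omega (expR t))%:E | t in [set t : R | 0 <= t]].

(* exp (- lambda phi^* (k / lambda)); expeR (-oo) = 0. *)
Definition young_factor (omega : R -> R) (lambda : R) (k : nat) : \bar R :=
  expeR (- (lambda%:E * young_conj omega (k%:R / lambda))).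

End WeightFunctions.

Section Conditions.
Context {R : realType} {n : nat}.
Variables (omega : R -> R) (u : 'rV[R]_n -> R[i]).
Implicit Types (al be : {ffun 'I_n -> nat}) (lambda mu : R).

Definition weighted_bounded (lambda : R) (v : 'rV[R]_n -> R[i]) : Prop :=
  (ereal_sup (range (fun x =>
    (expR (lambda * omega (enorm x)) * Normc.normc (v x))%:E)) < +oo)%E.

Definition weighted_derivatives : Prop :=
  forall lambda al, 0 < lambda ->
    weighted_bounded lambda (Dop al u) /\
    weighted_bounded lambda (Dop al (fourier u)).

Definition weighted_monomials : Prop :=
  forall lambda al, 0 < lambda ->
    weighted_bounded lambda (fun x => (mi_pow x al)%:C%C * u x) /\
    weighted_bounded lambda (fun xi => (mi_pow xi al)%:C%C * fourier u xi).

Definition weighted_values : Prop :=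
  forall lambda, 0 < lambda ->
    weighted_bounded lambda u /\ weighted_bounded lambda (fourier u).

Definition separate_young_bounds : Prop :=
  (forall be lambda, 0 < lambda -> exists2 C : R, 0 < C & forall al,
    (ereal_sup (range (fun x =>
       (xD al be u x)%:E * young_factor omega lambda (mi_size al))) <= C%:E)%E) /\
  (forall al mu, 0 < mu -> exists2 C : R, 0 < C & forall be,
    (ereal_sup (range (fun x =>
       (xD al be u x)%:E * young_factor omega mu (mi_size be))) <= C%:E)%E).

Definition joint_young_bounds : Prop :=
  forall mu lambda, 0 < mu -> 0 < lambda -> exists2 C : R, 0 < C & forall al be,
    (ereal_sup (range (fun x =>
       (xD al be u x)%:E * young_factor omega lambda (mi_size al)
                  * young_factor omega mu (mi_size be))) <= C%:E)%E.

Definition total_young_bounds : Prop :=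
  forall lambda, 0 < lambda -> exists2 C : R, 0 < C & forall al be,
    (ereal_sup (range (fun x =>
       (xD al be u x)%:E * young_factor omega lambda (mi_size (al + be)%R))) <= C%:E)%E.

Definition S_omega : Prop :=
  [/\ L1 u, smooth u, smooth (fourier u) & weighted_derivatives].

End Conditions.

(* Main.v *)
(* The proof passes through a joint estimate on a Schwartz function f: for all
   lam, mu > 0, exp (mu omega(x)) |D^al f(x)| exp (- lam phi^*(|al| / lam)) is bounded
   uniformly in x and al.

   Decay of u and of its Fourier transform implies this estimate.  The decay of the
   transform bounds D^al u by C exp (lam phi^*(|al| / lam)), uniformly in x, by Fourier
   inversion.  Kolmogorov's interpolation inequality on the half-line leaving x in
   a coordinate direction, along which the Euclidean norm grows, bounds the square
   of a derivative by the supremum of the function, which decays, times the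
   supremum of the derivative of twice the order.  The constants are exponential in
   the order and are absorbed by condition (alpha).  One coordinate is treated at a
   time.

   Conversely, bounds on x^be D^al u give decay of u and of its transform, since
   exp (lam omega(t)) is comparable to sup_k t^k exp (- lam phi^*(k / lam)) up to a
   change of lam, phi being convex. *)
Require Import Defs.
From mathcomp Require Import all_boot all_order all_algebra.
From mathcomp Require Import complex.
From mathcomp Require Import all_classical all_reals all_analysis.
From mathcomp Require Import measurable_realfun.
From mathcomp Require Import qpoly zify ring lra.

Set Implicit Arguments.
Unset Strict Implicit.
Unset Printing Implicit Defensive.

Import Order.TTheory GRing.Theory Num.Theory.
Import numFieldNormedType.Exports.

Local Open Scope classical_set_scope.
Local Open Scope ring_scope.

(** All calculus is real. For a real function f the transform is replaced by the family Re(e^{i th}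
    f^(xi)) with a phase th: multiplying it by xi_j, or differentiating it in xi_j, moves th by pi/2
    and puts the derivative of f, or x_j f, in place of f. The phases 0 and pi/2 determine all
    others.

    The interpolation inequality is used as 256^k (A / t + B t) with a free t > 0 instead of a
    square root; t is chosen at each point so that both terms have the same size. Here 256 = 16^2:
    interpolation at N points costs 16^N, and N = 2k.

    One coordinate at a time is what makes the orders match. If w consists of k derivatives in the
    current coordinate followed by v, the decaying bound has order |v| and the uniform one 2k + |v|.
    These orders add up to 2|w|, so the product of the two factors dominates the square of the
    factor at |w|, up to a change of lam.

    As phi^* may be infinite, a factor may vanish. Hence bounds keep the factor as a multiplier, and
    every division by it is preceded by a case distinction. *)

Lemma expR_ge1 {R : realType} (x : R) : 0 <= x -> 1 <= expR x.
Proof. by move=> x0; rewrite -expR0 ler_expR. Qed.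

(** * Weight functions and their Young conjugates *)

Section WeightTheory.
Context {R : realType} (omega : R -> R) (W : weight_function omega).
Implicit Types (lam mu c t : R) (k : nat).

(* exp (- lam * phi^* (k / lam)), which is the infimum over t >= 0 of
   exp (lam * omega (exp t) - k * t); it is 0 when phi^* is +oo. *)
Definition young_real lam k : R := fine (young_factor omega lam k).

Lemma young_conj_ge s t : 0 <= t ->
  ((s * t - omega (expR t))%:E <= young_conj omega s)%E.
Proof. by move=> t0; apply: ereal_sup_ubound; exists t. Qed.

(** Taking [t = 0] shows that [young_conj] is never [-oo], so the factor is a real number, equal to
    0 where the conjugate is infinite. *)
Lemma young_factorE lam k : 0 < lam ->
  young_factor omega lam k = (young_real lam k)%:E.
Proof.
move=> l0; rewrite /young_real /young_factor.
have := @young_conj_ge (k%:R / lam) 0 (lexx _).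
case: (young_conj _ _) => [r| |] //= _.
by rewrite gt0_muley ?lte_fin.
Qed.

Lemma young_real_ge0 lam k : 0 <= young_real lam k.
Proof. by apply: fine_ge0; exact: expeR_ge0. Qed.

Lemma young_real_le lam k t : 0 < lam -> 0 <= t ->
  young_real lam k <= expR (lam * omega (expR t) - k%:R * t).
Proof.
move=> l0 t0; rewrite /young_real /young_factor.
have := @young_conj_ge (k%:R / lam) _ t0.
case: (young_conj _ _) => [r| |] //=; last by rewrite gt0_muley ?lte_fin//= expR_ge0.
rewrite lee_fin ler_expR => h.
have := ler_wpM2l (ltW l0) h; rewrite mulrBr mulrA (mulrC lam) divfK ?gt_eqF//.
lra.
Qed.

(** The other half of the description as an infimum. Together with [young_real_le] it reduces later
    estimates to comparing exponents at every [t]. *)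
Lemma le_young_real lam k c : 0 < lam ->
  (forall t, 0 <= t -> c <= expR (lam * omega (expR t) - k%:R * t)) ->
  c <= young_real lam k.
Proof.
move=> l0 h; have [c0|c0] := leP c 0; first by rewrite (le_trans c0)// young_real_ge0.
have : (young_conj omega (k%:R / lam) <= (- ln c / lam)%:E)%E.
  apply: ge_ereal_sup => _ /= [t t0 <-]; rewrite lee_fin ler_pdivlMr//.
  have := h t t0; rewrite -ler_ln ?posrE ?expR_gt0// expRK.
  by rewrite mulrBl mulrAC divfK ?gt_eqF//; lra.
rewrite /young_real /young_factor.
have := @young_conj_ge (k%:R / lam) 0 (lexx _).
case: (young_conj _ _) => [r| |] //= _.
rewrite lee_fin ler_pdivlMr// => hr.
by rewrite -[leLHS]lnK ?posrE// ler_expR; lra.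
Qed.

Lemma young_real_pow lam k r : 0 < lam -> 1 <= r ->
  young_real lam k * r ^+ k <= expR (lam * omega r).
Proof.
move=> l0 r1; have r0 : 0 < r by exact: lt_le_trans r1.
have := @young_real_le lam k (ln r) l0 (ln_ge0 r1).
rewrite lnK ?posrE// expRB expRM_natl lnK ?posrE//.
by rewrite ler_pdivlMr// exprn_gt0.
Qed.

(** The infimum over [t >= 0] only sees radii [r >= 1]. For [r < 1] the power is at most 1 and
    testing at radius 1 bounds the factor, whence the constant [expR (lam * omega 1)]. *)
Lemma young_real_pow_le lam k r : 0 < lam -> 0 <= r ->
  young_real lam k * r ^+ k <= expR (lam * omega 1) * expR (lam * omega r).
Proof.
move=> l0 r0; have [r1|r1] := leP 1 r.
  apply: (le_trans (@young_real_pow lam k r l0 r1)).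
  by rewrite ler_peMl ?expR_ge0// expR_ge1// mulr_ge0// ?(weight_ge0 W)// ltW.
apply: (@le_trans _ _ (expR (lam * omega 1))); last first.
  by rewrite ler_peMr ?expR_ge0// expR_ge1// mulr_ge0// ?(weight_ge0 W)// ltW.
have := @young_real_pow lam k 1 l0 (lexx _); rewrite expr1n mulr1; apply: le_trans.
by rewrite ler_piMr ?young_real_ge0// exprn_ile1// ltW.
Qed.

Lemma omega_phi_le s t : s <= t -> omega (expR s) <= omega (expR t).
Proof. by move=> st; apply: (weight_nondecreasing W); rewrite ?expR_ge0// ler_expR. Qed.

(** Given [t] and [s], the infimum for [k + l] is tested at the larger of them: [omega] there is one
    of the two values, and the other one is nonnegative. *)
Lemma young_real_addM lam k l : 0 < lam -> young_real lam (k + l) <= young_real lam k * young_real lam l.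
Proof.
move=> l0.
have H t s : 0 <= t -> 0 <= s -> young_real lam (k + l) <=
   expR (lam * omega (expR t) - k%:R * t) * expR (lam * omega (expR s) - l%:R * s).
  move=> t0 s0; pose m := Num.max t s.
  have m0 : 0 <= m by rewrite le_max t0.
  apply: (le_trans (@young_real_le lam (k + l) m l0 m0)).
  rewrite -expRD ler_expR natrD.
  have h1 : k%:R * t <= k%:R * m by rewrite ler_wpM2l// le_max lexx.
  have h2 : l%:R * s <= l%:R * m by rewrite ler_wpM2l// le_max lexx orbT.
  have h3 : omega (expR m) <= omega (expR t) + omega (expR s).
    rewrite /m; have [_|_] := leP t s.
      by rewrite lerDr (weight_ge0 W)// expR_ge0.
    by rewrite lerDl (weight_ge0 W)// expR_ge0.
  have := ler_wpM2l (ltW l0) h3; lra.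
(* The infima over [t] and [s] are taken one after the other, each time dividing by the remaining
   factor; its positivity follows once the factor at [k + l] is nonzero. *)
have [z|nz] := eqVneq (young_real lam (k + l)) 0; first by rewrite z mulr_ge0 ?young_real_ge0.
have p : 0 < young_real lam (k + l) by rewrite lt_def nz young_real_ge0.
have H1 s : 0 <= s -> young_real lam (k + l) <= young_real lam k * expR (lam * omega (expR s) - l%:R * s).
  move=> s0; rewrite -ler_pdivrMr ?expR_gt0//; apply: le_young_real => // t t0.
  by rewrite ler_pdivrMr ?expR_gt0//; exact: H.
have pk : 0 < young_real lam k.
  have := lt_le_trans p (@H1 0 (lexx _)); by rewrite pmulr_lgt0// expR_gt0.
rewrite -ler_pdivrMl//; apply: le_young_real => // t t0.
by rewrite ler_pdivrMl//; exact: H1.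
Qed.

(** Testing both factors at the same [t] adds the exponents; doubling [lam] is the price of this
    converse to [young_real_addM]. *)
Lemma young_real_half lam k l : 0 < lam ->
  young_real lam k * young_real lam l <= young_real (2 * lam) (k + l).
Proof.
move=> l0; apply: le_young_real => [|t t0]; first by rewrite mulr_gt0.
apply: (@le_trans _ _ (expR (lam * omega (expR t) - k%:R * t) *
  expR (lam * omega (expR t) - l%:R * t))).
  by apply: ler_pM; rewrite ?young_real_ge0//; exact: young_real_le.
by rewrite -expRD ler_expR natrD; lra.
Qed.

Lemma young_real_noninc lam k l : 0 < lam -> (k <= l)%N -> young_real lam l <= young_real lam k.
Proof.
move=> l0 kl; apply: le_young_real => // t t0; apply: (le_trans (@young_real_le lam l t l0 t0)).
by rewrite ler_expR lerD2l lerN2 ler_wpM2r// ler_nat.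
Qed.

Lemma young_real_mono lam mu k : 0 < lam -> lam <= mu -> young_real lam k <= young_real mu k.
Proof.
move=> l0 lm; apply: le_young_real => [|t t0]; first exact: lt_le_trans lm.
apply: (le_trans (@young_real_le lam k t l0 t0)).
by rewrite ler_expR lerD2r ler_wpM2r// (weight_ge0 W)// expR_ge0.
Qed.

Lemma weight_linear : exists a b : R, 0 < b /\ forall t, a + b * t <= omega (expR t).
Proof.
have [a [b [b0 h]]] := weight_gamma W; exists a, b; split => // t.
apply: le_trans (h _ (expR_ge0 t)); rewrite lerD2l ler_wpM2l ?(ltW b0)//.
rewrite -{1}(expRK t) ler_ln ?posrE ?ltr_pwDl ?expR_gt0 ?expR_ge0//.
by rewrite lerDr.
Qed.

(** By condition (gamma), [lam = (k + 1) / b] makes the exponent at least [lam * a + t], which is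
    bounded below. So at each fixed order some factor can be divided out. *)
Lemma young_real_gt0 k : exists2 lam, 0 < lam & 0 < young_real lam k.
Proof.
have [a [b [b0 h]]] := weight_linear.
exists ((k%:R + 1) / b); first by rewrite divr_gt0// ltr_wpDl.
have l0 : 0 < (k%:R + 1) / b by rewrite divr_gt0// ltr_wpDl.
apply: (@lt_le_trans _ _ (expR ((k%:R + 1) / b * a))); first exact: expR_gt0.
apply: le_young_real => // t t0; rewrite ler_expR.
have := ler_wpM2l (ltW l0) (h t); rewrite mulrDr [_ / b * (b * t)]mulrA divfK ?gt_eqF//.
have k0 : 0 <= k%:R * t :> R by rewrite mulr_ge0.
lra.
Qed.

(** Condition (gamma) in the form used later: powers of the radius are absorbed by enlarging the
    parameter of the weight. *)
Lemma pow_weight k : exists lam C, [/\ 0 < lam, 0 < C & forall r, 0 <= r ->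
  r ^+ k <= C * expR (lam * omega r)].
Proof.
have [lam l0 y0] := young_real_gt0 k.
exists lam, (expR (lam * omega 1) / young_real lam k); split => //.
  by rewrite divr_gt0// expR_gt0.
by move=> r r0; rewrite mulrAC ler_pdivlMr// mulrC young_real_pow_le.
Qed.

Lemma young_real_pow2 lam : 0 < lam -> exists mu C, [/\ 0 < mu, 0 < C &
  forall k, 2 ^+ k * young_real lam k <= C * young_real mu k].
Proof.
move=> l0; have [L L0 h] := weight_alpha W.
exists (lam * L), (expR (lam * L)); split; rewrite ?mulr_gt0 ?expR_gt0// => k.
rewrite -ler_pdivrMl ?expR_gt0//; apply: le_young_real => [|t t0]; first by rewrite mulr_gt0.
rewrite ler_pdivrMl ?expR_gt0//.
have h2 : 0 <= ln 2 :> R by rewrite ln_ge0// ler1n.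
(* The infimum is tested at [t + ln 2]: the term [k * ln 2] cancels [2 ^+ k], and condition (alpha)
   bounds [omega (2 * expR t)]. *)
have := young_real_le k l0 (addr_ge0 t0 h2) => /(ler_wpM2l (exprn_ge0 k (ler0n R 2))).
move=> /le_trans; apply.
rewrite -{1}[2](@lnK R) ?posrE// -expRM_natl -!expRD ler_expR.
have := h _ (expR_ge0 t); rewrite -{1}[2](@lnK R) ?posrE// -expRD addrC.
by move=> /(ler_wpM2l (ltW l0)); lra.
Qed.

Lemma young_real_exp lam (c : R) : 0 < lam -> exists mu C, [/\ 0 < mu, 0 < C &
  forall k, c ^+ k * young_real lam k <= C * young_real mu k].
Proof.
move=> l0.
have H m : exists mu C, [/\ 0 < mu, 0 < C & forall k, (2 ^+ m) ^+ k * young_real lam k <= C * young_real mu k].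
  elim: m => [|m [mu [C [mu0 C0 h]]]].
    by exists lam, 1; split => // k; rewrite expr0 expr1n.
  have [nu [D [nu0 D0 h']]] := young_real_pow2 mu0.
  exists nu, (C * D); split; rewrite ?mulr_gt0// => k.
  rewrite exprS exprMn -mulrA.
  apply: (@le_trans _ _ (2 ^+ k * (C * young_real mu k))); first by rewrite -mulrA ler_wpM2l// exprn_ge0.
  by rewrite mulrCA ler_wpM2l// ltW.
have [m cm] : exists m, `|c| <= 2 ^+ m.
  exists (Num.bound `|c|); apply: le_trans (ltW (archi_boundP _)) _ => //.
  by rewrite -natrX ler_nat ltnW// ltn_expl.
have [mu [C [mu0 C0 h]]] := H m; exists mu, C; split => // k.
apply: le_trans (h k); rewrite ler_wpM2r ?young_real_ge0//.
by rewrite (le_trans (ler_norm _))// normrX lerXn2r// ?nnegrE// exprn_ge0.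
Qed.

Lemma omega_scale (m : nat) : exists2 L, 0 < L & forall t, 0 <= t ->
  omega (m%:R * t) <= L * (omega t + 1).
Proof.
have [L L0 h] := weight_alpha W.
suff [K K0 hK] : exists2 K, 0 < K & forall t, 0 <= t ->
    omega ((2 ^ m)%:R * t) <= K * (omega t + 1).
  exists K => // t t0; apply: le_trans (hK t t0).
  apply: (weight_nondecreasing W); first by rewrite mulr_ge0.
  by rewrite ler_wpM2r// ler_nat ltnW// ltn_expl.
elim: m => [|m [K K0 hK]].
  by exists 1 => // t t0; rewrite expn0 !mul1r; lra.
exists (L * (K + 1)) => [|t t0]; first by rewrite mulr_gt0// addr_gt0.
rewrite expnS natrM -mulrA; apply: (le_trans (h _ _)); first by rewrite mulr_ge0.
rewrite -mulrA ler_wpM2l ?(ltW L0)//.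
have := hK t t0; have := weight_ge0 W t0; nra.
Qed.

(** Chord slopes of a convex function increase, so the slopes of chords ending at [t] are bounded by
    those of chords starting at [t]; their supremum is a supporting slope. *)
Lemma subgradient t : exists s, forall x,
  omega (expR t) + s * (x - t) <= omega (expR x).
Proof.
pose phi x := omega (expR x).
have cvx x y z : x < y -> y < z ->
    (phi y - phi x) / (y - x) <= (phi z - phi y) / (z - y).
  move=> xy yz; have xz : x < z by exact: lt_trans yz.
  have z0 : z - x != 0 by rewrite subr_eq0 gt_eqF.
  have p0 : 0 <= (y - x) / (z - x) by rewrite divr_ge0// subr_ge0 ltW.
  have p1 : (y - x) / (z - x) <= 1 by rewrite ler_pdivrMr ?subr_gt0// mul1r lerD2r ltW.
  have := weight_delta W (Itv01 p0 p1) (in_setT (z : R^o)) (in_setT (x : R^o)).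
  have yE : (y - x) / (z - x) * z + (1 - (y - x) / (z - x)) * x = y by field.
  rewrite !convRE/= [X in omega (expR X)]yE => h; rewrite ler_pdivrMr ?subr_gt0// mulrAC ler_pdivlMr ?subr_gt0//.
  have hp : (y - x) / (z - x) * (z - x) = y - x by rewrite divfK.
  have := ler_wpM2l (ltW _ : 0 <= z - x) h; rewrite subr_gt0 => /(_ xz).
  move: hp; rewrite /unstable.onem; set p := (y - x) / (z - x) => hp.
  have e1 : p * (z - x) * phi z = (y - x) * phi z by rewrite hp.
  have e2 : p * (z - x) * phi x = (y - x) * phi x by rewrite hp.
  rewrite -/(phi x) -/(phi y) -/(phi z).
  lra.
pose A := [set (phi t - phi x) / (t - x) | x in [set x | x < t]].
have A0 : A !=set0 by exists ((phi t - phi (t - 1)) / (t - (t - 1))), (t - 1) => //=; lra.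
have Aub z : t < z -> ubound A ((phi z - phi t) / (z - t)).
  by move=> tz _ [x /= xt <-]; exact: cvx.
have Ab : has_ubound A.
  by exists ((phi (t + 1) - phi t) / (t + 1 - t)); apply: Aub; rewrite ltrDl.
exists (sup A) => x; rewrite -/(phi t) -/(phi x).
have [xt|tx|->] := ltgtP x t; last by rewrite subrr mulr0 addr0.
- have : A ((phi t - phi x) / (t - x)) by exists x.
  move=> /(ub_le_sup Ab); rewrite ler_pdivrMr ?subr_gt0//; lra.
- have := ge_sup A0 (Aub _ tx); rewrite ler_pdivlMr ?subr_gt0//; lra.
Qed.

(* At r = exp t the infimum in [young_real lam k] is nearly attained when k is the
   integer part of lam * s, with s a subgradient of phi at t. *)
Lemma weight_of_powers mu : 0 < mu -> exists lam D, [/\ 0 < lam, 0 < D &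
  forall r v C, 0 <= r -> 0 <= v ->
    (forall k, r ^+ k * v * young_real lam k <= C) -> v * expR (mu * omega r) <= D * C].
Proof.
move=> mu0; have [lam1 [C1 [l10 C10 hC1]]] := pow_weight 1.
pose lam := mu + lam1; have l0 : 0 < lam by exact: addr_gt0.
have D0 := expR_gt0 (mu * omega 1).
exists lam, (expR (mu * omega 1) + C1); split => [//||r v C r0 v0 h].
  by rewrite addr_gt0.
have y1 : 1 <= young_real lam 0.
  apply: le_young_real => // t t0; rewrite mul0r subr0 expR_ge1// mulr_ge0 ?(ltW l0)//.
  by rewrite (weight_ge0 W) ?expR_ge0.
have vC : v <= C.
  by apply: le_trans (h 0); rewrite expr0 mul1r ler_peMr.
have C0 : 0 <= C by exact: le_trans vC.
have [r1|r1] := leP r 1.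
  apply: (@le_trans _ _ (C * expR (mu * omega 1))).
    apply: ler_pM => //; rewrite ?expR_ge0//.
    by rewrite ler_expR ler_wpM2l ?(ltW mu0)// (weight_nondecreasing W).
  by rewrite mulrC mulrDl lerDl mulr_ge0// ltW.
have r'0 : 0 < r by exact: lt_trans r1.
pose t := ln r; have t0 : 0 < t by rewrite ln_gt0.
have rE : expR t = r by rewrite lnK ?posrE.
have [s hs] := subgradient t.
have s0 : 0 <= s.
  have := hs (t - 1); have : omega (expR (t - 1)) <= omega (expR t).
    by apply: omega_phi_le; rewrite lerBlDr lerDl.
  lra.
have ls0 : 0 <= lam * s by rewrite mulr_ge0// ltW.
pose k := Num.truncn (lam * s).
have kl : k%:R <= lam * s by rewrite truncn_le.
have kg : lam * s < k.+1%:R by rewrite truncnS_gt.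
(* The supporting line at [t] lies below the weight, and [k <= lam * s] makes the linear term left
   over in [x >= 0] nonnegative. *)
have yk : expR (lam * omega r - lam * s * t) <= young_real lam k.
  apply: le_young_real => // x x0; rewrite ler_expR -rE.
  have := ler_wpM2l (ltW l0) (hs x); have := ler_wpM2r x0 kl; lra.
have hk : expR (lam * omega r) <= r ^+ k * young_real lam k * r.
  rewrite -{2 3}rE -expRM_natl -(ler_pM2l (expR_gt0 (- (k.+1%:R * t)))).
  rewrite mulrAC -expRD mulrA -!expRD.
  rewrite (_ : - (k.+1%:R * t) + (k%:R * t + t) = 0); last by rewrite -natr1; lra.
  rewrite expR0 mul1r (le_trans _ yk)// ler_expR addrC lerD2l lerN2 ler_wpM2r ?ltW//.
have hr := hC1 r r0; rewrite expr1 in hr.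
have : v * expR (lam * omega r) <= C * r.
  apply: (@le_trans _ _ (v * (r ^+ k * young_real lam k * r))); first by rewrite ler_wpM2l.
  by rewrite (_ : v * _ = r ^+ k * v * young_real lam k * r) ?ler_wpM2r//; ring.
rewrite /lam mulrDl expRD mulrA => h1.
have h2 : v * expR (mu * omega r) * expR (lam1 * omega r) <=
    C * C1 * expR (lam1 * omega r).
  by apply: (le_trans h1); rewrite -mulrA ler_wpM2l.
move: h2; rewrite ler_pM2r ?expR_gt0// => /le_trans; apply.
by rewrite mulrC mulrDl lerDr mulr_ge0// expR_ge0.
Qed.

End WeightTheory.

(** * Kolmogorov's interpolation inequality on the half-line *)

Section Kolmogorov.
Context {R : realType}.
Implicit Types (F : nat -> R -> R) (p q : {poly R}).

(** A weighted l1 norm of the coefficients. It bounds each coefficient, and multiplication by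
    ['X - a] increases it by a factor of at most [c + |a|], so it is easily estimated on Lagrange
    basis polynomials. *)
Definition wnorm (c : R) p : R := \sum_(i < size p) `|p`_i| * c ^+ i.

Lemma wnorm_le (c : R) p m : (size p <= m)%N -> wnorm c p = \sum_(i < m) `|p`_i| * c ^+ i.
Proof.
move=> pm; rewrite /wnorm (big_ord_widen m (fun i => `|p`_i| * c ^+ i) pm).
rewrite [RHS](bigID (fun i : 'I_m => (i < size p)%N))/= [X in _ = _ + X]big1 ?addr0//.
by move=> i; rewrite -leqNgt => h; rewrite nth_default// normr0 mul0r.
Qed.

Lemma wnorm_coef (c : R) p k : 0 <= c -> `|p`_k| * c ^+ k <= wnorm c p.
Proof.
move=> c0; rewrite (wnorm_le c (leq_maxl (size p) k.+1)).
have km : (k < maxn (size p) k.+1)%N by rewrite leq_max leqnn orbT.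
rewrite (bigD1 (Ordinal km))//= lerDl sumr_ge0// => i _.
by rewrite mulr_ge0// exprn_ge0.
Qed.

Lemma wnorm_ge0 (c : R) p : 0 <= c -> 0 <= wnorm c p.
Proof. by move=> c0; rewrite sumr_ge0// => i _; rewrite mulr_ge0// exprn_ge0. Qed.

Lemma wnormD (c : R) p q : 0 <= c -> wnorm c (p + q) <= wnorm c p + wnorm c q.
Proof.
move=> c0; rewrite (wnorm_le c (leq_maxl (size p) (size q))) (wnorm_le c (leq_maxr (size p) (size q))).
rewrite (wnorm_le c (size_polyD p q)) -big_split ler_sum// => i _ /=.
by rewrite coefD -mulrDl ler_wpM2r ?exprn_ge0// ler_normD.
Qed.

Lemma wnormZ (c a : R) p : wnorm c (a *: p) = `|a| * wnorm c p.
Proof.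
rewrite (wnorm_le c (size_scale_leq a p)) mulr_sumr.
by apply: eq_bigr => i _; rewrite coefZ normrM mulrA.
Qed.

Lemma wnorm_sum (c : R) (I : Type) (r : seq I) (P : I -> {poly R}) : 0 <= c ->
  wnorm c (\sum_(i <- r) P i) <= \sum_(i <- r) wnorm c (P i).
Proof.
move=> c0; elim/big_rec2: _ => [|i x y _ h].
  by rewrite /wnorm size_poly0 big_ord0.
by apply: (le_trans (wnormD _ _ c0)); rewrite lerD2l.
Qed.

Lemma wnorm_MX (c : R) p : wnorm c (p * 'X) = c * wnorm c p.
Proof.
have s : (size (p * 'X)%R <= (size p).+1)%N.
  by apply: (leq_trans (size_polyMleq _ _)); rewrite size_polyX addn2.
rewrite (wnorm_le c s) big_ord_recl coefMX/= normr0 mul0r add0r mulr_sumr.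
by apply: eq_bigr => i _; rewrite coefMX/= /bump add1n/= exprS mulrCA.
Qed.

Lemma wnorm_prod (c : R) (I : Type) (r : seq I) (P : pred I) (x : I -> R) : 0 <= c ->
  wnorm c (\prod_(i <- r | P i) ('X - (x i)%:P)) <= \prod_(i <- r | P i) (c + `|x i|).
Proof.
move=> c0; elim/big_rec2: _ => [|i q y _ h].
  by rewrite /wnorm size_poly1 big_ord1 coef1/= normr1 mul1r.
rewrite mulrBl mul_polyC -scaleNr mulrDl mulrC; apply: (le_trans (wnormD _ _ c0)).
rewrite wnorm_MX wnormZ normrN; apply: lerD; first by rewrite ler_wpM2l.
by rewrite ler_wpM2l.
Qed.

Lemma prod_subn i : (\prod_(0 <= j < i) (i - j) = i`!)%N.
Proof.
elim: i => [|i ih]; first by rewrite big_geq.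
by rewrite big_nat_recl//= subn0 factS -ih; congr muln.
Qed.

Lemma prod_subn_gt i N : (\prod_(i.+1 <= j < N) (j - i) = (N - i.+1)`!)%N.
Proof.
rewrite -[X in (\prod_(X <= _ < _) _)%N]add0n big_addn fact_prod big_add1/=.
by apply: eq_big_nat => j _; rewrite addnS -addSn addnK.
Qed.

Lemma prod_dist N (i : 'I_N) :
  \prod_(j < N | j != i) `|i%:R - j%:R : R| = (i`! * (N - i.+1)`!)%:R.
Proof.
rewrite -(big_mkord (fun j => j != i :> nat) (fun j => `|i%:R - j%:R : R|)).
rewrite big_mkcond (@big_cat_nat _ _ _ i)//=; last exact: ltnW.
rewrite (@big_ltn _ _ _ i)// eqxx/= mul1r natrM -prod_subn -prod_subn_gt !natr_prod.
congr (_ * _); apply: eq_big_nat => j /andP[h1 h2].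
  by rewrite neq_ltn h2 natrB ?(ltnW h2)// ger0_norm// subr_ge0 ler_nat ltnW.
rewrite neq_ltn h1 orbT natrB ?(ltnW h1)// distrC ger0_norm//.
by rewrite subr_ge0 ler_nat ltnW.
Qed.

Lemma prod_addn N m : (\prod_(j < m) (N.+1 + j) * N`! = (N + m)`!)%N.
Proof.
elim: m => [|m ih]; first by rewrite big_ord0 mul1n addn0.
by rewrite big_ord_recr/= mulnAC ih addnS factS mulnC addSn.
Qed.

Lemma bin_le_exp2 n m : ('C(n, m) <= 2 ^ n)%N.
Proof.
have [mn|nm] := leqP m n; last by rewrite bin_small.
rewrite (_ : 2 = 1 + 1)%N// expnDn (bigD1 (inord m))//=.
by rewrite inordK// !exp1n !muln1 leq_addr.
Qed.

Lemma sum_bin n : (\sum_(i < n.+1) 'C(n, i) = 2 ^ n)%N.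
Proof.
by rewrite (_ : 2 = 1 + 1)%N// expnDn; apply: eq_bigr => i _; rewrite !exp1n !muln1.
Qed.

(** The sum dominates the [wnorm] of weight [N] of all Lagrange basis polynomials at the nodes
    [0, ..., N - 1]. Each numerator is at most the full product [N (N + 1) ... (2 N - 1)], the
    inverse denominators are binomial coefficients over [(N - 1)!], and the powers of 2 bounding
    everything stay below [2 ^ (4 N)]. *)
Lemma fact_bound N : (0 < N)%N ->
  \sum_(i < N) (\prod_(j < N | j != i) (N + j)%:R : R) / (i`! * (N - i.+1)`!)%:R <= 16 ^+ N.
Proof.
case: N => // N _.
pose P := (\prod_(j < N.+1) (N.+1 + j))%N.
have PE : (P = 'C(N + N.+1, N) * N.+1`!)%N.
  apply/eqP; rewrite -(eqn_pmul2r (fact_gt0 N)) prod_addn.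
  by rewrite -(bin_fact (leq_addr N.+1 N)) addKn mulnAC mulnA.
apply: (@le_trans _ _ (\sum_(i < N.+1) (P%:R / N`!%:R) * 'C(N, i)%:R : R)).
  apply: ler_sum => i _; rewrite -natr_prod subSS.
  have iN : (i <= N)%N by rewrite -ltnS.
  rewrite -mulrA ler_pM//.
    by rewrite ler_nat /P [leqRHS](bigD1 i)//= leq_pmull.
  have -> : N`!%:R = 'C(N, i)%:R * (i`! * (N - i)`!)%:R :> R by rewrite -natrM bin_fact.
  rewrite invfM mulrAC mulVf ?mul1r//.
  by rewrite pnatr_eq0 -lt0n bin_gt0.
rewrite -mulr_sumr -natr_sum sum_bin PE factS mulnA natrM mulfK ?pnatr_eq0 -?lt0n ?fact_gt0//.
rewrite -natrM -(natrX _ 16) ler_nat.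
apply: (@leq_trans (2 ^ (N + N.+1) * 2 ^ N.+1 * 2 ^ N)).
  rewrite leq_mul2r; apply/orP; right; apply: leq_mul; first exact: bin_le_exp2.
  exact/ltnW/ltn_expl.
by rewrite -!expnD (_ : 16 = 2 ^ 4)%N// -expnM leq_exp2l//; lia.
Qed.

(** The weight [N ^+ k] anticipates a rescaling of the nodes to spacing [h / N], which turns it into
    [h ^+ k]. *)
Lemma coef_bound N p (M : R) : (size p <= N)%N -> (0 < N)%N ->
  (forall j, (j < N)%N -> `|p.[j%:R]| <= M) ->
  forall k, `|p`_k| * N%:R ^+ k <= 16 ^+ N * M.
Proof.
move=> sp N0 h k.
have x_inj : injective (fun i : nat => i%:R : R) by move=> i j /eqP; rewrite eqr_nat => /eqP.
have M0 : 0 <= M by exact: le_trans (h 0%N N0).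
apply: (le_trans (wnorm_coef _ _ (ler0n _ _))).
rewrite [p in wnorm _ p](lagrange_gen N0 x_inj sp).
apply: (le_trans (wnorm_sum _ _ (ler0n _ _))).
apply: (@le_trans _ _ (\sum_(i < N) M * ((\prod_(j < N | j != i) (N + j)%:R : R) / (i`! * (N - i.+1)`!)%:R))); last first.
  by rewrite -mulr_sumr mulrC ler_wpM2r// fact_bound.
apply: ler_sum => i _; rewrite lagrangeE// !mul_polyC !wnormZ.
rewrite /=; apply: ler_pM => //; rewrite ?mulr_ge0 ?wnorm_ge0//; first exact: h.
rewrite mul_polyC wnormZ normfV horner_prod normr_prod.
under eq_bigr do rewrite hornerXsubC.
rewrite prod_dist mulrC ler_wpM2r ?invr_ge0//.
apply: (le_trans (wnorm_prod _ _ _ (ler0n _ _))).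
by apply: ler_prod => j _; rewrite natrD normr_nat lexx addr_ge0.
Qed.

Lemma derive_ge0_le (f df : R -> R) (x : R) : 0 <= x ->
  (forall s : R, is_derive s 1 f (df s)) -> (forall s, 0 <= s -> 0 <= df s) ->
  f 0 <= f x.
Proof.
move=> x0 fd d0; have fc : {within `[0, x], continuous f}.
  apply: continuous_subspaceT => s; apply/differentiable_continuous/derivable1_diffP.
  exact: (@ex_derive _ _ _ _ _ _ _ (fd s)).
have [c] := MVT_segment x0 (fun s _ => fd s) fc.
rewrite in_itv/= => /andP[c0 _] e; rewrite -subr_ge0 e subr0 mulr_ge0//.
exact: d0.
Qed.

Lemma is_derive_pow_fact N (B s : R) :
  is_derive s 1 (fun s => B * (s ^+ N.+1 / N.+1`!%:R)) (B * (s ^+ N / N`!%:R)).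
Proof.
pose p : {poly R} := (B / N.+1`!%:R) *: 'X^(N.+1).
rewrite (_ : (fun s => _) = horner p); last first.
  by apply/funext => t; rewrite /p hornerZ hornerXn; ring.
apply: is_derive_eq; rewrite /p derivZ derivXn hornerZ hornerMn hornerXn/=.
rewrite factS natrM -mulr_natr.
by field; rewrite nat1r !pnatr_eq0 -!lt0n fact_gt0.
Qed.

Definition taylor_poly F N : {poly R} := \poly_(i < N) (F i 0 / i`!%:R).

Lemma deriv_taylor_poly F N :
  (taylor_poly F N.+1)^`() = taylor_poly (fun i => F i.+1) N.
Proof.
apply/polyP => i; rewrite coef_deriv !coef_poly ltnS.
case: ifP => _; last by rewrite mul0rn.
rewrite factS natrM -mulr_natr; field.
by rewrite nat1r !pnatr_eq0 -!lt0n fact_gt0.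
Qed.

(** The derivative of the remainder is the remainder for the shifted sequence, and its bound is the
    derivative of the bound to be shown. Both vanish at 0, so monotonicity of sum and difference
    concludes. *)
Lemma taylor_bound N F (B x : R) :
  (forall i (s : R), is_derive s 1 (F i) (F i.+1 s)) ->
  (forall s, 0 <= s -> `|F N s| <= B) -> 0 <= x ->
  `|F 0%N x - (taylor_poly F N).[x]| <= B * (x ^+ N / N`!%:R).
Proof.
elim: N F x => [|N ih] F x Fd FB x0.
  rewrite /taylor_poly poly_def big_ord0 horner0 subr0 expr0 fact0 divr1 mulr1.
  exact: FB.
pose g s := F 0%N s - (taylor_poly F N.+1).[s].
pose dg s := F 1%N s - (taylor_poly (fun i => F i.+1) N).[s].
have g0 : g 0 = 0.
  by rewrite /g horner_coef0 coef_poly/= fact0 divr1 subrr.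
have gd (s : R) : is_derive s 1 g (dg s).
  by rewrite /dg -deriv_taylor_poly; exact: is_deriveB.
pose m s : R := B * (s ^+ N.+1 / N.+1`!%:R).
pose dm s : R := B * (s ^+ N / N`!%:R).
have md (s : R) : is_derive s 1 m (dm s) by exact: is_derive_pow_fact.
have m0 : m 0 = 0 by rewrite /m expr0n/= mul0r mulr0.
have dgm s : 0 <= s -> `|dg s| <= dm s.
  by move=> s0; exact: (ih (fun i => F i.+1)).
rewrite -/(g x) -/(m x) ler_norml; apply/andP; split.
  have H : (forall s, 0 <= s -> 0 <= dm s + dg s) -> m 0 + g 0 <= m x + g x.
    by move=> h; exact: (derive_ge0_le x0 (fun s => is_deriveD (md s) (gd s)) h).
  move: H; rewrite m0 g0 addr0.
  suff h : forall s, 0 <= s -> 0 <= dm s + dg s by move=> /(_ h); lra.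
  by move=> s s0; have := dgm s s0; rewrite ler_norml => /andP[]; lra.
have H : (forall s, 0 <= s -> 0 <= dm s - dg s) -> m 0 - g 0 <= m x - g x.
    by move=> h; exact: (derive_ge0_le x0 (fun s => is_deriveB (md s) (gd s)) h).
  move: H; rewrite m0 g0 subr0.
  suff h : forall s, 0 <= s -> 0 <= dm s - dg s by move=> /(_ h); lra.
by move=> s s0; have := dgm s s0; rewrite ler_norml => /andP[]; lra.
Qed.

(* The Taylor polynomial of degree < N at 0 is bounded at N equispaced points of
   [0, h], and Lagrange interpolation turns this into a bound on its coefficients. *)
Lemma kolmogorov_scaled F N k (A B h : R) : (0 < N)%N -> (k < N)%N -> 0 < h -> 0 <= A ->
  (forall i (s : R), is_derive s 1 (F i) (F i.+1 s)) ->
  (forall s, 0 <= s -> `|F 0%N s| <= A) ->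
  (forall s, 0 <= s -> `|F N s| <= B) ->
  `|F k 0| * h ^+ k <= k`!%:R * 16 ^+ N * (A + B * (h ^+ N / N`!%:R)).
Proof.
move=> N0 kN h0 A0 Fd FA FB.
have B0 : 0 <= B by exact: le_trans (FB 0 (lexx _)).
have NR0 : 0 < N%:R :> R by rewrite ltr0n.
pose eta := h / N%:R; have eta0 : 0 < eta by rewrite divr_gt0.
have hE : eta * N%:R = h by rewrite divfK ?gt_eqF.
(* The Taylor polynomial in the variable [s * eta], so that its nodes are the integers below [N]. *)
pose p : {poly R} := \poly_(i < N) (F i 0 / i`!%:R * eta ^+ i).
have pE s : p.[s] = (taylor_poly F N).[s * eta].
  rewrite !horner_poly; apply: eq_bigr => i _.
  by rewrite [(s * eta) ^+ i]exprMn [s ^+ i * _]mulrC mulrA.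
have pb j : (j < N)%N -> `|p.[j%:R]| <= A + B * (h ^+ N / N`!%:R).
  move=> jN; rewrite pE; set s := j%:R * eta.
  have s0 : 0 <= s by rewrite mulr_ge0// ltW.
  have sh : s <= h.
    by rewrite /s /eta mulrCA ler_piMr ?(ltW h0)// ler_pdivrMr// mul1r ler_nat ltnW.
  rewrite -[X in `|X|](subKr (F 0%N s)) (le_trans (ler_normB _ _))// lerD ?FA//.
  apply: (le_trans (taylor_bound Fd FB s0)).
  by rewrite ler_wpM2l// ler_wpM2r ?invr_ge0// lerXn2r ?nnegrE// ltW.
have := coef_bound (size_poly _ _) N0 pb k.
rewrite coef_poly kN !normrM normfV normr_nat normrX (gtr0_norm eta0).
rewrite -[X in X <= _](mulrA (_ / _)) -exprMn hE mulrAC ler_pdivrMr ?ltr0n ?fact_gt0//.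
by move=> /le_trans; apply; rewrite -[X in _ <= X]mulrA [X in _ <= X]mulrC.
Qed.

(** Minimizing over [x] would give the usual bound in [sqrt (A * B)]; a free [x] avoids roots and a
    separate case [B = 0]. *)
Lemma kolmogorov F k (A B x : R) : 0 < x -> 0 <= A ->
  (forall i (s : R), is_derive s 1 (F i) (F i.+1 s)) ->
  (forall s, 0 <= s -> `|F 0%N s| <= A) ->
  (forall s, 0 <= s -> `|F k.*2 s| <= B) ->
  `|F k 0| <= 256 ^+ k * (A / x + B * x).
Proof.
(* Interpolation needs [k < k.*2], so [k = 0] is apart: [A <= A / x] if [x <= 1], and [B <= B * x]
   otherwise. *)
move=> x0 A0 Fd FA FB; case: k FB => [|k] FB.
  rewrite expr0 mul1r.
  have h1 := FA 0 (lexx _); have h2 := FB 0 (lexx _).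
  have B0 : 0 <= B by exact: le_trans h2.
  have [x1|x1] := leP x 1.
    apply: (le_trans h1); apply: (@le_trans _ _ (A / x)).
      by rewrite ler_peMr// invf_ge1.
    by rewrite lerDl mulr_ge0// ltW.
  apply: (le_trans h2); apply: (@le_trans _ _ (B * x)).
    by rewrite ler_peMr// ltW.
  by rewrite lerDr divr_ge0// ltW.
set n := k.+1 in FB *.
have B0 : 0 <= B by exact: le_trans (FB 0 (lexx _)).
(* [h] solves [h ^+ n = x * n!]. Dividing by this leaves [A / x] in the first term, and
   [n! ^ 2 <= (2 n)!] leaves at most [B * x] in the second. *)
pose h := expR (ln (x * n`!%:R) / n%:R).
have h0 : 0 < h by exact: expR_gt0.
have n0 : 0 < n%:R :> R by rewrite ltr0n.
have f0 : 0 < n`!%:R :> R by rewrite ltr0n fact_gt0.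
have hn : h ^+ n = x * n`!%:R.
  by rewrite /h -expRM_natl mulrC divfK ?gt_eqF// lnK// posrE mulr_gt0.
have n2 : n.*2 = (n + n)%N by rewrite addnn.
have := @kolmogorov_scaled F n.*2 n A B h isT _ h0 A0 Fd FA FB.
rewrite -{1}addnn -{1}addSnnS leq_addr => /(_ isT).
rewrite n2 exprD [in h ^+ (_ + _)]exprD hn -exprMn (_ : 16 * 16 = 256 :> R); last by lra.
have hf : n`!%:R * n`!%:R / (n + n)`!%:R <= 1 :> R.
  rewrite ler_pdivrMr ?ltr0n ?fact_gt0// mul1r -natrM ler_nat.
  by rewrite -[X in (_ <= X)%N](bin_fact (leq_addr n n)) addKn leq_pmull// bin_gt0 leq_addr.
move=> hk; have : `|F n 0| * (x * n`!%:R) <= n`!%:R * 256 ^+ n * (A + B * x ^+ 2).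
  apply: (le_trans hk); rewrite ler_wpM2l ?mulr_ge0 ?exprn_ge0//.
  rewrite lerD2l ler_wpM2l// (_ : _ / _ = x ^+ 2 * (n`!%:R * n`!%:R / (n + n)`!%:R)); last by ring.
  by rewrite ler_piMr// sqr_ge0.
rewrite mulrA -[in X in _ <= X]mulrA [X in _ <= X]mulrC ler_pM2r//.
rewrite -ler_pdivlMr// => /le_trans; apply.
by rewrite -mulrA ler_wpM2l ?exprn_ge0// mulrDl expr2 mulrA mulfK ?gt_eqF.
Qed.

End Kolmogorov.

(** * Improper integrals on the line *)

Section Integrals1D.
Context {R : realType}.
Implicit Types (f g h H : R -> R).
Local Notation leb := (@lebesgue_measure R).

Lemma is_derive_derivable f (x d : R) : is_derive x 1 f d -> derivable f x 1.
Proof. by case. Qed.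

Lemma is_derive_continuous f (x d : R) : is_derive x 1 f d -> {for x, continuous f}.
Proof.
by move=> /is_derive_derivable dx; apply/differentiable_continuous/derivable1_diffP.
Qed.

Lemma integral_half_FTC h H (l : R) :
  (forall x : R, 0 <= x -> 0 <= h x) -> continuous h ->
  (forall x : R, is_derive x 1 H (h x)) ->
  H x @[x --> +oo] --> l ->
  (\int[leb]_(x in `[0%R, +oo[) (h x)%:E = (l - H 0)%:E)%E.
Proof.
move=> h0 ch dH Hl; rewrite EFinB; apply: ge0_continuous_FTC2y => //.
- exact: continuous_subspaceT.
- by apply: cvg_at_right_filter; exact: is_derive_continuous (dH 0).
- by move=> x _; rewrite derive1E; exact: (@derive_val _ _ _ _ _ _ _ (dH x)).
Qed.

Lemma integral_split0 h : (forall x, 0 <= h x) -> continuous h ->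
  (\int[leb]_x (h x)%:E = \int[leb]_(x in `[0%R, +oo[) (h x)%:E +
    \int[leb]_(x in `[0%R, +oo[) (h (- x))%:E)%E.
Proof.
move=> h0 ch.
have mh : measurable_fun [set: R] h by exact: continuous_measurable_fun.
rewrite -(setUv `[0, +oo[%classic) ge0_integral_setU//=; last 4 first.
- exact: measurableC.
- by apply/measurable_EFinP; rewrite setUv.
- by move=> x _; rewrite lee_fin.
- exact/disj_setPCl.
congr (_ + _)%E; rewrite setCitvr.
rewrite integral_itv_bndo_bndc; last exact/measurable_EFinP/measurable_funTS.
rewrite -{1}oppr0 ge0_integration_by_substitutionNy//.
exact: continuous_subspaceT.
Qed.

Lemma integral_FTC h H (l m : R) : (forall x, 0 <= h x) -> continuous h ->
  (forall x : R, is_derive x 1 H (h x)) ->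
  H x @[x --> +oo] --> l -> H x @[x --> -oo] --> m ->
  (\int[leb]_x (h x)%:E = (l - m)%:E)%E.
Proof.
move=> h0 ch dH Hl Hm; rewrite integral_split0// (integral_half_FTC _ _ dH Hl)//.
have dN (x : R) : is_derive x 1 (fun x => - H (- x)) (h (- x)).
  have := dH (- x) => dHx.
  have : is_derive x 1 (H \o -%R) (h (- x) * -1) by exact: is_derive1_comp.
  by move=> /is_deriveN; rewrite mulrN1 opprK.
have cN : continuous (h \o -%R).
  by move=> x; apply: continuous_comp; [exact: opp_continuous|exact: ch].
have lN : - H (- x) @[x --> +oo] --> - m by apply: cvgN; exact/cvgNy_compNP.
rewrite (integral_half_FTC _ cN dN lN)//.
  by rewrite -EFinD; congr EFin; rewrite oppr0; ring.
by move=> x _; exact: h0.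
Qed.

(** The antiderivative is [2 * atan ((t - c) / a)]. The value is the mass of the Poisson kernel,
    independent of its width and centre. *)
Lemma integral_atan_scaled (a c : R) : 0 < a ->
  (\int[leb]_t (2 * a / (a ^+ 2 + (t - c) ^+ 2))%:E = (2 * pi)%:E)%E.
Proof.
move=> a0.
have den t : a ^+ 2 + (t - c) ^+ 2 != 0.
  by rewrite gt_eqF// ltr_pwDl ?exprn_gt0// sqr_ge0.
pose H t := 2 * atan (a^-1 * (t - c)).
have lin (x : R) : is_derive x 1 (fun t : R => a^-1 * (t - c)) a^-1.
  have : is_derive x 1 (a^-1 \*: (id - cst c)) (a^-1 *: (1 - 0)).
    exact: is_deriveZ.
  by rewrite subr0 /GRing.scale/= mulr1.
have dH (t : R) : is_derive t 1 H (2 * a / (a ^+ 2 + (t - c) ^+ 2)).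
  have dl := lin t.
  have : is_derive t 1 (atan \o (fun t => a^-1 * (t - c)))
    ((1 + (a^-1 * (t - c)) ^+ 2)^-1 * a^-1) by exact: is_derive1_comp.
  move=> /(@is_deriveZ _ _ _ _ 2); rewrite /GRing.scale/=.
  move/is_derive_eq; apply.
  have a1 : a != 0 by rewrite gt_eqF.
  by field; rewrite den a1.
rewrite (@integral_FTC _ H pi (- pi) _ _ dH).
- by congr EFin; ring.
- by move=> t; rewrite divr_ge0 ?mulr_ge0 ?(ltW a0)// addr_ge0 ?sqr_ge0.
- move=> t; apply: cvgM; first exact: cvg_cst.
  apply: cvgV => //; apply: cvgD; first exact: cvg_cst.
  rewrite expr2; apply: cvgM; apply: cvgB; try exact: cvg_cst; exact: cvg_id.
- have -> : pi = 2 * (pi / 2) :> R by field.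
  apply: cvgM; first exact: cvg_cst.
  apply: (cvg_comp _ _ _ (@cvgy_atan R)).
  apply: gt0_cvgMry; first by rewrite invr_gt0.
  exact: cvg_addrr.
- have -> : - pi = 2 * (- (pi / 2)) :> R by field.
  apply: cvgM; first exact: cvg_cst.
  apply/cvgNy_compNP => /=.
  have -> : (fun x => atan (a^-1 * (- x - c))) = (fun x => - atan (a^-1 * (x + c))).
    by apply/funext => x; rewrite -atanN; congr atan; ring.
  apply: cvgN; apply: (cvg_comp _ _ _ (@cvgy_atan R)).
  apply: gt0_cvgMry; first by rewrite invr_gt0.
  exact: cvg_addrr.
Qed.

(* The summand 1 makes the integrand nonnegative, as the improper fundamental
   theorem of calculus requires. *)
Lemma integral_half_exp_cos (eps y th : R) : 0 < eps ->
  (\int[leb]_(x in `[0%R, +oo[) (expR (- (eps * x)) * (1 + cos (y * x - th)))%:E =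
   (eps^-1 + (eps * cos th + y * sin th) / (eps ^+ 2 + y ^+ 2))%:E)%E.
Proof.
move=> e0.
have den : eps ^+ 2 + y ^+ 2 != 0 by rewrite gt_eqF// ltr_pwDl ?exprn_gt0// sqr_ge0.
have e1 : eps != 0 by rewrite gt_eqF.
(* [- eps^-1] accounts for the summand 1; the fraction is the real part of
   [exp (i (y x - th)) / (i y - eps)]. *)
pose G x := - eps^-1 + (y * sin (y * x - th) - eps * cos (y * x - th)) / (eps ^+ 2 + y ^+ 2).
pose H x := expR (- (eps * x)) * G x.
have lin (a b x : R) : is_derive x 1 (fun t : R => a * t - b) a.
  have : is_derive x 1 (a \*: id - cst b) (a *: 1 - 0) by exact: is_deriveB.
  by rewrite subr0 /GRing.scale/= mulr1.
have dE (x : R) : is_derive x 1 (fun x => expR (- (eps * x))) (expR (- (eps * x)) * - eps).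
  have : is_derive x 1 (expR \o (fun t => - eps * t - 0)) (expR (- eps * x - 0) * - eps).
    by have := lin (- eps) 0 x => ?; exact: is_derive1_comp.
  rewrite subr0 mulNr (_ : _ \o _ = fun x => expR (- (eps * x)))//.
  by apply/funext => t /=; rewrite subr0 mulNr.
have dS (x : R) : is_derive x 1 (fun x => sin (y * x - th)) (cos (y * x - th) * y).
  by have := lin y th x => ?; exact: is_derive1_comp.
have dC (x : R) : is_derive x 1 (fun x => cos (y * x - th)) (- sin (y * x - th) * y).
  by have := lin y th x => ?; exact: is_derive1_comp.
have dH (x : R) : is_derive x 1 H (expR (- (eps * x)) * (1 + cos (y * x - th))).
  pose k := (eps ^+ 2 + y ^+ 2)^-1.
  have dG : is_derive x 1 G (0 + k *: (y *: (cos (y * x - th) * y) - eps *: (- sin (y * x - th) * y))).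
    rewrite (_ : G = cst (- eps^-1) + k \*: ((y \*: (fun x => sin (y * x - th))) - (eps \*: (fun x => cos (y * x - th))))).
      by apply: is_deriveD; apply: is_deriveZ; apply: is_deriveB; apply: is_deriveZ.
    by apply/funext => t; rewrite /G [X in _ + X]mulrC.
  have := is_deriveM (dE x) dG.
  rewrite (_ : _ * _ = H)//; move/is_derive_eq; apply.
  rewrite /GRing.scale/= /G /k; set E := expR _; set S := sin _; set C := cos _.
  by field; rewrite den e1.
have D0 : 0 <= (eps ^+ 2 + y ^+ 2)^-1 by rewrite invr_ge0 addr_ge0 ?sqr_ge0.
have He x : `|H x| <= (eps^-1 + (`|y| + eps) / (eps ^+ 2 + y ^+ 2)) * expR (- (eps * x)).
  rewrite /H normrM ger0_norm ?expR_ge0// mulrC ler_wpM2r ?expR_ge0//.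
  rewrite /G (le_trans (ler_normD _ _))// normrN gtr0_norm ?invr_gt0// lerD2l.
  rewrite normrM [X in _ * X]ger0_norm// ler_wpM2r//.
  rewrite (le_trans (ler_normB _ _))// !normrM (gtr0_norm e0) lerD//.
    by rewrite ler_piMr// ler_norml sin_geN1 sin_le1.
  by rewrite ler_piMr ?(ltW e0)// ler_norml cos_geN1 cos_le1.
have H0 : H x @[x --> +oo] --> (0 : R).
  apply: norm_cvg0; apply: (@squeeze_cvgr _ _ _ _ (cst 0)
    (fun x => (eps^-1 + (`|y| + eps) / (eps ^+ 2 + y ^+ 2)) * expR (- (eps * x)))).
  - by near=> x; rewrite /= normr_ge0 He.
  - exact: cvg_cst.
  - rewrite -[X in _ --> X](mulr0 (eps^-1 + (`|y| + eps) / (eps ^+ 2 + y ^+ 2))).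
    apply: cvgM; first exact: cvg_cst.
    apply: (cvg_comp _ _ _ (@cvgr_expR R)).
    by apply: gt0_cvgMry => //; exact: cvg_id.
rewrite (integral_half_FTC _ _ dH H0).
- congr EFin; rewrite /H /G !mulr0 oppr0 expR0 (sub0r th) sinN cosN.
  by field; rewrite den e1.
- by move=> x _; rewrite mulr_ge0 ?expR_ge0// -lerBlDl sub0r cos_geN1.
- move=> x; apply: cvgM; first exact: is_derive_continuous (dE x).
  apply: cvgD; first exact: cvg_cst.
  exact: is_derive_continuous (dC x).
Unshelve. all: by end_near. Qed.

(** The left half-line contributes the same integral with phase [- th], so the sine terms cancel and
    the Poisson kernel remains. *)
Lemma integral_exp_cos (eps y th : R) : 0 < eps ->
  (\int[leb]_x (expR (- (eps * `|x|)) * (1 + cos (y * x - th)))%:E =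
   (2 / eps + cos th * (2 * eps / (eps ^+ 2 + y ^+ 2)))%:E)%E.
Proof.
move=> e0; have den : eps ^+ 2 + y ^+ 2 != 0.
  by rewrite gt_eqF// ltr_pwDl ?exprn_gt0// sqr_ge0.
rewrite integral_split0; last 2 first.
- by move=> x; rewrite mulr_ge0 ?expR_ge0// -lerBlDl sub0r cos_geN1.
- move=> x; apply: cvgM.
    apply: (@continuous_comp _ _ _ (fun x => - (eps * `|x|)) expR).
      apply: cvgN; apply: cvgM; first exact: cvg_cst.
      exact: norm_continuous.
    exact: continuous_expR.
  apply: cvgD; first exact: cvg_cst.
  apply: (@continuous_comp _ _ _ (fun x => y * x - th) cos); last exact: continuous_cos.
  apply: cvgB; last exact: cvg_cst.
  by apply: cvgM; [exact: cvg_cst|exact: cvg_id].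
transitivity (\int[leb]_(x in `[0%R, +oo[) (expR (- (eps * x)) * (1 + cos (y * x - th)))%:E +
  \int[leb]_(x in `[0%R, +oo[) (expR (- (eps * x)) * (1 + cos (y * x - - th)))%:E)%E.
  congr (_ + _)%E; apply: eq_integral => x; rewrite inE/= in_itv/= andbT => x0.
    by rewrite ger0_norm.
  rewrite normrN ger0_norm//.
  by rewrite -[cos (y * x - - th)]cosN; congr (_ * (1 + cos _))%:E; ring.
rewrite !integral_half_exp_cos// -EFinD; congr EFin; rewrite cosN sinN; field.
by rewrite den gt_eqF.
Qed.

End Integrals1D.

(** * Integration over tuples, integration by parts and Fubini under a common majorant *)

Section TupleIntegrals.
Context {R : realType}.
Local Notation leb := (@lebesgue_measure R).
Local Notation TR := (measurableTypeR R).
Local Notation tcons := (@Defs.cons_tuple R _).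
Local Notation mu n := (@lebesgue_measure_tuple R n).

Lemma measurable_cons_tuple n : measurable_fun [set: TR * n.-tuple TR] (@Defs.cons_tuple R n).
Proof. by apply: measurable_cons. Qed.

Lemma row_ballE n (x y : 'rV[R]_n) e : 0 < e ->
  ball x e y <-> forall j, `|x 0 j - y 0 j| < e.
Proof.
move=> e0; split=> [|h].
  by rewrite /ball/= => -[_ h] j; exact: h.
by split => // i j; rewrite ord1; exact: h.
Qed.

(** Tuples carry the product sigma-algebra, rows the topology of the maximum norm. An open set is a
    countable union of balls with rational centre and radius, and each ball is a finite intersection
    of coordinate conditions. *)
Lemma open_measurable_row n (U : set 'rV[R]_n) : open U ->
  measurable ((@row_of_tuple R n) @^-1` U : set (n.-tuple TR)).
Proof.
move=> oU.
pose B (p : 'rV[rat]_n * rat) : set 'rV[R]_n :=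
  ball (map_mx ratr p.1 : 'rV[R]_n) (ratr p.2).
have -> : @row_of_tuple R n @^-1` U =
    \bigcup_(p in [set p | 0 < p.2 /\ B p `<=` U]) (@row_of_tuple R n @^-1` (B p)).
  apply/seteqP; split => [t Ut|t [p [_ pU]]]; last exact: pU.
  move: oU; rewrite openE => /(_ _ Ut) /nbhs_ballP[e /= e0 eU].
  have [r /= ] := @rat_in_itvoo R 0 (e / 2) (divr_gt0 e0 (ltr0Sn _ 1)).
  rewrite in_itv/= => /andP[r0 re].
  have hq j : {q : rat | `|ratr q - tnth t j| < (ratr r : R)}.
    apply: cid; have lt : tnth t j - ratr r < tnth t j + ratr r by lra.
    have [q] := rat_in_itvoo lt.
    by rewrite in_itv/= => /andP[h1 h2]; exists q; rewrite ltr_norml; lra.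
  exists (\row_j sval (hq j), r).
    split; first by rewrite -(ltr0q R).
    move=> y /row_ballE -/(_ r0) h; apply: eU; apply/row_ballE => // j.
    have := h j; rewrite !mxE; have := svalP (hq j) => h1 h2.
    rewrite (le_lt_trans (ler_distD (ratr (sval (hq j))) _ _))// distrC; lra.
  by apply/row_ballE => // j; rewrite !mxE; exact: svalP (hq j).
have mB p : 0 < p.2 -> measurable (@row_of_tuple R n @^-1` (B p) : set (n.-tuple TR)).
  move=> p0; have p0' : 0 < (ratr p.2 : R) by rewrite ltr0q.
  have -> : @row_of_tuple R n @^-1` (B p) = \bigcap_(j in [set: 'I_n])
      ((fun t : n.-tuple TR => tnth t j) @^-1` (ball (ratr (p.1 0 j) : R) (ratr p.2))).
    apply/seteqP; split => [t /= /(row_ballE _ _ p0') h j _|t h].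
      by have := h j; rewrite !mxE.
    by apply/row_ballE => // j; have := h j I; rewrite !mxE.
  apply: fin_bigcap_measurable; first exact: finite_finset.
  move=> j _; rewrite -[X in measurable X]setTI; apply: measurable_tnth => //.
  exact: measurable_ball.
rewrite bigcup_mkcond; apply: countable_bigcupT_measurable => [|p].
  exact: countableP.
by case: ifPn => // /[1!inE] -[p0 _]; exact: mB.
Qed.

Lemma continuous_measurable_row n (F : 'rV[R]_n -> R) : continuous F ->
  measurable_fun [set: n.-tuple TR] (F \o @row_of_tuple R n).
Proof.
move=> cF; apply: (measurability _ (RGenOInfty.measurableE R)) => //.
move=> /= _ [_ [x ->] <-]; rewrite setTI comp_preimage.
by apply: open_measurable_row; apply: open_comp => //; move=> y _; exact: cF.
Qed.

Lemma ge0_integral_tupleS n (f : n.+1.-tuple TR -> \bar R) :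
  measurable_fun setT f -> (forall t, 0 <= f t)%E ->
  (\int[mu n.+1]_t f t = \int[leb]_x \int[mu n]_t f (tcons (x, t)))%E.
Proof.
move=> mf f0.
have E := @ge0_integral_pushforward _ _ _ _ R _ (@measurable_cons_tuple n)
  (leb \x mu n)%E setT f measurableT mf (fun t _ => f0 t).
apply: (eq_trans E); rewrite preimage_setT fubini_tonelli1//.
  exact: measurableT_comp mf (@measurable_cons_tuple n).
by move=> x; exact: f0.
Qed.

Lemma integral_tupleS n (f : n.+1.-tuple TR -> \bar R) :
  (mu n.+1).-integrable setT f ->
  (\int[mu n.+1]_t f t = \int[leb]_x \int[mu n]_t f (tcons (x, t)) /\
   \int[mu n.+1]_t f t = \int[mu n]_t \int[leb]_x f (tcons (x, t)))%E.
Proof.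
move=> fi; have mf := measurable_int _ fi.
have mfc : measurable_fun setT (f \o @Defs.cons_tuple R n).
  exact: measurableT_comp mf (@measurable_cons_tuple n).
have fi' : (leb \x mu n)%E.-integrable setT (f \o @Defs.cons_tuple R n).
  apply/integrableP; split => //.
  have /integrableP[_] := fi.
  have maf : measurable_fun setT (abse \o f) by exact: measurableT_comp.
  have E := @ge0_integral_pushforward _ _ _ _ R _ (@measurable_cons_tuple n)
    (leb \x mu n)%E setT (abse \o f) measurableT maf (fun t _ => abse_ge0 _).
  by apply: le_lt_trans; rewrite le_eqVlt; apply/orP; left; apply/eqP; exact/esym.
have E : (\int[mu n.+1]_t f t = \int[leb \x mu n]_z f (tcons z))%E.
  exact: (@integral_pushforward _ _ _ _ R _ (@measurable_cons_tuple n)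
    (leb \x mu n)%E setT f mf fi' measurableT).
rewrite E; split.
  by rewrite -(integral12_prod_meas1 fi').
by rewrite -(integral21_prod_meas1 fi').
Qed.

Lemma tnth_tcons0 n (x : R) (t : n.-tuple TR) : tnth (tcons (x, t)) ord0 = x.
Proof. by []. Qed.

Lemma tnth_tconsS n (x : R) (t : n.-tuple TR) i : tnth (tcons (x, t)) (lift ord0 i) = tnth t i.
Proof. exact: tnthS. Qed.

Lemma measurable_tuple_prod n (h : 'I_n -> R -> R) :
  (forall i, measurable_fun setT (h i)) ->
  measurable_fun setT (fun t : n.-tuple TR => \prod_i h i (tnth t i)).
Proof.
move=> mh; apply: measurable_prod => i _.
exact: measurableT_comp (mh i) (measurable_tnth i).
Qed.

Lemma integral_tuple_prod n (h : 'I_n -> R -> R) (c : 'I_n -> R) :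
  (forall i, measurable_fun setT (h i)) -> (forall i x, 0 <= h i x) ->
  (forall i, \int[leb]_x (h i x)%:E = (c i)%:E)%E ->
  (\int[mu n]_t (\prod_i h i (tnth t i))%:E = (\prod_i c i)%:E)%E.
Proof.
elim: n h c => [|n ih] h c mh h0 hc.
  rewrite big_ord0; apply: (eq_trans (integral_dirac _ _ _)) => //.
    by apply/measurable_EFinP; exact: measurable_tuple_prod.
  by rewrite big_ord0 diracE mem_set// mul1e.
have c0 i : 0 <= c i.
  by rewrite -lee_fin -hc integral_ge0// => x _; rewrite lee_fin.
rewrite ge0_integral_tupleS; last 2 first.
- by apply/measurable_EFinP; exact: measurable_tuple_prod.
- by move=> t; rewrite lee_fin prodr_ge0.
under eq_integral => x _.
  under eq_integral => t _.
    rewrite big_ord_recl tnth_tcons0.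
    under eq_bigr do rewrite tnth_tconsS.
    rewrite EFinM; over.
  rewrite ge0_integralZl//; last 3 first.
  - apply/measurable_EFinP.
    exact: (measurable_tuple_prod (h := fun i => h (lift ord0 i))).
  - by move=> t _; rewrite lee_fin prodr_ge0.
  - by rewrite lee_fin.
  rewrite (ih (fun i => h (lift ord0 i)) (fun i => c (lift ord0 i)))//.
  over.
rewrite ge0_integralZr//; last 3 first.
- by apply/measurable_EFinP; exact: mh.
- by move=> x _; rewrite lee_fin.
- by rewrite lee_fin prodr_ge0.
by rewrite hc -EFinM big_ord_recl.
Qed.

(** Positive, integrable and multiplicative over the coordinates: a bound by a multiple of it keeps
    this shape when a coordinate is frozen, which suits induction on the dimension. *)
Definition cauchy_weight n (t : n.-tuple TR) : R := \prod_i (1 + tnth t i ^+ 2)^-1.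

Lemma cauchy_weight_gt0 n (t : n.-tuple TR) : 0 < cauchy_weight t.
Proof. by apply: prodr_gt0 => i _; rewrite invr_gt0 ltr_pwDl// sqr_ge0. Qed.

Lemma cauchy_weight_tcons n (x : R) (t : n.-tuple TR) :
  cauchy_weight (tcons (x, t)) = (1 + x ^+ 2)^-1 * cauchy_weight t.
Proof.
rewrite /cauchy_weight big_ord_recl tnth_tcons0; congr (_ * _).
by apply: eq_bigr => i _; rewrite tnth_tconsS.
Qed.

Lemma cvg_oneDsqrV : (1 + x ^+ 2)^-1 @[x --> +oo] --> (0 : R).
Proof.
apply/gtr0_cvgV0; first by near=> x; rewrite ltr_pwDl// sqr_ge0.
apply: (cvg_comp _ _ (@cvgr_expr2 R)).
exact: cvg_addrl.
Unshelve. all: by end_near. Qed.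

Lemma measurable_oneDsqrV : measurable_fun setT (fun x : R => (1 + x ^+ 2)^-1).
Proof. by apply: continuous_measurable_fun; exact: continuous_oneDsqrV. Qed.

Lemma integral_oneDsqrV : (\int[leb]_x ((1 + x ^+ 2)^-1)%:E = (pi : R)%:E)%E.
Proof.
have d (x : R) : is_derive x 1 (@atan R) (1 + x ^+ 2)^-1 by exact: is_derive1_atan.
rewrite (integral_FTC _ _ d (@cvgy_atan R) (m := - (pi / 2))).
- by congr EFin; field.
- by move=> x; rewrite invr_ge0 addr_ge0// sqr_ge0.
- exact: continuous_oneDsqrV.
- apply/cvgNy_compNP; rewrite (_ : _ \o _ = (fun x => - atan x)).
    by apply: cvgN; exact: cvgy_atan.
  by apply/funext => x; rewrite /= atanN.
Qed.

Lemma integral_cauchy_weight n :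
  (\int[mu n]_t (cauchy_weight t)%:E = (pi ^+ n)%:E)%E.
Proof.
rewrite (integral_tuple_prod (h := fun _ x => (1 + x ^+ 2)^-1) (c := fun=> pi)) //.
- by rewrite prodr_const card_ord.
- by move=> _; exact: measurable_oneDsqrV.
- by move=> _ x; rewrite invr_ge0 addr_ge0// sqr_ge0.
- by move=> _; exact: integral_oneDsqrV.
Qed.

Lemma measurable_cauchy_weight n : measurable_fun setT (@cauchy_weight n).
Proof. by apply: (measurable_tuple_prod (h := fun _ x => (1 + x ^+ 2)^-1)) => _; exact: measurable_oneDsqrV. Qed.

Lemma integrable_cauchy_weight n (C : R) :
  (mu n).-integrable setT (fun t => (C * cauchy_weight t)%:E).
Proof.
have : (mu n).-integrable setT (fun t => (cauchy_weight t)%:E).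
  apply/integrableP; split.
    by apply/measurable_EFinP; exact: measurable_cauchy_weight.
  under eq_integral do rewrite gee0_abs ?lee_fin ?(ltW (cauchy_weight_gt0 _))//.
  by rewrite integral_cauchy_weight ltry.
by move=> /(integrableZl measurableT C).
Qed.

Lemma integrable_dominated n (f : n.-tuple TR -> R) (C : R) :
  measurable_fun setT f -> (forall t, `|f t| <= C * cauchy_weight t) ->
  (mu n).-integrable setT (EFin \o f).
Proof.
move=> mf fC; apply: le_integrable (integrable_cauchy_weight n C) => //.
  exact/measurable_EFinP.
by move=> t _; rewrite lee_fin (le_trans (fC t))// ler_norm.
Qed.

Lemma normr_integral_dominated n (f : n.-tuple TR -> R) (C : R) :
  measurable_fun setT f -> (forall t, `|f t| <= C * cauchy_weight t) ->
  `|(\int[mu n]_t f t)%R| <= C * pi ^+ n.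
Proof.
move=> mf fC; have fi := integrable_dominated mf fC.
apply: (le_trans (le_normr_Rintegral _ fi)) => //.
have -> : C * pi ^+ n = (\int[mu n]_t (C * cauchy_weight t))%R.
  rewrite RintegralZl//; last first.
    by have := integrable_cauchy_weight n 1; under eq_fun do rewrite mul1r.
  by rewrite /Rintegral integral_cauchy_weight.
apply: le_Rintegral => //; last exact: integrable_cauchy_weight.
exact: (integrable_norm fi).
Qed.

(** Since [g] may change sign, the nonnegative [g + C / (1 + x^2)] is integrated, with
    antiderivative [f + C * atan]. As [f] vanishes at both ends, the total is exactly the integral
    of the added term. *)
Lemma integral_derivative_eq0 (f g : R -> R) (C : R) :
  (forall x : R, is_derive x 1 f (g x)) -> continuous g ->
  (forall x, `|f x| <= C * (1 + x ^+ 2)^-1) ->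
  (forall x, `|g x| <= C * (1 + x ^+ 2)^-1) ->
  (\int[leb]_x (g x)%:E = 0)%E.
Proof.
move=> df cg fC gC.
have C0 : 0 <= C.
  by have := le_trans (normr_ge0 _) (fC 0); rewrite expr0n/= addr0 invr1 mulr1.
have f0 : f x @[x --> +oo] --> (0 : R).
  apply: norm_cvg0; apply: (@squeeze_cvgr _ _ _ _ (cst 0) (fun x => C * (1 + x ^+ 2)^-1)).
  - by near=> x; rewrite /= normr_ge0 fC.
  - exact: cvg_cst.
  - by rewrite -[X in _ --> X](mulr0 C); apply: cvgM; [exact: cvg_cst|exact: cvg_oneDsqrV].
have f0' : f x @[x --> -oo] --> (0 : R).
  apply/cvgNy_compNP => /=.
  apply: norm_cvg0; apply: (@squeeze_cvgr _ _ _ _ (cst 0) (fun x => C * (1 + x ^+ 2)^-1)).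
  - by near=> x; rewrite /= normr_ge0 -[X in 1 + X]sqrrN fC.
  - exact: cvg_cst.
  - by rewrite -[X in _ --> X](mulr0 C); apply: cvgM; [exact: cvg_cst|exact: cvg_oneDsqrV].
pose k x : R := C * (1 + x ^+ 2)^-1.
have ck : continuous k.
  by move=> x; apply: cvgM; [exact: cvg_cst|exact: continuous_oneDsqrV].
have mg : measurable_fun setT g by exact: continuous_measurable_fun.
have mk : measurable_fun setT k by exact: continuous_measurable_fun.
have ik : leb.-integrable setT (EFin \o k).
  have /(integrableZl measurableT C)// : leb.-integrable setT (fun x : R => ((1 + x ^+ 2)^-1)%:E).
  apply/integrableP; split; first by apply/measurable_EFinP; exact: measurable_oneDsqrV.
  under eq_integral do rewrite gee0_abs ?lee_fin ?invr_ge0 ?addr_ge0 ?sqr_ge0//.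
  by rewrite integral_oneDsqrV ltry.
have ig : leb.-integrable setT (EFin \o g).
  apply: le_integrable ik => //; first exact/measurable_EFinP.
  by move=> x _; rewrite lee_fin (le_trans (gC x))// ler_norm.
have dH (x : R) : is_derive x 1 (f + C \*: @atan R) (g x + k x).
  have da : is_derive x 1 (@atan R) (1 + x ^+ 2)^-1 by exact: is_derive1_atan.
  by apply: is_deriveD; exact: is_deriveZ.
have H1 : (f + C \*: @atan R) x @[x --> +oo] --> 0 + C * (pi / 2).
  by apply: cvgD => //; apply: cvgM; [exact: cvg_cst|exact: cvgy_atan].
have H2 : (f + C \*: @atan R) x @[x --> -oo] --> 0 + C * - (pi / 2).
  apply: cvgD => //; apply: cvgM; first exact: cvg_cst.
  apply/cvgNy_compNP; rewrite (_ : _ \o _ = (fun x => - atan x)).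
    by apply: cvgN; exact: cvgy_atan.
  by apply/funext => x; rewrite /= atanN.
have := integral_FTC _ _ dH H1 H2.
rewrite (_ : (fun x => (g x + k x)%:E) = (fun x => (g x)%:E + (k x)%:E)%E)//.
have -> : (\int[leb]_x (((g x)%:E + (k x)%:E)))%E = (\int[leb]_x (g x)%:E + \int[leb]_x (k x)%:E)%E.
  exact: integralD.
have -> : (\int[leb]_x (k x)%:E = (C * pi)%:E)%E.
  under eq_integral do rewrite EFinM.
  rewrite ge0_integralZl ?lee_fin//.
  - by rewrite integral_oneDsqrV.
  - by apply/measurable_EFinP; exact: measurable_oneDsqrV.
  - by move=> x _; rewrite lee_fin invr_ge0 addr_ge0// sqr_ge0.
have -> : 0 + C * (pi / 2) - (0 + C * - (pi / 2)) = C * pi :> R by field.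
have gf := integrable_fin_num measurableT ig.
have gk0 x : 0 <= g x + k x.
  by have := gC x; rewrite -/(k x) ler_norml => /andP[h _]; rewrite -lerBlDr sub0r.
have gkc : continuous (fun x => g x + k x).
  by move=> x; apply: cvgD; [exact: cg|exact: ck].
move=> /(_ gk0 gkc); move: gf; case: (\int[leb]_x (g x)%:E)%E => [r _|//|//].
by move=> [] h; congr EFin; lra.
Unshelve. all: by end_near. Qed.

Definition upd n (t : n.-tuple TR) (j : 'I_n) (s : R) : n.-tuple TR :=
  [tuple if i == j then s else tnth t i | i < n].

Lemma upd_tcons0 n (x s : R) (t : n.-tuple TR) : upd (tcons (x, t)) ord0 s = tcons (s, t).
Proof.
apply: eq_from_tnth => i; rewrite tnth_mktuple.
case: (unliftP ord0 i) => [k|] ->; last by rewrite eqxx tnth_tcons0.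
by rewrite eq_sym (negbTE (neq_lift _ _)) !tnth_tconsS.
Qed.

Lemma upd_tconsS n (x s : R) (t : n.-tuple TR) j :
  upd (tcons (x, t)) (lift ord0 j) s = tcons (x, upd t j s).
Proof.
apply: eq_from_tnth => i; rewrite tnth_mktuple.
case: (unliftP ord0 i) => [k|] ->; last by rewrite (negbTE (neq_lift _ _)) !tnth_tcons0.
by rewrite (inj_eq lift_inj) !tnth_tconsS tnth_mktuple.
Qed.

Lemma measurable_tcons2 n (x : R) :
  measurable_fun setT (fun t : n.-tuple TR => tcons (x, t)).
Proof.
apply: (measurableT_comp (@measurable_cons_tuple n)).
exact: (measurable_pair1 (x : TR)).
Qed.

(** If [j] is the first coordinate, it is integrated innermost and the one-variable case applies;
    otherwise the induction hypothesis annihilates the inner integral over the remaining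
    coordinates. *)
Lemma integral_partial_eq0 n (f g : n.-tuple TR -> R) (C : R) (j : 'I_n) :
  measurable_fun setT g ->
  (forall t (s : R), is_derive s 1 (fun s => f (upd t j s)) (g (upd t j s))) ->
  (forall t, continuous (fun s => g (upd t j s))) ->
  (forall t, `|f t| <= C * cauchy_weight t) ->
  (forall t, `|g t| <= C * cauchy_weight t) ->
  (\int[mu n]_t (g t)%:E = 0)%E.
Proof.
elim: n f g C j => [|n ih] f g C j mg df cg fC gC; first by case: j cg df.
have ig := integrable_dominated mg gC.
have [E1 E2] := integral_tupleS ig.
have up0 x s t : upd (tcons (x, t)) ord0 s = tcons (s, t) by exact: upd_tcons0.
case: (unliftP ord0 j) => [k|] jE; rewrite {}jE in df cg *.
  rewrite [LHS]E1; apply: integral0_eq => x _.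
  apply: (ih (fun t => f (tcons (x, t))) (fun t => g (tcons (x, t))) (C * (1 + x ^+ 2)^-1) k).
  - exact: measurableT_comp mg (measurable_tcons2 x).
  - move=> t s; have := df (tcons (x, t)) s; rewrite upd_tconsS.
    by under eq_fun do rewrite upd_tconsS.
  - by move=> t; have := cg (tcons (x, t)); under eq_fun do rewrite upd_tconsS.
  - by move=> t; rewrite -mulrA -cauchy_weight_tcons.
  - by move=> t; rewrite -mulrA -cauchy_weight_tcons.
rewrite [LHS]E2; apply: integral0_eq => t _.
apply: (@integral_derivative_eq0 (fun x => f (tcons (x, t))) _ (C * cauchy_weight t)).
- move=> x; have := df (tcons (0, t)) x; rewrite up0.
  by under eq_fun do rewrite up0.
- by have := cg (tcons (0, t)); under eq_fun do rewrite up0.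
- by move=> x; rewrite mulrAC -mulrA -cauchy_weight_tcons.
- by move=> x; rewrite mulrAC -mulrA -cauchy_weight_tcons.
Qed.

Lemma integrable_prod_dominated n (F : n.-tuple TR * n.-tuple TR -> R) (C : R) :
  measurable_fun setT F ->
  (forall x y, `|F (x, y)| <= C * cauchy_weight x * cauchy_weight y) ->
  (mu n \x mu n)%E.-integrable setT (EFin \o F).
Proof.
move=> mF FC.
have m1 x : measurable_fun setT (fun y => F (x, y)).
  exact: measurableT_comp mF (measurable_pair1 x).
apply/integrable12ltyP; first exact/measurable_EFinP.
have : (mu n).-integrable setT (fun x => (C * pi ^+ n * cauchy_weight x)%:E).
  exact: integrable_cauchy_weight.
move=> /integrableP[_]; apply: le_lt_trans; apply: ge0_le_integral => //.
- by move=> x _; exact: integral_ge0.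
- apply: (measurable_fun_fubini_tonelli_F (fun z => `|(F z)%:E|%E)) => //.
  by apply: measurableT_comp => //; exact/measurable_EFinP.
- apply: measurableT_comp => //; apply/measurable_EFinP.
  by apply: measurable_funM => //; exact: measurable_cauchy_weight.
move=> x _; apply: (@le_trans _ _ (\int[mu n]_y (C * cauchy_weight x * cauchy_weight y)%:E)%E).
  apply: ge0_le_integral => //.
  - by apply: measurableT_comp => //; exact/measurable_EFinP.
  - apply/measurable_EFinP; apply: measurable_funM => //; exact: measurable_cauchy_weight.
  - by move=> y _; rewrite lee_fin FC.
under eq_integral do rewrite EFinM.
have C0 : 0 <= C * cauchy_weight x.
  have := le_trans (normr_ge0 _) (FC x x).
  by rewrite pmulr_lge0// cauchy_weight_gt0.
rewrite ge0_integralZl//.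
- by rewrite integral_cauchy_weight -EFinM mulrAC; rewrite lee_fin ler_norm.
- by apply/measurable_EFinP; exact: measurable_cauchy_weight.
- by move=> y _; rewrite lee_fin ltW// cauchy_weight_gt0.
Qed.

Lemma measurable_integral_dominated n (F : n.-tuple TR * n.-tuple TR -> R) (C : R) :
  measurable_fun setT F ->
  (forall x y, `|F (x, y)| <= C * cauchy_weight x * cauchy_weight y) ->
  measurable_fun setT (fun y => (\int[mu n]_x F (x, y))%R).
Proof.
move=> mF FC.
have := measurable_fubini_G (integrable_prod_dominated mF FC).
move=> mG; apply/measurable_EFinP; rewrite (_ : _ \o _ = fubini_G (mu n) (EFin \o F))//.
have m2 y : measurable_fun setT (fun x => F (x, y)).
  exact: measurableT_comp mF (measurable_pair2 y).
have FC' x y : `|F (x, y)| <= C * cauchy_weight y * cauchy_weight x by rewrite mulrAC.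
apply/funext => y; rewrite /= /Rintegral fineK//.
exact: integrable_fin_num (integrable_dominated (m2 y) (FC'^~ y)).
Qed.

Lemma fubini_dominated n (F : n.-tuple TR * n.-tuple TR -> R) (C : R) :
  measurable_fun setT F ->
  (forall x y, `|F (x, y)| <= C * cauchy_weight x * cauchy_weight y) ->
  (\int[mu n]_x (\int[mu n]_y F (x, y)) = \int[mu n]_y (\int[mu n]_x F (x, y)))%R.
Proof.
move=> mF FC.
have FC' x y : `|F (x, y)| <= C * cauchy_weight y * cauchy_weight x.
  by rewrite mulrAC.
have m1 x : measurable_fun setT (fun y => F (x, y)).
  exact: measurableT_comp mF (measurable_pair1 x).
have m2 y : measurable_fun setT (fun x => F (x, y)).
  exact: measurableT_comp mF (measurable_pair2 y).
have iF := integrable_prod_dominated mF FC.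
have := Fubini iF.
rewrite /Rintegral => E; congr fine.
transitivity (\int[mu n]_x \int[mu n]_y (F (x, y))%:E)%E.
  apply: eq_integral => x _; rewrite fineK//.
  exact: integrable_fin_num (integrable_dominated (m1 x) (FC x)).
rewrite [LHS]E; apply: eq_integral => y _; rewrite fineK//.
exact: integrable_fin_num (integrable_dominated (m2 y) (FC'^~ y)).
Qed.

End TupleIntegrals.

(** * Mean value estimates and directional derivatives *)

Section Lipschitz.
Context {R : realType}.

Lemma mvt_bound (f df : R -> R) (a b : R) : (forall x : R, is_derive x 1 f (df x)) ->
  exists2 c, `|c - a| <= `|b - a| & f b - f a = df c * (b - a).
Proof.
move=> d; have cf : continuous f by move=> x; exact: is_derive_continuous (d x).
have [ab|/ltW ba] := leP a b.
  have [c] := MVT_segment ab (fun x _ => d x) (continuous_subspaceT cf).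
  rewrite in_itv/= => /andP[ac cb] e; exists c => //.
  by rewrite !ger0_norm ?subr_ge0// lerB.
have [c] := MVT_segment ba (fun x _ => d x) (continuous_subspaceT cf).
rewrite in_itv/= => /andP[ac cb] e; exists c.
  by rewrite !ler0_norm ?subr_le0// lerN2 lerB.
by rewrite -opprB e -mulrN opprB.
Qed.

Lemma cos_lip (a b : R) : `|cos b - cos a| <= `|b - a|.
Proof.
have [c _ ->] := mvt_bound a b (@is_derive_cos R).
by rewrite normrM ler_piMl// normrN ler_norml sin_geN1 sin_le1.
Qed.

Lemma sin_lip (a b : R) : `|sin b - sin a| <= `|b - a|.
Proof.
have [c _ ->] := mvt_bound a b (@is_derive_sin R).
by rewrite normrM ler_piMl// ler_norml cos_geN1 cos_le1.
Qed.

Lemma cos_taylor (z h : R) : `|cos (z + h) - cos z + h * sin z| <= h ^+ 2.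
Proof.
have [c cz ->] := mvt_bound z (z + h) (@is_derive_cos R).
rewrite addrAC subrr add0r in cz *.
rewrite (_ : _ + _ = (sin z - sin c) * h); last by ring.
rewrite normrM -[h ^+ 2]ger0_norm ?sqr_ge0// normrX expr2 ler_wpM2r//.
by rewrite (le_trans (sin_lip _ _))// distrC.
Qed.

(** With a remainder quadratic in [h], differentiating an integral comes down to one pointwise
    estimate of the integrand, with no passage to the limit under the integral sign. *)
Lemma is_derive_quadratic (V : normedModType R) (F : V -> R) (x v : V) (d K : R) :
  (forall h : R, `|F (h *: v + x) - F x - h * d| <= K * h ^+ 2) ->
  is_derive x v F d.
Proof.
move=> FK.
have K0 : 0 <= K by have := le_trans (normr_ge0 _) (FK 1); rewrite expr1n mulr1.
have H : (h^-1 *: ((F \o shift x) (h *: v) - F x)) @[h --> 0^'] --> d.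
  apply/cvgrPdist_le => e e0; near=> h; rewrite distrC.
  have h0 : h != 0 by near: h; exact: nbhs_dnbhs_neq.
  have -> : h^-1 *: ((F \o shift x) (h *: v) - F x) - d = h^-1 * (F (h *: v + x) - F x - h * d).
    by rewrite [RHS]mulrBr mulrA mulVf// mul1r.
  rewrite normrM normfV ler_pdivrMl ?normr_gt0//.
  rewrite (le_trans (FK h))// -[h ^+ 2]ger0_norm ?sqr_ge0// normrX expr2 mulrCA ler_wpM2l//.
  have hK : `|h| <= e / (K + 1).
    near: h; apply: dnbhs0_le; rewrite divr_gt0// ltr_wpDl//.
  rewrite (le_trans (ler_wpM2l K0 hK))// mulrA ler_pdivrMr ?ltr_wpDl// mulrC ler_wpM2l ?(ltW e0)//.
  by rewrite lerDl.
by split; [apply/cvg_ex; exists d|exact: cvg_lim H].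
Unshelve. all: by end_near. Qed.

Lemma is_derive_line (V : normedModType R) (F : V -> R) (v e : V) (s : R) :
  derivable F (v + s *: e) e ->
  is_derive s 1 (fun s : R => F (v + s *: e)) ('D_e F (v + s *: e)).
Proof.
move=> dF.
have E : (fun h : R => h^-1 *: (((fun s : R => F (v + s *: e)) \o shift s) (h *: 1) - F (v + s *: e)))
   = (fun h : R => h^-1 *: ((F \o shift (v + s *: e)) (h *: e) - F (v + s *: e))).
  apply/funext => h /=; congr (_ *: (F _ - _)).
  by rewrite (_ : h *: (1 : R) = h) ?scalerDl 1?addrCA//; exact: mulr1.
by split; rewrite ?/derivable ?/derive E.
Qed.

End Lipschitz.

(** * The cosine transform with a phase *)

Section Transform.
Context {R : realType} {n : nat}.
Local Notation TR := (measurableTypeR R).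
Local Notation mu := (@lebesgue_measure_tuple R n).
Local Notation row := (@row_of_tuple R n).
Implicit Types (f g : 'rV[R]_n -> R) (x xi v : 'rV[R]_n) (th C : R) (j : 'I_n).

Definition rweight x : R := \prod_i (1 + x 0 i ^+ 2)^-1.

Lemma rweight_row (t : n.-tuple TR) : rweight (row t) = cauchy_weight t.
Proof. by apply: eq_bigr => i _; rewrite mxE. Qed.

Lemma dotC x xi : dot x xi = dot xi x.
Proof. by apply: eq_bigr => i _; rewrite mulrC. Qed.

Lemma dotDl x v xi : dot (x + v) xi = dot x xi + dot v xi.
Proof. by rewrite /dot -big_split; apply: eq_bigr => i _; rewrite mxE mulrDl. Qed.

Lemma dotZ_delta (s : R) j xi : dot (s *: delta_mx 0 j) xi = s * xi 0 j.
Proof.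
rewrite /dot (bigD1 j)//= big1 => [|i ij]; rewrite !mxE eqxx/=.
  by rewrite eqxx mulr1 addr0.
by rewrite (negbTE ij) mulr0 mul0r.
Qed.

Lemma dot_continuous xi : continuous (fun x => dot x xi).
Proof.
apply: (@continuous_big _ _ +%R 0 xpredT (@add_continuous _)) => i _ x.
apply: continuousM; first exact: coord_continuous.
exact: cst_continuous.
Qed.

Definition cosdot th xi x : R := cos (dot x xi - th).

Lemma cosdot_continuous th xi : continuous (cosdot th xi).
Proof.
move=> x; apply: (@continuous_comp _ _ _ (fun x => dot x xi - th) cos); last exact: continuous_cos.
exact: (cvgB (@dot_continuous xi x) (cvg_cst th)).
Qed.

Lemma cosdot_le1 th xi x : `|cosdot th xi x| <= 1.
Proof. by rewrite ler_norml cos_geN1 cos_le1. Qed.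

(** For real [f] this is Re(e^{i th} f^(xi)), where f^ is the Fourier transform. The phase lets the
    identities for derivatives and for multiplication by coordinates stay real. *)
Definition cos_transform th f xi : R := (\int[mu]_t (cosdot th xi (row t) * f (row t)))%R.

Definition dominated f := continuous f /\ exists C, forall x, `|f x| <= C * rweight x.

Lemma dominated_integrable f : dominated f -> mu.-integrable setT (EFin \o f \o row).
Proof.
move=> [cf [C fC]].
apply: (@integrable_dominated _ _ (f \o row) C); first exact: continuous_measurable_row.
by move=> t; rewrite /= -rweight_row.
Qed.

Lemma dominated_cosdot f th xi : dominated f -> dominated (fun x => cosdot th xi x * f x).
Proof.
move=> [cf [C fC]]; split.
  by move=> x; exact: (cvgM (@cosdot_continuous th xi x) (cf x)).
by exists C => x; rewrite normrM (le_trans _ (fC x))// ler_piMl// cosdot_le1.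
Qed.

Lemma integral_row_le f C : continuous f -> (forall x, `|f x| <= C * rweight x) ->
  `|(\int[mu]_t f (row t))%R| <= C * pi ^+ n.
Proof.
move=> cf fC.
apply: (@normr_integral_dominated _ _ (f \o row)); first exact: continuous_measurable_row.
by move=> t; rewrite /= -rweight_row.
Qed.

Lemma cos_transform_le th f xi C : continuous f -> (forall x, `|f x| <= C * rweight x) ->
  `|cos_transform th f xi| <= C * pi ^+ n.
Proof.
move=> cf fC; apply: (@integral_row_le (fun x => cosdot th xi x * f x)).
  by move=> x; exact: (cvgM (@cosdot_continuous th xi x) (cf x)).
by move=> x; rewrite normrM (le_trans _ (fC x))// ler_piMl// cosdot_le1.
Qed.

Lemma integral_rowD f g : dominated f -> dominated g ->
  (\int[mu]_t (f (row t) + g (row t)) = \int[mu]_t f (row t) + \int[mu]_t g (row t))%R.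
Proof.
by move=> df dg; apply: RintegralD => //; exact: dominated_integrable.
Qed.

Lemma integral_rowZ f (k : R) : dominated f ->
  (\int[mu]_t (k * f (row t)) = k * \int[mu]_t f (row t))%R.
Proof.
by move=> df; apply: RintegralZl => //; exact: dominated_integrable.
Qed.

Lemma dominatedZ f (k : R) : dominated f -> dominated (fun x => k * f x).
Proof.
move=> [cf [C fC]]; split; first by move=> x; exact: (cvgM (cvg_cst k) (cf x)).
by exists (`|k| * C) => x; rewrite normrM -mulrA ler_wpM2l.
Qed.

Lemma dominatedD f g : dominated f -> dominated g -> dominated (fun x => f x + g x).
Proof.
move=> [cf [C fC]] [cg [D gD]]; split; first by move=> x; exact: (cvgD (cf x) (cg x)).
by exists (C + D) => x; rewrite mulrDl (le_trans (ler_normD _ _))// lerD.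
Qed.

Lemma cos_transformE th f xi : dominated f ->
  cos_transform th f xi = cos th * cos_transform 0 f xi + sin th * cos_transform (pi / 2) f xi.
Proof.
move=> df; rewrite /cos_transform.
rewrite -(@integral_rowZ (fun x => cosdot 0 xi x * f x)); last exact: dominated_cosdot.
rewrite -(@integral_rowZ (fun x => cosdot (pi / 2) xi x * f x)); last exact: dominated_cosdot.
rewrite -(@integral_rowD (fun x => cos th * (cosdot 0 xi x * f x))
  (fun x => sin th * (cosdot (pi / 2) xi x * f x))); try by apply: dominatedZ; exact: dominated_cosdot.
apply: eq_Rintegral => t _; rewrite /cosdot subr0.
have -> : cos (dot (row t) xi - pi / 2) = sin (dot (row t) xi) by rewrite cosBpihalf.
by rewrite cosB; ring.
Qed.

Lemma cos_transform_opp th f xi : cos_transform th f (- xi) = cos_transform (- th) f xi.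
Proof.
apply: eq_Rintegral => t _; congr (_ * _); rewrite /cosdot -cosN; congr cos.
rewrite opprB opprK addrC; congr (_ + _).
by rewrite /dot -sumrN; apply: eq_bigr => i _; rewrite [(- xi) 0 i]mxE mulrN opprK.
Qed.

(** [cos_taylor] with increment [h * x 0 j] leaves a remainder of at most [h^2 x_j^2 |f x|], which
    is why [x_j^2 f] has to be dominated. *)
Lemma cos_transform_derive th f xi j : dominated f -> dominated (fun x => x 0 j * f x) ->
  dominated (fun x => x 0 j * (x 0 j * f x)) ->
  is_derive xi (delta_mx 0 j) (cos_transform th f) (cos_transform (th - pi / 2) (fun x => x 0 j * f x) xi).
Proof.
move=> d0 d1 [c2 [C f2]].
apply: (@is_derive_quadratic _ _ _ _ _ _ (C * pi ^+ n)) => h.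
have dotE x : dot x (h *: delta_mx 0 j + xi) = dot x xi + h * x 0 j.
  by rewrite !(dotC x) dotDl dotZ_delta addrC.
have E : cos_transform th f (h *: delta_mx 0 j + xi) - cos_transform th f xi -
    h * cos_transform (th - pi / 2) (fun x => x 0 j * f x) xi =
   (\int[mu]_t ((cosdot th (h *: delta_mx 0 j + xi) (row t) * f (row t)) +
     ((-1) * (cosdot th xi (row t) * f (row t)) +
      (- h) * (cosdot (th - pi / 2) xi (row t) * (row t 0 j * f (row t))))))%R.
  rewrite (@integral_rowD (fun x => cosdot th (h *: delta_mx 0 j + xi) x * f x)
     (fun x => (-1) * (cosdot th xi x * f x) +
      (- h) * (cosdot (th - pi / 2) xi x * (x 0 j * f x)))); last 2 first.
  - exact: dominated_cosdot.
  - by apply: dominatedD; apply: dominatedZ; exact: dominated_cosdot.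
  rewrite (@integral_rowD (fun x => (-1) * (cosdot th xi x * f x))
      (fun x => (- h) * (cosdot (th - pi / 2) xi x * (x 0 j * f x)))); last 2 first.
  - by apply: dominatedZ; exact: dominated_cosdot.
  - by apply: dominatedZ; exact: dominated_cosdot.
  rewrite (@integral_rowZ (fun x => cosdot th xi x * f x)); last exact: dominated_cosdot.
  rewrite (@integral_rowZ (fun x => cosdot (th - pi / 2) xi x * (x 0 j * f x))); last exact: dominated_cosdot.
  by rewrite /cos_transform; ring.
rewrite {}E mulrAC.
apply: (@integral_row_le (fun x => (cosdot th (h *: delta_mx 0 j + xi) x * f x) +
     ((-1) * (cosdot th xi x * f x) +
      (- h) * (cosdot (th - pi / 2) xi x * (x 0 j * f x))))).
  apply: (dominatedD (dominated_cosdot _ _ d0)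
    (dominatedD (dominatedZ _ (dominated_cosdot _ _ d0)) (dominatedZ _ (dominated_cosdot _ _ d1)))).1.
move=> x; pose z := dot x xi - th.
have -> : cosdot th (h *: delta_mx 0 j + xi) x * f x +
     ((-1) * (cosdot th xi x * f x) +
      (- h) * (cosdot (th - pi / 2) xi x * (x 0 j * f x))) =
   (cos (z + h * x 0 j) - cos z + (h * x 0 j) * sin z) * f x.
  have -> : cosdot (th - pi / 2) xi x = - sin z.
    by rewrite /cosdot opprB addrCA addrC -/z cosDpihalf.
  by rewrite /cosdot dotE addrAC -/z; ring.
rewrite normrM (le_trans (ler_wpM2r (normr_ge0 _) (cos_taylor _ _)))//.
rewrite exprMn -mulrA (mulrC C) -[leRHS]mulrA ler_wpM2l ?sqr_ge0//.
apply: le_trans (f2 x); rewrite !normrM mulrA -normrM -expr2 [X in _ <= X * _]ger0_norm//.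
exact: sqr_ge0.
Qed.

Lemma rweight_gt0 x : 0 < rweight x.
Proof. by apply: prodr_gt0 => i _; rewrite invr_gt0 ltr_pwDl// sqr_ge0. Qed.

Lemma dominated_bound_ge0 f C : (forall x, `|f x| <= C * rweight x) -> 0 <= C.
Proof.
by move=> fC; have := le_trans (normr_ge0 _) (fC 0); rewrite pmulr_lge0// rweight_gt0.
Qed.

(** Cosine is 1-Lipschitz, so the transform is Lipschitz with a constant built from the majorants of
    the functions [x_j f]. *)
Lemma cos_transform_continuous th f : dominated f ->
  (forall j, dominated (fun x => x 0 j * f x)) -> continuous (cos_transform th f).
Proof.
move=> d0 d1.
have /choice[C fC] : forall j, exists C, forall x, `|x 0 j * f x| <= C * rweight x.
  by move=> j; have [] := d1 j.
have C0 j : 0 <= C j by exact: dominated_bound_ge0 (fC j).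
have S0 : 0 <= \sum_j C j by apply: sumr_ge0.
have lip (xi eta : 'rV[R]_n) (e : R) : (forall j, `|xi 0 j - eta 0 j| <= e) ->
    `|cos_transform th f xi - cos_transform th f eta| <= e * (\sum_j C j) * pi ^+ n.
  move=> xe.
  have -> : cos_transform th f xi - cos_transform th f eta =
      (\int[mu]_t (cosdot th xi (row t) * f (row t) + (-1) * (cosdot th eta (row t) * f (row t))))%R.
    rewrite (@integral_rowD (fun x => cosdot th xi x * f x) (fun x => (-1) * (cosdot th eta x * f x))).
    - rewrite (@integral_rowZ (fun x => cosdot th eta x * f x)); last exact: dominated_cosdot.
      by rewrite mulN1r.
    - exact: dominated_cosdot.
    - by apply: dominatedZ; exact: dominated_cosdot.
  apply: (@integral_row_le (fun x => cosdot th xi x * f x + (-1) * (cosdot th eta x * f x))).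
    exact: (dominatedD (dominated_cosdot _ _ d0) (dominatedZ _ (dominated_cosdot _ _ d0))).1.
  move=> x; rewrite mulN1r -mulrBl normrM.
  apply: (@le_trans _ _ (`|\sum_j x 0 j * (xi 0 j - eta 0 j)| * `|f x|)).
    rewrite ler_wpM2r// (le_trans (cos_lip _ _))//.
    rewrite (_ : dot x xi - th - _ = \sum_j x 0 j * (xi 0 j - eta 0 j))//.
    rewrite opprB addrA subrK /dot -sumrB; apply: eq_bigr => i _.
    by rewrite mulrBr.
  apply: (@le_trans _ _ ((\sum_j `|x 0 j * (xi 0 j - eta 0 j)|) * `|f x|)).
    by rewrite ler_wpM2r// ler_norm_sum.
  rewrite mulr_suml -mulrA mulr_suml mulr_sumr ler_sum// => i _.
  rewrite normrM mulrAC -normrM mulrC ler_pM//.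
move=> xi; apply/(@cvgrPdist_le _ _ _ (nbhs xi)) => e e0.
pose K := (\sum_j C j) * pi ^+ n + 1.
have K0 : 0 < K by rewrite ltr_wpDl// mulr_ge0// exprn_ge0// pi_ge0.
apply/nbhs_ballP; exists (e / K); first by rewrite /= divr_gt0.
move=> eta /row_ballE h.
have {}h j : `|xi 0 j - eta 0 j| <= e / K by apply/ltW/h; rewrite divr_gt0.
apply: (le_trans (lip _ _ _ h)).
by rewrite -mulrA mulrAC ler_pdivrMr// ler_wpM2l ?(ltW e0)// lerDl.
Qed.

Lemma row_upd (t : n.-tuple TR) j (s : R) :
  row (upd t j s) = (row t - tnth t j *: delta_mx 0 j) + s *: delta_mx 0 j.
Proof.
apply/rowP => i; rewrite !mxE eqxx tnth_mktuple/=.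
by have [->|ij] := eqVneq i j; rewrite ?mulr1 ?mulr0 ?subrr ?add0r ?subr0 ?addr0.
Qed.

(** Integration by parts: the partial derivative in [x_j] of [sin (dot x xi - th) * f x] has
    integral 0. *)
Lemma cos_transform_partial th f xi j : dominated f -> dominated (partial j f) ->
  (forall x, derivable f x (delta_mx 0 j)) ->
  xi 0 j * cos_transform th f xi = cos_transform (th - pi / 2) (partial j f) xi.
Proof.
move=> d0 d1 df; have [cf [C1 fC]] := d0; have [cg [C2 gC]] := d1.
have C10 := dominated_bound_ge0 fC; have C20 := dominated_bound_ge0 gC.
have cE x : cosdot (th - pi / 2) xi x = - sin (dot x xi - th).
  by rewrite /cosdot opprB addrCA addrC cosDpihalf.
pose G x := sin (dot x xi - th) * f x.
(* [G'] is the derivative of [G] in direction [j], written with cosines only because the sine is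
   minus the cosine of phase [th - pi / 2]. *)
pose G' x := xi 0 j * (cosdot th xi x * f x) + (-1) * (cosdot (th - pi / 2) xi x * partial j f x).
have dG' : dominated G'.
  by apply: dominatedD; apply: dominatedZ; exact: dominated_cosdot.
have cG' := dG'.1.
suff I0 : (\int[mu]_t G' (row t))%R = 0.
  move: I0; rewrite (@integral_rowD (fun x => xi 0 j * (cosdot th xi x * f x))
    (fun x => (-1) * (cosdot (th - pi / 2) xi x * partial j f x))); last 2 first.
  - by apply: dominatedZ; exact: dominated_cosdot.
  - by apply: dominatedZ; exact: dominated_cosdot.
  rewrite (@integral_rowZ (fun x => cosdot th xi x * f x)); last exact: dominated_cosdot.
  rewrite (@integral_rowZ (fun x => cosdot (th - pi / 2) xi x * partial j f x)); last exact: dominated_cosdot.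
  by rewrite mulN1r => /eqP; rewrite subr_eq0 => /eqP.
rewrite /Rintegral.
pose C := C1 + (`|xi 0 j| * C1 + C2).
have CC1 x : C1 * rweight x <= C * rweight x.
  by rewrite ler_wpM2r ?(ltW (rweight_gt0 _))// lerDl addr_ge0// mulr_ge0.
suff -> : (\int[mu]_t (G' (row t))%:E = 0)%E by [].
apply: (@integral_partial_eq0 _ _ (G \o row) (G' \o row) C j).
- exact: continuous_measurable_row.
- move=> t s /=; rewrite !row_upd.
  under eq_fun do rewrite row_upd.
  set v := row t - _; set e := delta_mx 0 j : 'rV[R]_n.
  have dE s' : dot (v + s' *: e) xi = dot v xi + s' * xi 0 j.
    by rewrite dotDl dotZ_delta.
  have d2 : is_derive s 1 (fun s => f (v + s *: e)) (partial j f (v + s *: e)).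
    exact: is_derive_line.
  have lin : is_derive s 1 (fun s : R => dot v xi + s * xi 0 j - th) (xi 0 j).
    have : is_derive s 1 (cst (dot v xi - th) + xi 0 j \*: id) (0 + xi 0 j *: 1).
      by apply: is_deriveD; exact: is_deriveZ.
    rewrite add0r /GRing.scale/= mulr1.
    rewrite (_ : _ + _ = fun s : R => dot v xi + s * xi 0 j - th)//.
    by apply/funext => s' /=; rewrite [LHS]/(_ + _)/= /cst/= mulrC addrAC.
  have d1' : is_derive s 1 (sin \o (fun s : R => dot v xi + s * xi 0 j - th))
     (cos (dot v xi + s * xi 0 j - th) * xi 0 j) by exact: is_derive1_comp.
  have := is_deriveM d1' d2.
  rewrite (_ : _ * _ = (fun s => G (v + s *: e))); last first.
    by apply/funext => s'; rewrite /G dE.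
  move/is_derive_eq; apply.
  rewrite /G' cE /cosdot dE /GRing.scale/=; ring.
- move=> t; rewrite /=; under eq_fun do rewrite row_upd.
  move=> s; apply: (@continuous_comp _ _ _ (fun s : R => row t - tnth t j *: delta_mx 0 j + s *: delta_mx 0 j) G'); last exact: cG'.
  apply: cvgD; first exact: cvg_cst.
  by apply: cvgZr_tmp; exact: cvg_id.
- move=> t; rewrite /= -rweight_row (le_trans _ (CC1 _))// (le_trans _ (fC _))//.
  by rewrite /G normrM ler_piMl// ler_norml sin_geN1 sin_le1.
- move=> t; rewrite /= -rweight_row.
  apply: (@le_trans _ _ ((`|xi 0 j| * C1 + C2) * rweight (row t))); last first.
    by rewrite ler_wpM2r ?(ltW (rweight_gt0 _))// lerDr.
  rewrite /G' mulN1r (le_trans (ler_normB _ _))// [leRHS]mulrDl lerD//.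
    by rewrite !normrM -mulrA ler_wpM2l// (le_trans _ (fC _))// ler_piMl// cosdot_le1.
  by rewrite normrM (le_trans _ (gC _))// ler_piMl// cosdot_le1.
Qed.

End Transform.

(** * The Poisson kernel as a transform *)

Section PoissonKernel.
Context {R : realType}.
Local Notation leb := (@lebesgue_measure R).
Local Notation TR := (measurableTypeR R).
Local Notation tcons := (@Defs.cons_tuple R _).
Local Notation mu n := (@lebesgue_measure_tuple R n).
Implicit Types (eps y th : R).

(** The Fourier transform of [exp (- eps * |x|)] on the line, of total mass [2 * pi]. *)
Definition poisson eps y : R := 2 * eps / (eps ^+ 2 + y ^+ 2).

Lemma poisson_ge0 eps y : 0 < eps -> 0 <= poisson eps y.
Proof.
by move=> e0; rewrite /poisson divr_ge0 ?mulr_ge0 ?addr_ge0 ?sqr_ge0 ?ltW.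
Qed.

Lemma continuous_exp_norm eps : continuous (fun x : R => expR (- (eps * `|x|))).
Proof.
move=> x; apply: (@continuous_comp _ _ _ (fun x => - (eps * `|x|)) expR).
  by apply: cvgN; apply: cvgM; [exact: cvg_cst|exact: norm_continuous].
exact: continuous_expR.
Qed.

Lemma continuous_cos_lin y th : continuous (fun x : R => cos (y * x - th)).
Proof.
move=> x; apply: (@continuous_comp _ _ _ (fun x => y * x - th) cos); last exact: continuous_cos.
apply: cvgB; last exact: cvg_cst.
by apply: cvgM; [exact: cvg_cst|exact: cvg_id].
Qed.

Lemma integral_exp_norm eps : 0 < eps ->
  (\int[leb]_x (expR (- (eps * `|x|)))%:E = (2 / eps)%:E)%E.
Proof.
move=> e0; have := integral_exp_cos 0 (pi / 2) e0.
rewrite cos_pihalf mul0r addr0 => <-; apply: eq_integral => x _.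
by rewrite mul0r sub0r cosN cos_pihalf addr0 mulr1.
Qed.

(** Obtained from [integral_exp_cos] by subtracting the integral of the exponential alone, which
    integrability allows. *)
Lemma integral_exp_cos_signed eps y th : 0 < eps ->
  (\int[leb]_x (expR (- (eps * `|x|)) * cos (y * x - th))%:E =
    (cos th * poisson eps y)%:E)%E.
Proof.
move=> e0.
have mE : measurable_fun setT (fun x : R => expR (- (eps * `|x|))).
  by apply: continuous_measurable_fun; exact: continuous_exp_norm.
have mC : measurable_fun setT (fun x : R => cos (y * x - th)).
  by apply: continuous_measurable_fun; exact: continuous_cos_lin.
have iE : leb.-integrable setT (fun x => (expR (- (eps * `|x|)))%:E).
  apply/integrableP; split; first exact/measurable_EFinP.
  under eq_integral do rewrite gee0_abs ?lee_fin ?expR_ge0//.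
  by rewrite integral_exp_norm// ltry.
have iEC : leb.-integrable setT (fun x => (expR (- (eps * `|x|)) * cos (y * x - th))%:E).
  apply: le_integrable iE => //; first by apply/measurable_EFinP; exact: measurable_funM.
  move=> x _; rewrite lee_fin normrM ler_piMr//.
  by rewrite ler_norml cos_geN1 cos_le1.
have := integral_exp_cos y th e0.
rewrite (_ : (fun x => (_ * (1 + _))%:E) = (fun x => (expR (- (eps * `|x|)))%:E +
   (expR (- (eps * `|x|)) * cos (y * x - th))%:E)%E); last first.
  by apply/funext => x; rewrite mulrDr mulr1 EFinD.
rewrite [in LHS]integralD// integral_exp_norm//.
have := integrable_fin_num measurableT iEC.
case: (integral _ _ _) => [r _|//|//] [] h; congr EFin; rewrite /poisson; lra.
Qed.

(** From [exp s >= 1 + s^2 / 2]. The constant explodes as [eps] tends to 0, but it only serves to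
    justify integrability and Fubini for a fixed [eps]. *)
Lemma exp_norm_le eps x : 0 < eps ->
  expR (- (eps * `|x|)) <= (1 + 2 / eps ^+ 2) * (1 + x ^+ 2)^-1.
Proof.
move=> e0; have x0 : 0 < 1 + x ^+ 2 by rewrite ltr_pwDl// sqr_ge0.
rewrite ler_pdivlMr// expRN ler_pdivrMl ?expR_gt0//.
have h := expR_ge1Dxn 1 (mulr_ge0 (ltW e0) (normr_ge0 x)).
rewrite exprMn real_normK ?num_real// in h.
have e2 : 0 < eps ^+ 2 by rewrite exprn_gt0.
apply: (@le_trans _ _ ((1 + eps ^+ 2 * x ^+ 2 / 2) * (1 + 2 / eps ^+ 2))).
  have -> : (1 + eps ^+ 2 * x ^+ 2 / 2) * (1 + 2 / eps ^+ 2) =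
    1 + x ^+ 2 + (2 / eps ^+ 2 + eps ^+ 2 * x ^+ 2 / 2) by field; rewrite gt_eqF.
  have a1 : 0 <= 2 / eps ^+ 2 by rewrite divr_ge0// ltW.
  have a2 : 0 <= eps ^+ 2 * x ^+ 2 / 2 by rewrite divr_ge0// mulr_ge0// ?sqr_ge0// ltW.
  by rewrite lerDl addr_ge0.
by rewrite ler_wpM2r// addr_ge0// divr_ge0// ltW.
Qed.

Definition exp_weight n eps (t : n.-tuple TR) : R := \prod_i expR (- (eps * `|tnth t i|)).

Lemma exp_weight_ge0 n eps (t : n.-tuple TR) : 0 <= exp_weight eps t.
Proof. by apply: prodr_ge0 => i _; exact: expR_ge0. Qed.

Lemma exp_weight_le1 n eps (t : n.-tuple TR) : 0 < eps -> exp_weight eps t <= 1.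
Proof.
move=> e0; apply: prodr_ile1 => i _.
by rewrite expR_ge0 -expR0 ler_expR oppr_le0 mulr_ge0// ltW.
Qed.

Lemma exp_weight_le n eps (t : n.-tuple TR) : 0 < eps ->
  exp_weight eps t <= (1 + 2 / eps ^+ 2) ^+ n * cauchy_weight t.
Proof.
move=> e0; rewrite /cauchy_weight -[n in X in _ <= X * _]card_ord -prodr_const -big_split.
by apply: ler_prod => i _; rewrite expR_ge0 exp_norm_le.
Qed.

Lemma measurable_exp_weight n eps : measurable_fun setT (@exp_weight n eps).
Proof.
apply: (measurable_tuple_prod (h := fun _ x => expR (- (eps * `|x|)))) => _.
by apply: continuous_measurable_fun; exact: continuous_exp_norm.
Qed.

Lemma exp_weight_tcons n eps (x : R) (t : n.-tuple TR) :
  exp_weight eps (tcons (x, t)) = expR (- (eps * `|x|)) * exp_weight eps t.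
Proof.
rewrite /exp_weight big_ord_recl tnth_tcons0; congr (_ * _).
by apply: eq_bigr => i _; rewrite tnth_tconsS.
Qed.

Lemma measurable_lincomb n (y : 'I_n -> R) :
  measurable_fun setT (fun t : n.-tuple TR => \sum_i y i * tnth t i).
Proof.
apply: measurable_sum => i; apply: measurable_funM => //.
exact: measurable_tnth.
Qed.

Lemma measurable_cos : measurable_fun setT (@cos R).
Proof. by apply: continuous_measurable_fun; exact: continuous_cos. Qed.

(** The arbitrary phase makes the induction work: once the first coordinate [x] is frozen,
    [y ord0 * x] is absorbed into [th]. *)
Lemma integral_tuple_exp_cos n eps (y : 'I_n -> R) th : 0 < eps ->
  (\int[mu n]_t (cos (\sum_i y i * tnth t i - th) * exp_weight eps t)%:E =
    (cos th * \prod_i poisson eps (y i))%:E)%E.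
Proof.
move=> e0.
have mI m (z : 'I_m -> R) th' : measurable_fun setT
    (fun t : m.-tuple TR => cos (\sum_i z i * tnth t i - th') * exp_weight eps t).
  apply: measurable_funM; last exact: measurable_exp_weight.
  apply: (measurableT_comp measurable_cos).
  by apply: measurable_funB => //; exact: measurable_lincomb.
have iI m (z : 'I_m -> R) th' : (mu m).-integrable setT
    (fun t => (cos (\sum_i z i * tnth t i - th') * exp_weight eps t)%:E).
  apply: (@integrable_dominated _ _ _ ((1 + 2 / eps ^+ 2) ^+ m) (mI m z th')) => t.
  rewrite normrM (le_trans _ (exp_weight_le t e0))// [X in _ * X]ger0_norm ?exp_weight_ge0//.
  by rewrite ler_piMl ?exp_weight_ge0// ler_norml cos_geN1 cos_le1.
elim: n y th => [|n ih] y th.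
  apply: (eq_trans (integral_dirac _ _ _)) => //.
    by apply/measurable_EFinP; exact: mI.
  by rewrite /exp_weight !big_ord0 diracE mem_set// mul1e sub0r cosN.
have [E1 _] := integral_tupleS (iI n.+1 y th).
rewrite [LHS]E1.
have IZ x := integralZl measurableT (iI n (fun i => y (lift ord0 i)) (th - y ord0 * x))
  (expR (- (eps * `|x|))).
transitivity (\int[leb]_x ((\prod_i poisson eps (y (lift ord0 i)))%:E *
     (expR (- (eps * `|x|)) * cos (y ord0 * x - th))%:E))%E.
  apply: eq_integral => x _.
  transitivity (\int[mu n]_t ((expR (- (eps * `|x|)))%:E *
      (cos (\sum_i y (lift ord0 i) * tnth t i - (th - y ord0 * x)) * exp_weight eps t)%:E))%E.
    apply: eq_integral => t _; rewrite exp_weight_tcons big_ord_recl tnth_tcons0.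
    under eq_bigr do rewrite tnth_tconsS.
    by rewrite -EFinM mulrCA; congr (_ * (cos _ * _))%:E; ring.
  by rewrite [LHS]IZ ih -cosN opprB -!EFinM; congr EFin; ring.
rewrite integralZl//.
  by rewrite integral_exp_cos_signed// -EFinM big_ord_recl; congr EFin; ring.
have mE : measurable_fun setT (fun x : R => expR (- (eps * `|x|))).
  by apply: continuous_measurable_fun; exact: continuous_exp_norm.
have iE : leb.-integrable setT (fun x => (expR (- (eps * `|x|)))%:E).
  apply/integrableP; split; first exact/measurable_EFinP.
  under eq_integral do rewrite gee0_abs ?lee_fin ?expR_ge0//.
  by rewrite integral_exp_norm// ltry.
apply: le_integrable iE => //.
  apply/measurable_EFinP; apply: measurable_funM => //.
  by apply: continuous_measurable_fun; exact: continuous_cos_lin.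
move=> x _; rewrite lee_fin normrM ler_piMr//.
by rewrite ler_norml cos_geN1 cos_le1.
Qed.

End PoissonKernel.

(** * A sup bound in place of Fourier inversion *)

Section Inversion.
Context {R : realType} {n : nat}.
Local Notation leb := (@lebesgue_measure R).
Local Notation TR := (measurableTypeR R).
Local Notation mu := (@lebesgue_measure_tuple R n).
Local Notation row := (@row_of_tuple R n).

Lemma dot_row (t : n.-tuple TR) (x : 'rV[R]_n) : dot x (row t) = \sum_i x 0 i * tnth t i.
Proof. by apply: eq_bigr => i _; rewrite mxE. Qed.

Lemma tuple_prod_integrable (h : 'I_n -> R -> R) (c : 'I_n -> R) :
  (forall i, measurable_fun setT (h i)) -> (forall i x, 0 <= h i x) ->
  (forall i, \int[leb]_x (h i x)%:E = (c i)%:E)%E ->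
  mu.-integrable setT (fun t => (\prod_i h i (tnth t i))%:E).
Proof.
move=> mh h0 hc; apply/integrableP; split.
  by apply/measurable_EFinP; exact: measurable_tuple_prod.
under eq_integral do rewrite gee0_abs ?lee_fin ?prodr_ge0//.
by rewrite (integral_tuple_prod mh h0 hc) ltry.
Qed.

Lemma measurable_poisson (eps c : R) : 0 < eps ->
  measurable_fun setT (fun x : R => poisson eps (x - c)).
Proof.
move=> e0; apply: continuous_measurable_fun => x.
apply: cvgM; first exact: cvg_cst.
apply: cvgV; first by rewrite gt_eqF// ltr_pwDl ?exprn_gt0// sqr_ge0.
apply: cvgD; first exact: cvg_cst.
rewrite expr2; apply: cvgM; apply: cvgB; try exact: cvg_cst; exact: cvg_id.
Qed.

(** The kernel is written as the transform of [exp_weight] and the integrals are exchanged. The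
    inner integral becomes the cosine transform of [f] at phase [dot x0 xi], and [exp_weight <= 1]
    makes the bound independent of [eps]. *)
Lemma smoothing_le (f : 'rV[R]_n -> R) (M eps : R) (x0 : 'rV[R]_n) : 0 < eps ->
  dominated f -> (forall th xi, `|cos_transform th f xi| <= M * rweight xi) ->
  `|(\int[mu]_t (f (row t) * \prod_i poisson eps (tnth t i - x0 0 i)))%R| <= M * pi ^+ n.
Proof.
move=> e0 df fM; have [cf [C fC]] := df.
pose F (z : n.-tuple TR * n.-tuple TR) : R :=
  f (row z.1) * (cos (dot (row z.1) (row z.2) - dot x0 (row z.2)) * exp_weight eps z.2).
have mF : measurable_fun setT F.
  apply: measurable_funM.
    exact: measurableT_comp (continuous_measurable_row cf) measurable_fst.
  apply: measurable_funM; last exact: measurableT_comp (@measurable_exp_weight _ _ _) measurable_snd.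
  apply: (measurableT_comp measurable_cos); apply: measurable_funB.
    rewrite (_ : (fun _ => _) = (fun z : n.-tuple TR * n.-tuple TR => \sum_i tnth z.1 i * tnth z.2 i)); last first.
      by apply/funext => z; apply: eq_bigr => i _; rewrite !mxE.
    apply: measurable_sum => i; apply: measurable_funM.
      exact: measurableT_comp (measurable_tnth i) measurable_fst.
    exact: measurableT_comp (measurable_tnth i) measurable_snd.
  rewrite (_ : (fun _ => _) = (fun t : n.-tuple TR => \sum_i x0 0 i * tnth t i) \o snd); last first.
    by apply/funext => z; rewrite dot_row.
  exact: measurableT_comp (measurable_lincomb (fun i => x0 0 i)) measurable_snd.
pose K := (1 + 2 / eps ^+ 2) ^+ n.
have FC x y : `|F (x, y)| <= (C * K) * cauchy_weight x * cauchy_weight y.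
  rewrite /F/= normrM (_ : C * K * _ * _ = (C * cauchy_weight x) * (K * cauchy_weight y)); last by ring.
  apply: ler_pM => //; first by rewrite -rweight_row fC.
  rewrite normrM (le_trans _ (exp_weight_le y e0))// [X in _ * X]ger0_norm ?exp_weight_ge0//.
  by rewrite ler_piMl ?exp_weight_ge0// ler_norml cos_geN1 cos_le1.
have := fubini_dominated mF FC.
rewrite (_ : (\int[mu]_x (\int[mu]_y F (x, y)))%R =
  (\int[mu]_t (f (row t) * \prod_i poisson eps (tnth t i - x0 0 i)))%R); last first.
  apply: eq_Rintegral => t _; rewrite /F/= RintegralZl//; last first.
    apply: (@integrable_dominated _ _ _ K) => [|t'].
      apply: measurable_funM; last exact: measurable_exp_weight.
      apply: (measurableT_comp measurable_cos); apply: measurable_funB; last first.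
        by under eq_fun do rewrite dot_row; exact: measurable_lincomb.
      by under eq_fun do rewrite dot_row; exact: measurable_lincomb.
    rewrite normrM (le_trans _ (exp_weight_le t' e0))// [X in _ * X]ger0_norm ?exp_weight_ge0//.
    by rewrite ler_piMl ?exp_weight_ge0// ler_norml cos_geN1 cos_le1.
  congr (_ * _); rewrite /Rintegral.
  have := integral_tuple_exp_cos (fun i => tnth t i - x0 0 i) 0 e0.
  rewrite cos0 mul1r => E; rewrite -[RHS]/(fine (_%:E)) -E; congr fine.
  apply: eq_integral => t' _; rewrite subr0 !dot_row; congr (cos _ * _)%:E.
  by rewrite -sumrB; apply: eq_bigr => i _; rewrite mxE mulrBl.
move=> ->.
apply: normr_integral_dominated; first exact: measurable_integral_dominated mF FC.
move=> t; rewrite (_ : (\int[mu]_x F (x, t))%R = exp_weight eps t * cos_transform (dot x0 (row t)) f (row t)).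
  rewrite normrM ger0_norm ?exp_weight_ge0// -rweight_row.
  by apply: (le_trans _ (fM (dot x0 (row t)) (row t))); rewrite ler_piMl// exp_weight_le1.
rewrite /cos_transform -RintegralZl//.
  by apply: eq_Rintegral => t' _; rewrite /F/= /cosdot; ring.
exact: dominated_integrable (dominated_cosdot _ _ df).
Qed.

(* Integrating f against the product Poisson kernel, the transform of
   exp (- eps * sum |xi_i|), gives a bound in terms of the transform of f; letting
   eps tend to 0 replaces the Fourier inversion formula. *)
Lemma inversion_le (f : 'rV[R]_n -> R) (M : R) (x0 : 'rV[R]_n) :
  dominated f -> (forall th xi, `|cos_transform th f xi| <= M * rweight xi) ->
  `|f x0| <= M.
Proof.
move=> df fM; have [cf [C fC]] := df.
have C0 := dominated_bound_ge0 fC.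
have fC' x : `|f x| <= C.
  rewrite (le_trans (fC x))// ler_piMr//; apply: prodr_ile1 => i _.
  by rewrite invr_ge0 addr_ge0 ?sqr_ge0// invf_le1 ?lerDl ?sqr_ge0// ltr_pwDl// sqr_ge0.
apply/ler_addgt0Pr => e e0.
have [d d0 hd] : exists2 d : R, 0 < d & forall x : 'rV[R]_n, (forall j, `|x0 0 j - x 0 j| < d) -> `|f x0 - f x| <= e / 2.
  have := cf x0 => /(@cvgrPdist_le _ _ _ (nbhs x0)) /(_ _ (divr_gt0 e0 (ltr0Sn _ 1))).
  move=> /nbhs_ballP[d /= d0 h]; exists d => // x hx; apply: h.
  exact/row_ballE.
(* Chosen so that the mass of the kernel outside the box of half-width [d], relative to
   [(2 * pi) ^+ n], times the oscillation bound [2 * C] is at most [e / 2]. *)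
pose eps := e / 2 * d / (4 * C * n%:R + 1).
have den : 0 < 4 * C * n%:R + 1 by rewrite ltr_wpDl// !mulr_ge0.
have eps0 : 0 < eps by rewrite divr_gt0// mulr_gt0// divr_gt0.
have heps : 4 * C * n%:R * (eps / d) <= e / 2.
  rewrite /eps -[_ / 2 * d / _]mulrAC mulfK ?gt_eqF//.
  rewrite mulrA ler_pdivrMr// mulrC ler_wpM2l ?divr_ge0 ?(ltW e0)//.
  by rewrite lerDl.
clearbody eps.
have p0 : 0 < 2 * pi :> R by rewrite mulr_gt0// pi_gt0.
pose P (i : 'I_n) x := poisson eps (x - x0 0 i).
(* Majorant of the kernel where coordinate [j] is at distance at least [d] from [x0]: for
   [|y| >= d], [poisson eps y <= (2 * eps / d) * poisson d y], which has small total mass. *)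
pose Q (j i : 'I_n) x := if i == j then (2 * eps / d) * poisson d (x - x0 0 i) else P i x.
have mP i : measurable_fun setT (P i) by exact: measurable_poisson.
have P0 i x : 0 <= P i x by exact: poisson_ge0.
have IP i : (\int[leb]_x (P i x)%:E = (2 * pi)%:E)%E by exact: integral_atan_scaled.
have mQ j i : measurable_fun setT (Q j i).
  rewrite /Q; case: eqP => // _; apply: measurable_funM => //; exact: measurable_poisson.
have ed0 : 0 <= 2 * eps / d by rewrite divr_ge0 ?mulr_ge0 ?(ltW eps0) ?(ltW d0).
have Q0 j i x : 0 <= Q j i x.
  by rewrite /Q; case: eqP => // _; rewrite mulr_ge0// poisson_ge0.
pose c (j i : 'I_n) : R := if i == j then (2 * eps / d) * (2 * pi) else 2 * pi.
have IQ j i : (\int[leb]_x (Q j i x)%:E = (c j i)%:E)%E.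
  rewrite /Q /c; case: eqP => // _.
  under eq_integral do rewrite EFinM.
  rewrite ge0_integralZl ?lee_fin//.
  - by rewrite [X in (_ * X)%E](integral_atan_scaled (x0 0 i) d0) -EFinM.
  - by apply/measurable_EFinP; exact: measurable_poisson.
  - by move=> x _; rewrite lee_fin poisson_ge0.
have cE j : \prod_i c j i = (2 * eps / d) * (2 * pi) ^+ n.
  transitivity ((2 * eps / d) * \prod_(i < n) (2 * pi)); last by rewrite prodr_const card_ord.
  rewrite (bigD1 j)//= [in RHS](bigD1 j)//= [RHS]mulrA; congr (_ * _).
    by rewrite /c eqxx.
  by apply: eq_bigr => i /negbTE ij; rewrite /c ij.
have iP := tuple_prod_integrable mP P0 IP.
have iQ j := tuple_prod_integrable (mQ j) (Q0 j) (IQ j).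
have EP : (\int[mu]_t (\prod_i P i (tnth t i)))%R = (2 * pi) ^+ n.
  by rewrite /Rintegral (integral_tuple_prod mP P0 IP)/= prodr_const card_ord.
have EQs : (\int[mu]_t (\sum_j \prod_i Q j i (tnth t i)))%R = n%:R * ((2 * eps / d) * (2 * pi) ^+ n).
  rewrite /Rintegral; under eq_integral do rewrite -sumEFin.
  rewrite ge0_integral_sum//.
  - under eq_bigr do rewrite (integral_tuple_prod (mQ _) (Q0 _) (IQ _)) cE.
    by rewrite sumEFin/= sumr_const card_ord -[LHS]mulr_natl.
  - by move=> j; apply/measurable_EFinP; exact: measurable_tuple_prod.
  - by move=> j t _; rewrite lee_fin prodr_ge0.
have iQs : mu.-integrable setT (fun t => (\sum_j \prod_i Q j i (tnth t i))%:E).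
  under eq_fun do rewrite -sumEFin.
  by apply: integrable_sum => //; move=> j _; exact: iQ.
pose K (t : n.-tuple TR) := \prod_i P i (tnth t i).
have K0 t : 0 <= K t by apply: prodr_ge0.
have mK : measurable_fun setT K by exact: measurable_tuple_prod.
have mf : measurable_fun setT (f \o row) by exact: continuous_measurable_row.
have ifK : mu.-integrable setT (fun t => (f (row t) * K t)%:E).
  apply: (@le_integrable _ _ _ _ _ measurableT _ (fun t => (C * K t)%:E)).
  - by apply/measurable_EFinP; exact: measurable_funM.
  - move=> t _; rewrite lee_fin normrM [leRHS]ger0_norm ?mulr_ge0//.
    by rewrite (ger0_norm (K0 t)) ler_wpM2r.
  - exact: (integrableZl measurableT C iP).
have idK : mu.-integrable setT (fun t => ((f x0 - f (row t)) * K t)%:E).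
  rewrite (_ : (fun t => _) = (fun t => (f x0 * K t)%:E - (f (row t) * K t)%:E)%E); last first.
    by apply/funext => t; rewrite mulrBl.
  apply: integrableB => //; exact: (integrableZl measurableT (f x0) iP).
(* Inside the box, continuity of [f] gives the first term. Outside, some coordinate is far from [x0]
   and its [Q j] dominates the kernel. *)
have key t : `|(f x0 - f (row t)) * K t| <= e / 2 * K t + 2 * C * \sum_j \prod_i Q j i (tnth t i).
  rewrite normrM (ger0_norm (K0 t)).
  have [h|/existsNP[j /negP]] := pselect (forall j, `|x0 0 j - row t 0 j| < d).
    rewrite (le_trans (ler_wpM2r (K0 t) (hd _ h)))// lerDl mulr_ge0 ?mulr_ge0//.
    by apply: sumr_ge0 => i _; exact: prodr_ge0.
  rewrite -leNgt mxE => hj.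
  apply: (@le_trans _ _ (2 * C * \prod_i Q j i (tnth t i))); last first.
    rewrite (le_trans _ (ler_wpDl _ (lexx _)))// ?mulr_ge0 ?divr_ge0 ?(ltW e0)//.
    rewrite ler_wpM2l ?mulr_ge0// [leRHS](bigD1 j)//= lerDl sumr_ge0// => i _; exact: prodr_ge0.
  have hf : `|f x0 - f (row t)| <= 2 * C.
    by rewrite (le_trans (ler_normB _ _))// mulrDl mul1r lerD.
  apply: ler_pM => //.
  rewrite /K (bigD1 j)//= [leRHS](bigD1 j)//= [X in _ <= _ * X](eq_bigr (fun i => P i (tnth t i))); last first.
    by move=> i /negbTE ij; rewrite /Q ij.
  rewrite ler_wpM2r ?prodr_ge0// /Q eqxx /P /poisson.
  set y := tnth t j - x0 0 j.
  have y2 : d ^+ 2 <= y ^+ 2.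
    by rewrite -[y ^+ 2]real_normK ?num_real// lerXn2r ?nnegrE ?(ltW d0)// /y distrC.
  have e2 : 0 < eps ^+ 2 by rewrite exprn_gt0.
  have d2 : 0 < d ^+ 2 by rewrite exprn_gt0.
  have -> : 2 * eps / d * (2 * d / (d ^+ 2 + y ^+ 2)) = 2 * eps * (2 / (d ^+ 2 + y ^+ 2)).
    by field; rewrite !gt_eqF// addr_gt0// (lt_le_trans d2).
  rewrite ler_wpM2l ?mulr_ge0 ?(ltW eps0)//.
  rewrite ler_pdivlMr; last by rewrite addr_gt0// (lt_le_trans d2).
  rewrite mulrC ler_pdivrMr; last by rewrite addr_gt0// (lt_le_trans d2).
  lra.
have E : f x0 * (2 * pi) ^+ n = (\int[mu]_t (f (row t) * K t) + \int[mu]_t ((f x0 - f (row t)) * K t))%R.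
  rewrite -RintegralD// -EP -RintegralZl//.
  by apply: eq_Rintegral => t _; rewrite /K; ring.
have M0 : 0 <= M.
  by have := le_trans (normr_ge0 _) (fM 0 0); rewrite pmulr_lge0// rweight_gt0.
have pn0 : 0 < (2 * pi) ^+ n :> R by rewrite exprn_gt0.
rewrite -(ler_pM2r pn0) -{1}(ger0_norm (ltW pn0)) -normrM E (le_trans (ler_normD _ _))//.
rewrite mulrDl lerD//.
  apply: (le_trans (smoothing_le _ eps0 df fM)).
  by rewrite exprMn mulrA ler_wpM2r ?exprn_ge0 ?pi_ge0// ler_peMr// exprn_ege1// ler1n.
apply: (le_trans (le_normr_Rintegral measurableT idK)).
apply: (@le_trans _ _ (\int[mu]_t (e / 2 * K t + 2 * C * \sum_j \prod_i Q j i (tnth t i)))%R).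
  apply: le_Rintegral => //.
  - exact: (integrable_norm idK).
  - rewrite (_ : _ \o _ = (fun t => (e / 2 * K t)%:E + (2 * C * \sum_j \prod_i Q j i (tnth t i))%:E)%E)//.
    apply: integrableD => //; first exact: (integrableZl measurableT (e / 2) iP).
    exact: (integrableZl measurableT (2 * C) iQs).
rewrite RintegralD//; last 2 first.
- exact: (integrableZl measurableT (e / 2) iP).
- exact: (integrableZl measurableT (2 * C) iQs).
rewrite RintegralZl// RintegralZl// EP EQs !mulrA -mulrDl ler_wpM2r ?(ltW pn0)//.
rewrite [leRHS]splitr lerD2l.
have -> : 2 * C * n%:R * 2 * eps / d = 4 * C * n%:R * (eps / d) by field; rewrite gt_eqF.
exact: heps.
Qed.

End Inversion.

(** * The Euclidean norm and polynomial majorants *)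

Section RowNorm.
Context {R : realType} {n : nat}.
Implicit Types (x y : 'rV[R]_n) (i j : 'I_n).

Lemma enorm_ge0 x : 0 <= enorm x.
Proof. exact: sqrtr_ge0. Qed.

Lemma enorm_le_coord x y : (forall i, `|x 0 i| <= `|y 0 i|) -> enorm x <= enorm y.
Proof.
move=> h; apply: ler_wsqrtr; apply: ler_sum => i _.
by rewrite -!expr2 -[leLHS]real_normK ?num_real// -[leRHS]real_normK ?num_real// lerXn2r ?nnegrE.
Qed.

Lemma coord_le_enorm x j : `|x 0 j| <= enorm x.
Proof.
rewrite -sqrtr_sqr; apply: ler_wsqrtr; rewrite /dot (bigD1 j)//= -expr2 lerDl.
by apply: sumr_ge0 => i _; rewrite -expr2 sqr_ge0.
Qed.

Lemma enorm_le_max x : (0 < n)%N -> exists j, enorm x <= n%:R * `|x 0 j|.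
Proof.
move=> n0; pose j := [arg max_(j > Ordinal n0) `|x 0 j|]%O.
have hj i : `|x 0 i| <= `|x 0 j|.
  by rewrite /j; case: arg_maxP => //= k _; apply.
exists j; rewrite -[leRHS]ger0_norm ?mulr_ge0// -sqrtr_sqr; apply: ler_wsqrtr.
apply: (@le_trans _ _ (\sum_(i < n) `|x 0 j| ^+ 2)).
  apply: ler_sum => i _; rewrite -expr2 -[leLHS]real_normK ?num_real// lerXn2r ?nnegrE//.
rewrite sumr_const card_ord -[leLHS]mulr_natl exprMn ler_wpM2r ?sqr_ge0//.
by rewrite -natrX ler_nat expnS leq_pmulr// expn_gt0 n0.
Qed.

Lemma rweight_ge x : 1 <= 2 ^+ n * (1 + enorm x ^+ (2 * n)) * rweight x.
Proof.
pose r := enorm x; have r0 : 0 <= r by exact: enorm_ge0.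
have h : (\prod_(i < n) (1 + x 0 i ^+ 2)) <= 2 ^+ n * (1 + r ^+ (2 * n)).
  apply: (@le_trans _ _ ((1 + r ^+ 2) ^+ n)).
    rewrite -[n in leRHS]card_ord -prodr_const; apply: ler_prod => i _.
    rewrite addr_ge0 ?sqr_ge0//= lerD2l -[leLHS]real_normK ?num_real// lerXn2r ?nnegrE//.
    exact: coord_le_enorm.
  have [r1|r1] := leP r 1.
    apply: (@le_trans _ _ (2 ^+ n)).
      rewrite lerXn2r ?nnegrE ?addr_ge0 ?sqr_ge0// -[2]/(1 + 1) lerD2l.
      by rewrite exprn_ile1.
    by rewrite ler_peMr ?exprn_ge0// lerDl exprn_ge0.
  apply: (@le_trans _ _ ((2 * r ^+ 2) ^+ n)).
    rewrite lerXn2r ?nnegrE ?addr_ge0 ?mulr_ge0 ?sqr_ge0// mulr_natl mulr2n lerD2r.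
    by rewrite exprn_ege1// ltW.
  by rewrite exprMn -exprM ler_wpM2l ?exprn_ge0// lerDr.
apply: le_trans (ler_wpM2r (ltW (rweight_gt0 x)) h).
by rewrite /rweight -big_split/= big1// => i _; rewrite divff// gt_eqF// ltr_pwDl// sqr_ge0.
Qed.

(** Polynomial weights of degree [2 * n] are what integrability over n coordinates costs: each
    coordinate needs a factor [1 + x_i^2]. *)
Lemma le_rweight x v B : 0 <= v -> (1 + enorm x ^+ (2 * n)) * v <= B ->
  v <= 2 ^+ n * B * rweight x.
Proof.
move=> v0 h; have := ler_wpM2r v0 (rweight_ge x); rewrite mul1r => /le_trans; apply.
rewrite mulrAC ler_wpM2r ?(ltW (rweight_gt0 x))//.
by rewrite -mulrA ler_wpM2l// exprn_ge0.
Qed.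

End RowNorm.

(** * Words of partial derivatives and rapidly decreasing functions *)

Section Words.
Context {R : realType} {n : nat}.
Implicit Types (f g : 'rV[R]_n -> R) (x xi : 'rV[R]_n) (w v s : seq 'I_n) (i j : 'I_n).

(* [Dop] differentiates in a fixed order of the coordinates; as long as only such
   words occur, the symmetry of partial derivatives is not needed. *)
Definition sorted_word w := sorted (fun i j : 'I_n => (i <= j)%N) w.

Lemma sorted_word_cons j w : sorted_word (j :: w) -> sorted_word w.
Proof. exact: path_sorted. Qed.

Lemma sorted_word_min j w : sorted_word (j :: w) -> all (fun i : 'I_n => (j <= i)%N) w.
Proof. by apply: order_path_min => a b c; exact: leq_trans. Qed.

Lemma sorted_word_subseq w v : subseq v w -> sorted_word w -> sorted_word v.
Proof. by apply: subseq_sorted => a b c; exact: leq_trans. Qed.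

Lemma sorted_word_nseq_cat k j w : all (fun i : 'I_n => (j <= i)%N) w ->
  sorted_word w -> sorted_word (nseq k j ++ w).
Proof.
move=> jw sw; elim: k => // k ih; rewrite /sorted_word/= path_min_sorted//.
by rewrite all_cat jw andbT all_nseq leqnn orbT.
Qed.

Lemma sorted_word_nseq k j : sorted_word (nseq k j).
Proof. by rewrite -[nseq k j]cats0; exact: sorted_word_nseq_cat. Qed.

Lemma sorted_word_split j w : sorted_word w -> all (fun i : 'I_n => (j <= i)%N) w ->
  exists k v, [/\ w = nseq k j ++ v, sorted_word v & all (fun i : 'I_n => (j < i)%N) v].
Proof.
elim: w => [|i w ih] sw; first by exists 0%N, [::].
rewrite [all _ _]/= => /andP[ji jw].
have [ij|ij] := eqVneq i j.
  have [k [v [wE sv av]]] := ih (sorted_word_cons sw) jw.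
  by exists k.+1, v; split => //; rewrite wE ij.
exists 0%N, (i :: w); split => //.
have lt : (j < i)%N by rewrite ltn_neqAle eq_sym ji andbT.
rewrite /= lt; apply: sub_all (sorted_word_min sw) => b; exact: leq_trans.
Qed.

(** One entry for each occurrence of [j] in [w], with that letter removed: the words that Leibniz'
    rule produces when the derivative falls on the factor [x_j]. *)
Fixpoint deletions j w : seq (seq 'I_n) :=
  if w is i :: v then (if i == j then [:: v] else [::]) ++ map (cons i) (deletions j v) else [::].

Lemma size_deletions j w : (size (deletions j w) <= size w)%N.
Proof.
elim: w => //= i w ih; rewrite size_cat size_map.
by case: eqP => _ /=; rewrite ?add1n ?add0n ?ltnS// leqW.
Qed.

Lemma deletions_subseq j w v : v \in deletions j w -> subseq v w /\ size w = (size v).+1.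
Proof.
elim: w v => // i w ih v; rewrite [deletions _ _]/= mem_cat => /orP[|/mapP[v' /ih[sv sz] ->]].
  by case: eqP => // _; rewrite inE => /eqP ->; rewrite subseq_cons.
by rewrite /= eqxx sv sz.
Qed.

Lemma derivable_coord x i j : is_derive x (delta_mx 0 i) (fun x : 'rV[R]_n => x 0 j) (i == j)%:R.
Proof.
apply: (@is_derive_quadratic _ _ _ _ _ _ 0) => h; rewrite !mxE eqxx/= mul0r.
by rewrite addrK eq_sym subrr normr0.
Qed.

Lemma is_derive_bigsum (I : eqType) (r : seq I) (F dF : I -> 'rV[R]_n -> R) x (e : 'rV[R]_n) :
  (forall v : I, v \in r -> is_derive x e (F v) (dF v x)) ->
  is_derive x e (fun x => \sum_(v <- r) F v x) (\sum_(v <- r) dF v x).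
Proof.
elim: r => [|v r ih] h.
  under eq_fun do rewrite big_nil; rewrite big_nil; exact: is_derive_cst.
under eq_fun do rewrite big_cons; rewrite big_cons.
apply: is_deriveD; first by apply: h; rewrite mem_head.
by apply: ih => u ur; apply: h; rewrite inE ur orbT.
Qed.

Lemma smooth_is_derive f s i x : smooth_real f ->
  is_derive x (delta_mx 0 i) (partials s f) (partials (i :: s) f x).
Proof. by move=> sf; split; [have [_] := sf s; exact|]. Qed.

Lemma is_derive_mulx f s (r : seq (seq 'I_n)) i j x : smooth_real f ->
  is_derive x (delta_mx 0 i)
    (fun x => x 0 j * partials s f x + \sum_(v <- r) partials v f x)
    (x 0 j * partials (i :: s) f x + ((i == j)%:R * partials s f x +
      \sum_(v <- r) partials (i :: v) f x)).
Proof.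
move=> sf; rewrite addrA; apply: is_deriveD; last first.
  by apply: (@is_derive_bigsum _ r (fun v => partials v f) (fun v => partials (i :: v) f)) => v _; exact: smooth_is_derive.
apply: is_derive_eq.
  apply: is_deriveM; [exact: derivable_coord|exact: smooth_is_derive].
by rewrite /GRing.scale/= mulrC [_ * (i == j)%:R]mulrC.
Qed.

Lemma partials_mulx f s j : smooth_real f ->
  partials s (fun x => x 0 j * f x) =
  (fun x => x 0 j * partials s f x + \sum_(v <- deletions j s) partials v f x).
Proof.
move=> sf; elim: s => [|i s ih]; first by apply/funext => x; rewrite big_nil addr0.
rewrite [LHS]/= ih; apply/funext => x.
rewrite [LHS](@derive_val _ _ _ _ _ _ _ (is_derive_mulx s (deletions j s) i j x sf)) /=.
congr (_ + _); rewrite big_cat big_map; congr (_ + _).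
by case: eqP => _; rewrite ?big_seq1 ?big_nil ?mul1r ?mul0r.
Qed.

Lemma smooth_mulx f j : smooth_real f -> smooth_real (fun x => x 0 j * f x).
Proof.
move=> sf s; rewrite partials_mulx//; split => [x|i x]; last first.
  by have [] := is_derive_mulx s (deletions j s) i j x sf.
have h1 : {for x, continuous (fun x : 'rV[R]_n => x 0 j * partials s f x)}.
  by have [cs _] := sf s; exact: (cvgM (@coord_continuous _ _ _ 0 j x) (cs x)).
have h2 : {for x, continuous (fun x : 'rV[R]_n => \sum_(v <- deletions j s) partials v f x)}.
  apply: (@continuous_big _ _ +%R 0 xpredT (@add_continuous _)) => v _.
  by have [] := sf v.
exact: (cvgD h1 h2).
Qed.

Lemma partialsD f g s : smooth_real f -> smooth_real g ->
  partials s (fun x => f x + g x) = (fun x => partials s f x + partials s g x).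
Proof.
move=> sf sg; elim: s => //= i s ->; apply/funext => x.
exact: (@derive_val _ _ _ _ _ _ _ (is_deriveD (smooth_is_derive s i x sf) (smooth_is_derive s i x sg))).
Qed.

Lemma smoothD f g : smooth_real f -> smooth_real g -> smooth_real (fun x => f x + g x).
Proof.
move=> sf sg s; rewrite partialsD//; split => [x|i x].
  by have [cf _] := sf s; have [cg _] := sg s; exact: (cvgD (cf x) (cg x)).
by have [] := is_deriveD (smooth_is_derive s i x sf) (smooth_is_derive s i x sg).
Qed.

Lemma partialsN f s : smooth_real f ->
  partials s (fun x => - f x) = (fun x => - partials s f x).
Proof.
move=> sf; elim: s => //= i s ->; apply/funext => x.
exact: (@derive_val _ _ _ _ _ _ _ (is_deriveN (smooth_is_derive s i x sf))).
Qed.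

Lemma smoothN f : smooth_real f -> smooth_real (fun x => - f x).
Proof.
move=> sf s; rewrite partialsN//; split => [x|i x].
  by have [cf _] := sf s; exact: (cvgN (cf x)).
by have [] := is_deriveN (smooth_is_derive s i x sf).
Qed.

(** Decay is asked for sorted words only, since these are the words that multi-indices produce;
    smoothness covers every order of differentiation. *)
Definition rapid f := smooth_real f /\ forall w m, sorted_word w ->
  exists M, forall x, enorm x ^+ m * `|partials w f x| <= M.

Lemma rapid_dominated f w : rapid f -> sorted_word w -> dominated (partials w f).
Proof.
move=> [sf rf] sw; split; first by have [] := sf w.
have [M0 h0] := rf w 0%N sw; have [M1 h1] := rf w (2 * n)%N sw.
exists (2 ^+ n * (M0 + M1)) => x; apply: le_rweight => //.
by rewrite mulrDl mul1r lerD// -[leLHS]mul1r -(expr0 (enorm x)).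
Qed.

Lemma rapid_mulx f j : rapid f -> rapid (fun x => x 0 j * f x).
Proof.
move=> [sf rf]; split=> [|w m sw]; first exact: smooth_mulx.
rewrite partials_mulx//.
have [M0 h0] := rf w m.+1 sw.
have [M1 h1] : exists M, forall x, \sum_(v <- deletions j w) enorm x ^+ m * `|partials v f x| <= M.
  have : forall v, v \in deletions j w -> sorted_word v.
    by move=> v /deletions_subseq[sv _]; exact: sorted_word_subseq sw.
  elim: (deletions j w) => [_|v r ih h]; first by exists 0 => x; rewrite big_nil.
  have [M1 h1] := rf v m (h v (mem_head _ _)).
  have [|M2 h2] := ih; first by move=> u ur; apply: h; rewrite inE ur orbT.
  by exists (M1 + M2) => x; rewrite big_cons lerD.
exists (M0 + M1) => x.
rewrite (le_trans (ler_wpM2l _ (ler_normD _ _))) ?exprn_ge0 ?enorm_ge0//.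
rewrite mulrDr lerD//.
  apply: le_trans (h0 x); rewrite normrM mulrA ler_wpM2r// exprSr.
  by rewrite ler_wpM2l ?exprn_ge0 ?enorm_ge0// coord_le_enorm.
apply: le_trans (h1 x); rewrite -mulr_sumr ler_wpM2l ?exprn_ge0 ?enorm_ge0//.
exact: ler_norm_sum.
Qed.

Definition xmul s f : 'rV[R]_n -> R := foldr (fun j g x => x 0 j * g x) f s.

Lemma rapid_xmul f s : rapid f -> rapid (xmul s f).
Proof. by move=> rf; elim: s => //= j s ih; exact: rapid_mulx. Qed.

Lemma rapid_trans_derive f th xi j : rapid f ->
  is_derive xi (delta_mx 0 j) (cos_transform th f) (cos_transform (th - pi / 2) (fun x => x 0 j * f x) xi).
Proof.
move=> rf; apply: cos_transform_derive.
- exact: (@rapid_dominated f [::]).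
- exact: (@rapid_dominated _ [::] (rapid_mulx j rf)).
- exact: (@rapid_dominated _ [::] (rapid_mulx j (rapid_mulx j rf))).
Qed.

Lemma partials_trans f th s : rapid f ->
  partials s (cos_transform th f) = cos_transform (th - (size s)%:R * (pi / 2)) (xmul s f).
Proof.
move=> rf; elim: s => [|j s ih] /=; first by rewrite mul0r subr0.
rewrite ih; apply/funext => xi.
rewrite [LHS](@derive_val _ _ _ _ _ _ _ (rapid_trans_derive _ xi j (rapid_xmul s rf))).
by congr (cos_transform _ _ _); rewrite -natr1; ring.
Qed.

(** Every word is allowed here, sorted or not: derivatives of the transform become multiplications
    by coordinates, which keep [f] rapidly decreasing. *)
Lemma smooth_trans f th : rapid f -> smooth_real (cos_transform th f).
Proof.
move=> rf s; rewrite partials_trans//; have rs := rapid_xmul s rf; split => [|j x].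
  apply: cos_transform_continuous => [|j]; first exact: (@rapid_dominated _ [::] rs).
  exact: (@rapid_dominated _ [::] (rapid_mulx j rs)).
by have [] := rapid_trans_derive (th - (size s)%:R * (pi / 2)) x j rs.
Qed.

Definition wpow w xi : R := \prod_(i <- w) xi 0 i.

Lemma wpow_le w xi : `|wpow w xi| <= enorm xi ^+ size w.
Proof.
elim: w => [|i w ih]; first by rewrite /wpow big_nil normr1 expr0.
by rewrite /wpow big_cons normrM exprS ler_pM// coord_le_enorm.
Qed.

Lemma wpow_nseq k j xi : wpow (nseq k j) xi = xi 0 j ^+ k.
Proof. by elim: k => [|k ih]; rewrite /wpow ?big_nil// big_cons exprS -ih. Qed.

(** Letters are used from the innermost derivative outwards, so the intermediate words are suffixes
    of [w] and remain sorted. *)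
Lemma wpow_trans f th w xi : rapid f -> sorted_word w ->
  wpow w xi * cos_transform th f xi = cos_transform (th - (size w)%:R * (pi / 2)) (partials w f) xi.
Proof.
move=> rf; elim: w => [|j w ih] sw; first by rewrite /wpow big_nil mul1r mul0r subr0.
have sw' := sorted_word_cons sw.
rewrite /wpow big_cons -mulrA ih// cos_transform_partial.
- by congr (cos_transform _ _ _); rewrite /= -natr1; ring.
- exact: rapid_dominated.
- exact: (rapid_dominated rf sw).
- by move=> x; have [sf _] := rf; have [_] := sf w; exact.
Qed.

End Words.

(** * Decay, sup bounds on derivatives and the joint estimate *)

Section Core.
Context {R : realType} {n : nat} (omega : R -> R) (W : weight_function omega) (n_gt0 : (0 < n)%N).
Implicit Types (f g : 'rV[R]_n -> R) (x xi : 'rV[R]_n) (w v s : seq 'I_n) (i j : 'I_n).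
Implicit Types (lam mu C : R).
Local Notation young_real := (young_real omega).

Definition decays f := forall lam, 0 < lam -> exists C, forall x,
  expR (lam * omega (enorm x)) * `|f x| <= C.

Definition joint_decay f := forall lam mu, 0 < lam -> 0 < mu -> exists C,
  forall w x, sorted_word w ->
    expR (mu * omega (enorm x)) * `|partials w f x| * young_real lam (size w) <= C.

(** The norm is at most [n] times some coordinate, and [omega_scale] removes the factor [n]. As
    [lam] and [D] do not depend on [v], the result applies uniformly to families of derivatives. *)
Lemma weight_of_coord_powers mu : 0 < mu -> exists lam D, [/\ 0 < lam, 0 < D &
  forall x (v : R) C, 0 <= v ->
    (forall j k, `|x 0 j| ^+ k * v * young_real lam k <= C) ->
    v * expR (mu * omega (enorm x)) <= D * C].
Proof.
move=> mu0; have [L L0 hL] := omega_scale W n.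
have muL0 : 0 < mu * L by rewrite mulr_gt0.
have [lam [D [l0 D0 h]]] := weight_of_powers W muL0.
exists lam, (expR (mu * L) * D); split => //; first by rewrite mulr_gt0 ?expR_gt0.
move=> x v C v0 hv; have [j hj] := enorm_le_max x n_gt0.
apply: (@le_trans _ _ (v * (expR (mu * L) * expR (mu * L * omega `|x 0 j|)))).
  rewrite ler_wpM2l// -expRD ler_expR -mulrA -mulrDr ler_wpM2l ?(ltW mu0)//.
  apply: (@le_trans _ _ (omega (n%:R * `|x 0 j|))).
    by apply: (weight_nondecreasing W); rewrite ?enorm_ge0.
  by rewrite (le_trans (hL _ _))// mulrDr mulr1 addrC.
rewrite mulrCA -[leRHS]mulrA ler_wpM2l ?expR_ge0//.
by apply: h => // k; exact: hv.
Qed.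

Lemma decays_of_powers f : (forall lam, 0 < lam -> exists C, forall j k x,
    `|x 0 j| ^+ k * `|f x| * young_real lam k <= C) -> decays f.
Proof.
move=> h mu mu0; have [lam [D [l0 D0 hD]]] := weight_of_coord_powers mu0.
have [C hC] := h lam l0; exists (D * C) => x.
by rewrite mulrC; apply: hD.
Qed.

(** [xi_j ^+ k] times the transform is the transform of a pure derivative of order [k] in direction
    [j]; the polynomial weight makes that derivative integrable. *)
Lemma decays_trans f : rapid f ->
  (forall lam, 0 < lam -> exists C, forall j k x,
    (1 + enorm x ^+ (2 * n)) * `|partials (nseq k j) f x| * young_real lam k <= C) ->
  forall th, decays (cos_transform th f).
Proof.
move=> rf h th; apply: decays_of_powers => lam l0; have [C hC] := h lam l0.
exists (2 ^+ n * C * pi ^+ n) => j k xi.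
have sw := sorted_word_nseq k j.
have C0 : 0 <= C.
  apply: le_trans (hC (Ordinal n_gt0) 0%N 0).
  by rewrite mulr_ge0 ?young_real_ge0// mulr_ge0// addr_ge0// exprn_ge0// enorm_ge0.
rewrite -normrX -wpow_nseq -normrM wpow_trans//.
have [y0|ny0] := eqVneq (young_real lam k) 0.
  by rewrite y0 mulr0 !mulr_ge0 ?exprn_ge0 ?pi_ge0.
have y0 : 0 < young_real lam k by rewrite lt_def ny0 young_real_ge0.
rewrite -ler_pdivlMr// mulrAC.
apply: cos_transform_le; first by have [+ _] := rapid_dominated rf sw.
move=> x; rewrite -[2 ^+ n * C / _]mulrA; apply: le_rweight => //.
by rewrite ler_pdivlMr//; exact: hC.
Qed.

Lemma enorm_pow_weight : exists lam D, [/\ 0 < lam, 0 < D & forall x,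
  1 + enorm x ^+ (2 * n) <= D * expR (lam * omega (enorm x))].
Proof.
have [lam [C [l0 C0 h]]] := pow_weight W (2 * n).
exists lam, (1 + C); split => //; first by rewrite addr_gt0.
move=> x; rewrite mulrDl mul1r lerD ?h ?enorm_ge0//.
by rewrite expR_ge1// mulr_ge0 ?(ltW l0)// (weight_ge0 W)// enorm_ge0.
Qed.

Lemma trans_decays_unif f : rapid f -> decays (cos_transform 0 f) -> decays (cos_transform (pi / 2) f) ->
  forall lam, 0 < lam -> exists C, forall th xi,
    expR (lam * omega (enorm xi)) * `|cos_transform th f xi| <= C.
Proof.
move=> rf h0 h1 lam l0; have [C0 hC0] := h0 lam l0; have [C1 hC1] := h1 lam l0.
have df : dominated f by exact: (@rapid_dominated _ _ f [::]).
exists (C0 + C1) => th xi; rewrite cos_transformE//.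
rewrite (le_trans (ler_wpM2l (expR_ge0 _) (ler_normD _ _)))// mulrDr lerD//.
  apply: le_trans (hC0 xi); rewrite ler_wpM2l ?expR_ge0// normrM ler_piMl//.
  by rewrite ler_norml cos_geN1 cos_le1.
apply: le_trans (hC1 xi); rewrite ler_wpM2l ?expR_ge0// normrM ler_piMl//.
by rewrite ler_norml sin_geN1 sin_le1.
Qed.

Lemma derivative_bound f : rapid f -> decays (cos_transform 0 f) -> decays (cos_transform (pi / 2) f) ->
  forall lam, 0 < lam -> exists C, forall w x, sorted_word w ->
    `|partials w f x| * young_real lam (size w) <= C.
Proof.
move=> rf h0 h1 lam l0.
have [lam1 [D [l10 D0 hD]]] := enorm_pow_weight.
(* [lam] pays for the monomial of the derivative, [lam1] for the polynomial weight that
   [inversion_le] asks of the transform. *)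
have [C hC] := trans_decays_unif rf h0 h1 (addr_gt0 l10 l0).
have C0 : 0 <= C.
  by apply: le_trans (hC 0 0); rewrite mulr_ge0 ?expR_ge0.
pose B := expR (lam * omega 1) * (D * C).
exists (2 ^+ n * B) => w x sw.
have B0 : 0 <= B by rewrite !mulr_ge0 ?expR_ge0 ?(ltW D0).
have [y0|ny0] := eqVneq (young_real lam (size w)) 0.
  by rewrite y0 mulr0 mulr_ge0// exprn_ge0.
have y0 : 0 < young_real lam (size w) by rewrite lt_def ny0 young_real_ge0.
rewrite -ler_pdivlMr//; apply: inversion_le; first exact: rapid_dominated.
move=> th xi.
have -> : cos_transform th (partials w f) xi = wpow w xi * cos_transform (th + (size w)%:R * (pi / 2)) f xi.
  by rewrite wpow_trans// addrK.
rewrite -[2 ^+ n * B / _]mulrA; apply: le_rweight => //.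
rewrite ler_pdivlMr// normrM.
move: (hC (th + (size w)%:R * (pi / 2)) xi) => hCT.
have T0 : 0 <= `|cos_transform (th + (size w)%:R * (pi / 2)) f xi| by [].
move: (`|cos_transform _ _ _|) T0 hCT => T T0 hCT.
apply: (@le_trans _ _ (D * expR (lam1 * omega (enorm xi)) * (enorm xi ^+ size w * T) * young_real lam (size w))).
  rewrite ler_wpM2r ?(ltW y0)//; apply: ler_pM.
  - by rewrite addr_ge0// exprn_ge0// enorm_ge0.
  - by rewrite mulr_ge0.
  - exact: hD.
  - by rewrite ler_wpM2r// wpow_le.
have -> : D * expR (lam1 * omega (enorm xi)) * (enorm xi ^+ size w * T) * young_real lam (size w) =
  (young_real lam (size w) * enorm xi ^+ size w) * (D * expR (lam1 * omega (enorm xi)) * T) by ring.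
apply: (@le_trans _ _ ((expR (lam * omega 1) * expR (lam * omega (enorm xi))) *
   (D * expR (lam1 * omega (enorm xi)) * T))).
  rewrite ler_wpM2r ?mulr_ge0 ?expR_ge0 ?(ltW D0)//.
  by apply: young_real_pow_le => //; exact: enorm_ge0.
rewrite /B -mulrA ler_wpM2l ?expR_ge0//.
have -> : expR (lam * omega (enorm xi)) * (D * expR (lam1 * omega (enorm xi)) * T) =
   D * (expR ((lam1 + lam) * omega (enorm xi)) * T).
  by rewrite mulrDl expRD; ring.
by rewrite ler_wpM2l ?(ltW D0).
Qed.

(* Along the half-line leaving x in direction j away from 0, the Euclidean norm is
   at least that of x, so the decay of f at x persists on it. *)
Lemma outward_kolmogorov f v j k x (A B t : R) : smooth_real f -> 0 < t -> 0 <= A ->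
  (forall y : 'rV[R]_n, enorm x <= enorm y -> `|partials v f y| <= A) ->
  (forall y, `|partials (nseq k.*2 j ++ v) f y| <= B) ->
  `|partials (nseq k j ++ v) f x| <= 256 ^+ k * (A / t + B * t).
Proof.
move=> sf t0 A0 hA hB.
(* The direction pointing away from 0 in coordinate [j]; the powers of [sg] in [F] come from the
   chain rule and have modulus 1. *)
pose sg : R := if 0 <= x 0 j then 1 else -1.
have sg1 : `|sg| = 1 by rewrite /sg; case: ifP; rewrite ?normrN normr1.
pose F (i : nat) (s : R) := sg ^+ i * partials (nseq i j ++ v) f (x + (sg * s) *: delta_mx 0 j).
have Fd (i : nat) (s : R) : is_derive s 1 (F i) (F i.+1 s).
  have d1 : is_derive s 1 (fun s : R => sg * s) sg.
    have : is_derive s 1 (sg \*: (id : R -> R)) (sg *: 1) by exact: is_deriveZ.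
    by rewrite /GRing.scale/= mulr1.
  have d2 : is_derive (sg * s) 1 (fun s : R => partials (nseq i j ++ v) f (x + s *: delta_mx 0 j))
     (partials (nseq i.+1 j ++ v) f (x + (sg * s) *: delta_mx 0 j)).
    by apply: is_derive_line; have [_] := sf (nseq i j ++ v); exact.
  have : is_derive s 1 (sg ^+ i \*: ((fun s : R => partials (nseq i j ++ v) f (x + s *: delta_mx 0 j)) \o (fun s : R => sg * s)))
     (sg ^+ i *: (partials (nseq i.+1 j ++ v) f (x + (sg * s) *: delta_mx 0 j) * sg)).
    by apply: is_deriveZ; exact: is_derive1_comp.
  move/is_derive_eq; apply.
  by rewrite /F exprS /GRing.scale/=; ring.
have F0 (i : nat) : `|F i 0| = `|partials (nseq i j ++ v) f x|.
  by rewrite /F mulr0 scale0r addr0 normrM normrX sg1 expr1n mul1r.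
rewrite -F0; apply: kolmogorov => // s s0; last first.
  by rewrite /F normrM normrX sg1 expr1n mul1r.
rewrite /F expr0 mul1r; apply: hA; apply: enorm_le_coord => i.
rewrite !mxE eqxx/=; have [->|ij] := eqVneq i j; last by rewrite mulr0 addr0.
rewrite mulr1 /sg; case: ifPn => [xj|]; first by rewrite mul1r !ger0_norm ?addr_ge0// lerDl.
rewrite -ltNge => xj; rewrite mulN1r !ler0_norm ?(ltW xj)//; last by lra.
by lra.
Qed.

(* Induction on the number of coordinates in which derivatives are taken. *)
Lemma joint_decay_core f : rapid f -> decays f ->
  decays (cos_transform 0 f) -> decays (cos_transform (pi / 2) f) -> joint_decay f.
Proof.
move=> rf df h0 h1; have [sf _] := rf.
have D := derivative_bound rf h0 h1.
(* [m] counts the last coordinates, which sorted words list last: a word with letters at least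
   [n - m.+1] is a block of the new letter followed by a word already treated. *)
suff H m : (m <= n)%N -> forall lam mu, 0 < lam -> 0 < mu -> exists C, forall w x,
    sorted_word w -> all (fun i : 'I_n => (n - m <= i)%N) w ->
    expR (mu * omega (enorm x)) * `|partials w f x| * young_real lam (size w) <= C.
  move=> lam mu l0 m0; have [C hC] := H n (leqnn n) lam mu l0 m0.
  by exists C => w x sw; apply: hC => //; apply/allP => i _; rewrite subnn.
elim: m => [_|m ih mn] lam mu l0 m0.
  have [C hC] := df mu m0; exists (C * young_real lam 0) => -[x _ _|i w x _].
    by rewrite ler_wpM2r ?young_real_ge0.
  by rewrite /= subn0 leqNgt ltn_ord.
have mn' : (n - m.+1 < n)%N by rewrite ltn_subrL.
pose j := Ordinal mn'.
(* [lam'] absorbs the constant [256 ^+ k]; [lam1] is twice [lam'] because of the doubling in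
   [young_real_half]. The decay is taken with [2 * mu] since interpolation keeps half of it. *)
have [lam' [C3 [l'0 C30 hC3]]] := young_real_exp W 256 l0.
pose lam1 := 2 * lam'; have l10 : 0 < lam1 by rewrite mulr_gt0.
have [C1 hC1] := ih (ltnW mn) lam1 (2 * mu) l10 (mulr_gt0 (ltr0Sn _ 1) m0).
have [C2 hC2] := D lam1 l10.
have C10 : 0 <= C1.
  apply: le_trans (hC1 [::] 0 isT isT).
  by rewrite mulr_ge0 ?young_real_ge0// mulr_ge0// expR_ge0.
have C20 : 0 <= C2.
  by apply: le_trans (hC2 [::] 0 isT); rewrite mulr_ge0 ?young_real_ge0.
exists ((C1 + C2) * C3) => w x sw jw.
have C120 : 0 <= (C1 + C2) * C3 by rewrite mulr_ge0 ?addr_ge0// ltW.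
have [k [v [wE sv jv]]] := sorted_word_split (j := j) sw jw.
have jv' : all (fun i : 'I_n => (n - m <= i)%N) v.
  by apply: sub_all jv => i /=; rewrite subnS prednK// subn_gt0.
have swE : size w = (k + size v)%N by rewrite wE size_cat size_nseq.
pose Y := young_real lam' (size w).
(* If the factor vanishes at [lam'], then it vanishes at [lam] as well, by the choice of [lam'], and
   the claim is trivial. *)
have [Y0|nY0] := eqVneq Y 0.
  have : young_real lam (size w) = 0.
    have := hC3 (size w); rewrite -/Y Y0 mulr0 pmulr_rle0 ?exprn_gt0//.
    by move=> h; apply/eqP; rewrite eq_le h young_real_ge0.
  by move=> ->; rewrite mulr0.
have Yp : 0 < Y by rewrite lt_def nY0 young_real_ge0.
pose y1 := young_real lam1 (size v); pose y2 := young_real lam1 (k.*2 + size v).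
(* The order [2 * size w] splits as [size v] plus [k.*2 + size v], the orders of the two bounds
   being interpolated. *)
have YY : Y * Y <= y1 * y2.
  apply: (@le_trans _ _ (young_real lam1 (size w + size w))); first exact: young_real_half.
  rewrite swE [X in young_real lam1 X](_ : _ = size v + (k.*2 + size v))%N.
    exact: (young_real_addM W _ _ l10).
  by rewrite addnACA addnn [RHS]addnCA.
have yy0 : 0 < y1 * y2 by apply: lt_le_trans YY; rewrite mulr_gt0.
have y10 : 0 < y1.
  by rewrite lt_def young_real_ge0 andbT; apply: contraTneq yy0 => ->; rewrite mul0r ltxx.
have y20 : 0 < y2 by move: yy0; rewrite pmulr_rgt0.
pose E := expR (- (mu * omega (enorm x))); have E0 : 0 < E by exact: expR_gt0.
(* With this [t] the second term is exactly [C2 * E / Y], and by [YY] the first one is at most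
   [C1 * E / Y]. *)
pose t := E * y2 / Y; have t0 : 0 < t by rewrite divr_gt0 ?mulr_gt0.
have A0 : 0 <= C1 * (E * E) / y1 by rewrite divr_ge0 ?mulr_ge0 ?(ltW E0)// ltW.
have K : `|partials w f x| <= 256 ^+ k * (C1 * (E * E) / y1 / t + C2 / y2 * t).
  rewrite wE; apply: outward_kolmogorov => //.
    move=> y xy; rewrite ler_pdivlMr// -ler_pdivrMr ?mulr_gt0//.
    apply: le_trans (hC1 v y sv jv'); rewrite mulrAC ler_wpM2r ?(ltW y10)//.
    rewrite mulrC ler_wpM2r// invfM -expRN opprK -expRD ler_expR.
    rewrite -mulrDl -mulr2n -[mu *+ 2]mulr_natl ler_wpM2l ?mulr_ge0 ?(ltW m0)//.
    by apply: (weight_nondecreasing W); rewrite ?enorm_ge0.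
  move=> y; rewrite ler_pdivlMr//.
  have := hC2 (nseq k.*2 j ++ v) y; rewrite size_cat size_nseq; apply.
  apply: sorted_word_nseq_cat => //; apply: sub_all jv => i; exact: ltnW.
have tE : C1 * (E * E) / y1 / t + C2 / y2 * t <= (C1 + C2) * E / Y.
  have -> : C2 / y2 * t = C2 * E / Y by rewrite /t; field; rewrite nY0 gt_eqF.
  have -> : C1 * (E * E) / y1 / t = C1 * E * (Y / (y1 * y2)).
    by rewrite /t; field; rewrite nY0 !gt_eqF.
  rewrite -[leRHS]mulrA mulrDl -!mulrA lerD2r ler_wpM2l// ler_wpM2l ?(ltW E0)//.
  by rewrite ler_pdivrMr// mulrC ler_pdivlMr.
apply: (@le_trans _ _ (E^-1 * (256 ^+ k * ((C1 + C2) * E / Y)) * young_real lam (size w))).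
  rewrite /E -expRN opprK ler_wpM2r ?young_real_ge0// ler_wpM2l ?expR_ge0// (le_trans K)//.
  by rewrite ler_wpM2l// exprn_ge0.
have -> : E^-1 * (256 ^+ k * ((C1 + C2) * E / Y)) * young_real lam (size w) =
   (C1 + C2) * (256 ^+ k * young_real lam (size w) / Y) by field; rewrite nY0 gt_eqF.
rewrite ler_wpM2l ?addr_ge0// ler_pdivrMr//; apply: le_trans (hC3 (size w)).
by rewrite ler_wpM2r ?young_real_ge0// ler_weXn2l ?ler1n// swE leq_addr.
Qed.

(** For a fixed word, [lam] is taken with a positive factor, which is then divided out. *)
Lemma decays_partials f w : joint_decay f -> sorted_word w -> decays (partials w f).
Proof.
move=> jf sw mu m0; have [lam l0 y0] := young_real_gt0 W (size w).
have [C hC] := jf lam mu l0 m0; exists (C / young_real lam (size w)) => x.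
by rewrite ler_pdivlMr//; exact: hC.
Qed.

Lemma joint_decay_mulx f j : rapid f -> joint_decay f -> joint_decay (fun x => x 0 j * f x).
Proof.
move=> [sf _] jf lam mu l0 m0.
have [lam1 [K1 [l10 K10 hK1]]] := pow_weight W 1.
(* Leibniz' rule produces at most [size w <= 2 ^+ size w] shorter words, and [lam2] absorbs this
   power of 2. *)
have [lam2 [K2 [l20 K20 hK2]]] := young_real_pow2 W l0.
have [C1 hC1] := jf lam (mu + lam1) l0 (addr_gt0 m0 l10).
have [C2 hC2] := jf lam2 mu l20 m0.
have C20 : 0 <= C2.
  apply: le_trans (hC2 [::] 0 isT).
  by rewrite mulr_ge0 ?young_real_ge0// mulr_ge0// expR_ge0.
exists (K1 * C1 + K2 * C2) => w x sw; rewrite partials_mulx//.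
set E := expR _; have E0 : 0 <= E by exact: expR_ge0.
set y := young_real lam (size w); have y0 : 0 <= y by exact: young_real_ge0.
rewrite (le_trans (ler_wpM2r y0 (ler_wpM2l E0 (ler_normD _ _))))// mulrDr mulrDl lerD//.
  apply: (@le_trans _ _ (K1 * (expR ((mu + lam1) * omega (enorm x)) * `|partials w f x| * y))); last first.
    by rewrite ler_wpM2l ?(ltW K10)// hC1.
  have -> : K1 * (expR ((mu + lam1) * omega (enorm x)) * `|partials w f x| * y) =
     E * ((K1 * expR (lam1 * omega (enorm x))) * `|partials w f x|) * y.
    by rewrite mulrDl expRD /E; ring.
  rewrite ler_wpM2r// ler_wpM2l// normrM ler_wpM2r//.
  by rewrite (le_trans (coord_le_enorm x j))// -[leLHS]expr1 hK1 ?enorm_ge0.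
have sz v : v \in deletions j w -> E * `|partials v f x| * (2 ^+ size w * y) <= K2 * C2.
  move=> vd; have [sub szv] := deletions_subseq vd.
  have hv := hC2 v x (sorted_word_subseq sub sw).
  apply: (@le_trans _ _ (E * `|partials v f x| * (K2 * young_real lam2 (size v)))).
    rewrite ler_wpM2l ?mulr_ge0// (le_trans (hK2 (size w)))// ler_wpM2l ?(ltW K20)//.
    by apply: young_real_noninc => //; rewrite szv.
  by rewrite mulrCA ler_wpM2l ?(ltW K20).
have p2 : 0 < 2 ^+ size w :> R by rewrite exprn_gt0.
rewrite -(ler_pM2r p2).
apply: (@le_trans _ _ (\sum_(v <- deletions j w) K2 * C2)).
  rewrite -mulrA; apply: (@le_trans _ _ (E * (\sum_(v <- deletions j w) `|partials v f x|) * (y * 2 ^+ size w))).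
    by rewrite ler_wpM2r ?mulr_ge0 ?(ltW p2)// ler_wpM2l// ler_norm_sum.
  rewrite mulr_sumr mulr_suml big_seq [leRHS]big_seq; apply: ler_sum => v vd.
  by rewrite [y * _]mulrC sz.
rewrite big_const_seq count_predT iter_addr_0 -[leLHS]mulr_natr ler_wpM2l ?mulr_ge0 ?(ltW K20)//.
rewrite -natrX ler_nat (leq_trans (size_deletions j w))//.
by rewrite ltnW// ltn_expl.
Qed.

Lemma joint_decay_xmul f s : rapid f -> joint_decay f -> joint_decay (xmul s f).
Proof.
move=> rf jf; elim: s => //= j s ih.
by apply: joint_decay_mulx => //; exact: rapid_xmul.
Qed.

Lemma decays_trans_of_joint f th : rapid f -> joint_decay f -> decays (cos_transform th f).
Proof.
move=> rf jf; apply: decays_trans => // lam l0.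
have [lam1 [D [l10 D0 hD]]] := enorm_pow_weight.
have [C hC] := jf lam lam1 l0 l10; exists (D * C) => j k x.
have := hC (nseq k j) x (sorted_word_nseq k j); rewrite size_nseq => h.
apply: le_trans (ler_wpM2l (ltW D0) h).
by rewrite !mulrA ler_wpM2r ?young_real_ge0// ler_wpM2r.
Qed.

(** Differentiating the transform multiplies [f] by coordinates, which preserves the joint estimate,
    so only decay of transforms has to be known. *)
Lemma decays_partials_trans f th s : rapid f -> joint_decay f -> decays (partials s (cos_transform th f)).
Proof.
move=> rf jf; rewrite partials_trans//; apply: decays_trans_of_joint.
  exact: rapid_xmul.
exact: joint_decay_xmul.
Qed.

End Core.

(** * Complex values, multi-indices and the Fourier transform *)

Section Interface.
Context {R : realType} {n : nat}.
Implicit Types (u : 'rV[R]_n -> R[i]) (x xi : 'rV[R]_n) (al be : {ffun 'I_n -> nat}) (i j : 'I_n).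

Lemma normc_pair (a b : R) : Normc.normc (a +i* b)%C = Num.sqrt (a ^+ 2 + b ^+ 2).
Proof. by []. Qed.

Lemma normr_le_normc (a b : R) : `|a| <= Normc.normc (a +i* b)%C /\ `|b| <= Normc.normc (a +i* b)%C.
Proof.
by rewrite normc_pair -!sqrtr_sqr; split; apply: ler_wsqrtr;
  rewrite ?lerDl ?lerDr sqr_ge0.
Qed.

Lemma normc_le (a b : R) : Normc.normc (a +i* b)%C <= `|a| + `|b|.
Proof.
rewrite normc_pair -[leRHS]ger0_norm ?addr_ge0// -sqrtr_sqr; apply: ler_wsqrtr.
rewrite -[a ^+ 2]real_normK ?num_real// -[b ^+ 2]real_normK ?num_real//.
by rewrite sqrrD lerD2r lerDl mulrn_wge0// mulr_ge0.
Qed.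

Lemma normc_realM (r : R) (z : R[i]) : Normc.normc (r%:C%C * z) = `|r| * Normc.normc z.
Proof.
by rewrite Normc.normcM; congr (_ * _); rewrite /Normc.normc/= expr0n/= addr0 sqrtr_sqr.
Qed.

Lemma normc_Ni k (z : R[i]) : Normc.normc ((- 'i%C) ^+ k * z) = Normc.normc z.
Proof.
rewrite Normc.normcM (_ : Normc.normc _ = 1) ?mul1r//.
elim: k => [|k ih]; first by rewrite expr0 /Normc.normc/= expr0n/= addr0 expr1n sqrtr1.
rewrite exprS Normc.normcM ih mulr1 /Normc.normc/=.
by rewrite oppr0 expr0n/= add0r sqrrN expr1n sqrtr1.
Qed.

Definition cderiv al u x : R[i] :=
  (partials (mi_dirs al) (re_part u) x +i* partials (mi_dirs al) (im_part u) x)%C.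

Lemma normc_Dop al u x : Normc.normc (Dop al u x) = Normc.normc (cderiv al u x).
Proof. exact: normc_Ni. Qed.

Lemma xDE al be u x : xD al be u x = `|mi_pow x be| * Normc.normc (cderiv al u x).
Proof. by rewrite /xD normc_realM normc_Dop. Qed.

Lemma size_mi_dirs al : size (mi_dirs al) = mi_size al.
Proof.
rewrite size_flatten /shape -map_comp sumnE big_map -[RHS](big_enum _ _ xpredT)/=.
by apply: eq_bigr => j _; rewrite /= size_nseq.
Qed.

Lemma sorted_mi_dirs al : sorted_word (mi_dirs al).
Proof.
rewrite /mi_dirs.
have : sorted (fun i j : 'I_n => (i < j)%N) (enum 'I_n).
  have := iota_ltn_sorted 0 n; rewrite -val_enum_ord sorted_map.
  by apply: sub_sorted.
elim: (enum 'I_n) => //= j s ih sj.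
apply: sorted_word_nseq_cat; last by apply: ih; exact: path_sorted sj.
have : all (fun i : 'I_n => (j < i)%N) s by apply: order_path_min sj => a b c; exact: ltn_trans.
elim: s {ih sj} => //= i s ih /andP[ji /ih h]; rewrite all_cat h andbT all_nseq.
by rewrite (ltnW ji) orbT.
Qed.

(** A sorted word is determined by its letter counts, so sorted words are exactly the words of
    multi-indices; bounds on [Dop] thereby pass to [partials w]. *)
Lemma mi_dirs_count (w : seq 'I_n) : sorted_word w ->
  mi_dirs [ffun j => count_mem j w] = w.
Proof.
move=> sw; apply: (@sorted_eq _ (fun i j : 'I_n => (i <= j)%N)) => //.
- by move=> a b c; exact: leq_trans.
- by move=> a b /anti_leq/val_inj.
- exact: sorted_mi_dirs.
apply/allP => i _; rewrite /= /mi_dirs count_flatten -map_comp sumnE big_map.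
rewrite big_enum/=.
under eq_bigr do rewrite /= count_nseq ffunE.
rewrite (bigD1 i)//= eqxx mul1n big1 ?addn0// => j ji.
by rewrite (negbTE ji) mul0n.
Qed.

Definition mi_nseq k j : {ffun 'I_n -> nat} := [ffun i => if i == j then k else 0%N].

Lemma mi_pow_nseq x k j : mi_pow x (mi_nseq k j) = x 0 j ^+ k.
Proof.
rewrite /mi_pow (bigD1 j)//= ffunE eqxx big1 ?mulr1// => i ij.
by rewrite ffunE (negbTE ij) expr0.
Qed.

Lemma mi_size_nseq k j : mi_size (mi_nseq k j) = k.
Proof.
rewrite /mi_size (bigD1 j)//= ffunE eqxx big1 ?addn0// => i ij.
by rewrite ffunE (negbTE ij).
Qed.

Lemma mi_dirs_nseq k j : mi_dirs (mi_nseq k j) = nseq k j.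
Proof.
rewrite -[RHS]mi_dirs_count; last exact: sorted_word_nseq.
congr mi_dirs; apply/ffunP => i; rewrite !ffunE count_nseq/=.
by rewrite eq_sym; case: eqP => _; rewrite ?mul1n ?mul0n.
Qed.

Lemma mi_pow_le x be : `|mi_pow x be| <= enorm x ^+ mi_size be.
Proof.
rewrite /mi_pow /mi_size; elim/big_rec2: _ => [|i k p _ h]; first by rewrite normr1 expr0.
by rewrite normrM exprD ler_pM// normrX lerXn2r ?nnegrE ?enorm_ge0// coord_le_enorm.
Qed.

Lemma mi_sizeD al be : mi_size (al + be) = (mi_size al + mi_size be)%N.
Proof. by rewrite /mi_size -big_split/=; apply: eq_bigr => i _; rewrite ffunE. Qed.

Lemma ereal_sup_ltyP (T : Type) (F : T -> R) :
  (ereal_sup (range (fun x : T => (F x)%:E)) < +oo)%E <-> exists M, forall x : T, F x <= M.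
Proof.
split=> [|[M h]]; last first.
  by apply: (@le_lt_trans _ _ M%:E); [apply: ge_ereal_sup => _ [x _ <-]; rewrite lee_fin|rewrite ltry].
case E : (ereal_sup _) => [r| |] // _.
  exists r => x; rewrite -lee_fin -E; apply: ereal_sup_ubound; by exists x.
exists 0 => x.
have := @ereal_sup_ubound _ (range (fun x : T => (F x)%:E)) (F x)%:E.
by rewrite E => /(_ (ex_intro2 _ _ x I erefl)).
Qed.

Lemma ereal_sup_leP (T : Type) (F : T -> \bar R) (C : \bar R) :
  (ereal_sup (range F) <= C)%E <-> forall x : T, (F x <= C)%E.
Proof.
split=> [h x|h]; last by apply: ge_ereal_sup => _ [x _ <-].
by apply: le_trans h; apply: ereal_sup_ubound; exists x.
Qed.

Lemma schwartz_rapid u : (0 < n)%N -> schwartz u -> rapid (re_part u) /\ rapid (im_part u).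
Proof.
move=> n0 [[sr si] h].
have H w m : sorted_word w -> exists M, forall x, enorm x ^+ m * Normc.normc
    (partials w (re_part u) x +i* partials w (im_part u) x)%C <= M.
  move=> sw; pose al := [ffun j => count_mem j w] : {ffun 'I_n -> nat}.
  have alw : mi_dirs al = w by exact: mi_dirs_count.
  have /choice[M hM] : forall j, exists M, forall x, xD al (mi_nseq m j) u x <= M.
    by move=> j; apply/ereal_sup_ltyP; exact: h.
  have M0 j : 0 <= M j.
    by apply: le_trans (hM j 0); rewrite xDE mulr_ge0// /cderiv normc_pair sqrtr_ge0.
  exists (n%:R ^+ m * \sum_j M j) => x.
  have [j hj] := enorm_le_max x n0.
  apply: (@le_trans _ _ ((n%:R * `|x 0 j|) ^+ m * Normc.normc (cderiv al u x))).
    rewrite /cderiv alw ler_wpM2r//; first by rewrite normc_pair sqrtr_ge0.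
    by rewrite lerXn2r ?nnegrE ?enorm_ge0 ?mulr_ge0.
  rewrite exprMn -mulrA ler_wpM2l ?exprn_ge0//.
  apply: (@le_trans _ _ (M j)); first by have := hM j x; rewrite xDE mi_pow_nseq normrX.
  by rewrite (bigD1 j)//= lerDl sumr_ge0.
split; split => // w m sw; have [M hM] := H w m sw; exists M => x; apply: le_trans (hM x).
  by rewrite ler_wpM2l ?exprn_ge0 ?enorm_ge0//; have [] := normr_le_normc (partials w (re_part u) x) (partials w (im_part u) x).
by rewrite ler_wpM2l ?exprn_ge0 ?enorm_ge0//; have [] := normr_le_normc (partials w (re_part u) x) (partials w (im_part u) x).
Qed.

Lemma fourier_re u : rapid (re_part u) -> rapid (im_part u) ->
  re_part (fourier u) = (fun xi => cos_transform 0 (re_part u) xi + cos_transform (pi / 2) (im_part u) xi).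
Proof.
move=> ra rb; apply/funext => xi.
have da := @rapid_dominated _ _ _ [::] ra isT; have db := @rapid_dominated _ _ _ [::] rb isT.
rewrite /cos_transform -(@integral_rowD _ _ (fun x => cosdot 0 xi x * re_part u x)
  (fun x => cosdot (pi / 2) xi x * im_part u x)); try exact: dominated_cosdot.
rewrite /re_part/=; apply: eq_Rintegral => t _.
rewrite /re_part /im_part /cosdot subr0 cosBpihalf/=.
case: (u _) => a b /=; rewrite cosN sinN; ring.
Qed.

Lemma fourier_im u : rapid (re_part u) -> rapid (im_part u) ->
  im_part (fourier u) = (fun xi => cos_transform 0 (im_part u) xi + - cos_transform (pi / 2) (re_part u) xi).
Proof.
move=> ra rb; apply/funext => xi.
have da := @rapid_dominated _ _ _ [::] ra isT; have db := @rapid_dominated _ _ _ [::] rb isT.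
rewrite /cos_transform -mulN1r -(@integral_rowZ _ _ (fun x => cosdot (pi / 2) xi x * re_part u x)); last exact: dominated_cosdot.
rewrite -(@integral_rowD _ _ (fun x => cosdot 0 xi x * im_part u x)
  (fun x => -1 * (cosdot (pi / 2) xi x * re_part u x))); last 2 first.
- exact: dominated_cosdot.
- by apply: dominatedZ; exact: dominated_cosdot.
rewrite /im_part/=; apply: eq_Rintegral => t _.
rewrite /re_part /im_part /cosdot subr0 cosBpihalf/=.
case: (u _) => a b /=; rewrite cosN sinN; ring.
Qed.

End Interface.

(** * Stability of decay under sums, multiples and reflection *)

Section DecayClosure.
Context {R : realType} {n : nat} (omega : R -> R).
Implicit Types (f g : 'rV[R]_n -> R) (x xi : 'rV[R]_n) (v : 'rV[R]_n -> R[i]) (lam : R).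
Local Notation decays := (@decays R n omega).

Lemma enormN x : enorm (- x) = enorm x.
Proof.
by apply/eqP; rewrite eq_le !enorm_le_coord// => i; rewrite mxE normrN.
Qed.

Lemma decaysD f g : decays f -> decays g -> decays (fun x => f x + g x).
Proof.
move=> df dg lam l0; have [C hC] := df lam l0; have [D hD] := dg lam l0.
exists (C + D) => x; apply: (le_trans (ler_wpM2l (expR_ge0 _) (ler_normD _ _))).
by rewrite mulrDr lerD.
Qed.

Lemma decaysN f : decays f -> decays (fun x => - f x).
Proof.
by move=> df lam l0; have [C hC] := df lam l0; exists C => x; rewrite normrN.
Qed.

Lemma decaysZ (c : R) f : decays f -> decays (fun x => c * f x).
Proof.
move=> df lam l0; have [C hC] := df lam l0; exists (`|c| * C) => x.
by rewrite normrM mulrCA ler_wpM2l.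
Qed.

Lemma decays_reflect f : decays f -> decays (fun x => f (- x)).
Proof.
by move=> df lam l0; have [C hC] := df lam l0; exists C => x; rewrite -enormN.
Qed.

Lemma cos_transform0_reflect f xi : cos_transform 0 f (- xi) = cos_transform 0 f xi.
Proof. by rewrite cos_transform_opp oppr0. Qed.

Lemma cos_transform_pihalf_reflect f xi : dominated f ->
  cos_transform (pi / 2) f (- xi) = - cos_transform (pi / 2) f xi.
Proof.
by move=> df; rewrite cos_transform_opp cos_transformE// cosN sinN cos_pihalf sin_pihalf mul0r add0r mulN1r.
Qed.

Lemma weighted_boundedP lam v : weighted_bounded omega lam v <->
  exists M, forall x, expR (lam * omega (enorm x)) * Normc.normc (v x) <= M.
Proof. exact: ereal_sup_ltyP. Qed.

Lemma decays_of_weighted_bounded v :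
  (forall lam, 0 < lam -> weighted_bounded omega lam v) ->
  decays (re_part v) /\ decays (im_part v).
Proof.
move=> h; split => lam /h/weighted_boundedP[M hM]; exists M => x;
  apply: le_trans (hM x); rewrite ler_wpM2l ?expR_ge0//;
  rewrite /re_part /im_part; case: (v x) => p q;
  by have [] := normr_le_normc p q.
Qed.

Lemma weighted_bounded_of_decays v f g : decays f -> decays g ->
  (forall x, Normc.normc (v x) = Normc.normc (f x +i* g x)%C) ->
  forall lam, 0 < lam -> weighted_bounded omega lam v.
Proof.
move=> df dg vE lam l0; apply/weighted_boundedP.
have [C hC] := df lam l0; have [D hD] := dg lam l0; exists (C + D) => x.
rewrite vE (le_trans (ler_wpM2l (expR_ge0 _) (normc_le _ _)))//.
by rewrite mulrDr lerD.
Qed.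

Lemma weighted_bounded_Dop v al :
  decays (partials (mi_dirs al) (re_part v)) ->
  decays (partials (mi_dirs al) (im_part v)) ->
  forall lam, 0 < lam -> weighted_bounded omega lam (Dop al v).
Proof.
move=> hf hg; apply: (weighted_bounded_of_decays hf hg) => x; exact: normc_Dop.
Qed.

End DecayClosure.

(** * The implications between the conditions *)

Section Equivalence.
Context {R : realType} {n : nat} (n_gt0 : (0 < n)%N).
Context (omega : R -> R) (W : weight_function omega).
Context (u : 'rV[R]_n -> R[i]) (u_schwartz : schwartz u).
Implicit Types (x xi : 'rV[R]_n) (al be : {ffun 'I_n -> nat}) (lam mu : R).
Local Notation young_real := (young_real omega).
Local Notation decays := (@decays R n omega).
Local Notation re := (re_part u).
Local Notation im := (im_part u).
Local Notation joint_decays := (joint_decay omega re /\ joint_decay omega im).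

Let rapid_re : rapid re.
Proof. by have [] := schwartz_rapid n_gt0 u_schwartz. Qed.

Let rapid_im : rapid im.
Proof. by have [] := schwartz_rapid n_gt0 u_schwartz. Qed.

Let dominated_re : dominated re.
Proof. exact: (@rapid_dominated _ _ _ [::]). Qed.

Let dominated_im : dominated im.
Proof. exact: (@rapid_dominated _ _ _ [::]). Qed.

Lemma mi_dirs0 : mi_dirs (0 : {ffun 'I_n -> nat}) = [::].
Proof.
apply: size0nil; rewrite size_mi_dirs /mi_size big1// => i _; by rewrite ffunE.
Qed.

Lemma mi_pow0 x : mi_pow x 0 = 1.
Proof. by rewrite /mi_pow big1// => i _; rewrite ffunE expr0. Qed.

Lemma normc_Dop0 v x : Normc.normc (Dop (0 : {ffun 'I_n -> nat}) v x) = Normc.normc (v x).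
Proof.
by rewrite normc_Dop /cderiv mi_dirs0 /= /re_part /im_part; case: (v x).
Qed.

Lemma xD_ge al be x :
  `|mi_pow x be| * `|partials (mi_dirs al) re x| <= xD al be u x /\
  `|mi_pow x be| * `|partials (mi_dirs al) im x| <= xD al be u x.
Proof.
rewrite xDE /cderiv.
by have [h1 h2] := normr_le_normc (partials (mi_dirs al) re x) (partials (mi_dirs al) im x);
  split; rewrite ler_wpM2l.
Qed.

Lemma xD_le al be x : xD al be u x <= enorm x ^+ mi_size be *
  (`|partials (mi_dirs al) re x| + `|partials (mi_dirs al) im x|).
Proof.
rewrite xDE ler_pM//; [by rewrite /cderiv normc_pair sqrtr_ge0|exact: mi_pow_le|exact: normc_le].
Qed.

Lemma young_supP al be y (C : R) :
  (ereal_sup (range (fun x => (xD al be u x)%:E * y%:E)) <= C%:E)%E <->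
  forall x, xD al be u x * y <= C.
Proof.
split=> [/ereal_sup_leP h x|h]; last by apply/ereal_sup_leP => x; rewrite -EFinM lee_fin.
by have := h x; rewrite -EFinM lee_fin.
Qed.

Lemma young_sup2P al be y z (C : R) :
  (ereal_sup (range (fun x => (xD al be u x)%:E * y%:E * z%:E)) <= C%:E)%E <->
  forall x, xD al be u x * y * z <= C.
Proof.
split=> [/ereal_sup_leP h x|h]; last by apply/ereal_sup_leP => x; rewrite -!EFinM lee_fin.
by have := h x; rewrite -!EFinM lee_fin.
Qed.

Lemma monomials_of_derivatives :
  weighted_derivatives omega u -> weighted_monomials omega u.
Proof.
move=> h lam al l0; have [mu [C [m0 C0 hC]]] := pow_weight W (mi_size al).
have H v : (forall mu, 0 < mu -> weighted_bounded omega mu (Dop 0 v)) ->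
    weighted_bounded omega lam (fun x : 'rV[R]_n => (mi_pow x al)%:C%C * v x).
  move=> /(_ _ (addr_gt0 l0 m0))/weighted_boundedP[M hM].
  apply/weighted_boundedP; exists (C * M) => x; rewrite normc_realM.
  have := ler_wpM2l (ltW C0) (hM x); rewrite normc_Dop0; apply: le_trans.
  rewrite mulrDl expRD mulrCA [leRHS](_ : _ = (C * expR (mu * omega (enorm x))) *
    (expR (lam * omega (enorm x)) * Normc.normc (v x))); last by ring.
  rewrite ler_wpM2r//; last by rewrite (le_trans (mi_pow_le _ _))// hC// enorm_ge0.
  by rewrite mulr_ge0 ?expR_ge0//; case: (v x) => p q; rewrite normc_pair sqrtr_ge0.
by split; apply: H => k k0; have [] := h k 0 k0.
Qed.

Lemma values_of_monomials :
  weighted_monomials omega u -> weighted_values omega u.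
Proof.
move=> h lam l0; have [/weighted_boundedP[M hM] /weighted_boundedP[N hN]] := h lam 0 l0.
split; apply/weighted_boundedP; [exists M => x; have := hM x|exists N => x; have := hN x];
  by rewrite normc_realM mi_pow0 normr1 mul1r.
Qed.

(** The transform of phase 0 is even and that of phase [pi / 2] is odd. Even and odd parts of the
    real and imaginary parts of the Fourier transform therefore separate the four real
    transforms. *)
Lemma decays_trans_of_fourier :
  decays (re_part (fourier u)) -> decays (im_part (fourier u)) ->
  [/\ decays (cos_transform 0 re), decays (cos_transform (pi / 2) re),
      decays (cos_transform 0 im) & decays (cos_transform (pi / 2) im)].
Proof.
move=> dR dI; have dR' := decays_reflect dR; have dI' := decays_reflect dI.
move: dR dI dR' dI'; rewrite fourier_re// fourier_im// => dR dI dR' dI'.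
split.
- rewrite (_ : cos_transform 0 re = fun xi => 2^-1 * ((cos_transform 0 re xi + cos_transform (pi / 2) im xi) +
    (cos_transform 0 re (- xi) + cos_transform (pi / 2) im (- xi)))).
    exact: decaysZ (decaysD dR dR').
  by apply/funext => xi; rewrite cos_transform0_reflect cos_transform_pihalf_reflect//; field.
- rewrite (_ : cos_transform _ re = fun xi => 2^-1 * ((cos_transform 0 im (- xi) + - cos_transform (pi / 2) re (- xi)) +
    - (cos_transform 0 im xi + - cos_transform (pi / 2) re xi))).
    exact: decaysZ (decaysD dI' (decaysN dI)).
  by apply/funext => xi; rewrite cos_transform0_reflect cos_transform_pihalf_reflect//; field.
- rewrite (_ : cos_transform 0 im = fun xi => 2^-1 * ((cos_transform 0 im xi + - cos_transform (pi / 2) re xi) +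
    (cos_transform 0 im (- xi) + - cos_transform (pi / 2) re (- xi)))).
    exact: decaysZ (decaysD dI dI').
  by apply/funext => xi; rewrite cos_transform0_reflect cos_transform_pihalf_reflect//; field.
- rewrite (_ : cos_transform _ im = fun xi => 2^-1 * ((cos_transform 0 re xi + cos_transform (pi / 2) im xi) +
    - (cos_transform 0 re (- xi) + cos_transform (pi / 2) im (- xi)))).
    exact: decaysZ (decaysD dR (decaysN dR')).
  by apply/funext => xi; rewrite cos_transform0_reflect cos_transform_pihalf_reflect//; field.
Qed.

Lemma joint_decay_of_values : weighted_values omega u -> joint_decays.
Proof.
move=> h.
have [d1 d2] := @decays_of_weighted_bounded _ _ omega u (fun lam l0 => proj1 (h lam l0)).
have [d3 d4] := @decays_of_weighted_bounded _ _ omega (fourier u) (fun lam l0 => proj2 (h lam l0)).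
have [d5 d6 d7 d8] := decays_trans_of_fourier d3 d4.
by split; apply: joint_decay_core.
Qed.

Lemma joint_bounds_of_joint_decay : joint_decays -> joint_young_bounds omega u.
Proof.
move=> [jr ji] mu lam m0 l0.
have [C hC] := jr lam mu l0 m0; have [D hD] := ji lam mu l0 m0.
have C0 : 0 <= C.
  apply: le_trans (hC [::] 0 isT); by rewrite mulr_ge0 ?young_real_ge0// mulr_ge0// expR_ge0.
have D0 : 0 <= D.
  apply: le_trans (hD [::] 0 isT); by rewrite mulr_ge0 ?young_real_ge0// mulr_ge0// expR_ge0.
(* The summand 1 only secures strict positivity of the constant. *)
exists (1 + expR (mu * omega 1) * (C + D)) => [|al be].
  by rewrite ltr_pwDl// mulr_ge0 ?addr_ge0 ?expR_ge0.
rewrite !young_factorE//; apply/young_sup2P => x; apply: ler_wpDl => //.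
have hr := hC _ x (sorted_mi_dirs al); have hi := hD _ x (sorted_mi_dirs al).
rewrite size_mi_dirs in hr hi.
set P := `|partials (mi_dirs al) re x| in hr *; set Q := `|partials (mi_dirs al) im x| in hi *.
have PQ0 : 0 <= P + Q by rewrite addr_ge0 ?normr_ge0.
apply: (@le_trans _ _ ((young_real mu (mi_size be) * enorm x ^+ mi_size be) * ((P + Q) * young_real lam (mi_size al)))).
  rewrite [leRHS](_ : _ = enorm x ^+ mi_size be * (P + Q) * young_real lam (mi_size al) * young_real mu (mi_size be)); last by ring.
  by rewrite ler_wpM2r ?young_real_ge0// ler_wpM2r ?young_real_ge0//; exact: xD_le.
apply: (@le_trans _ _ ((expR (mu * omega 1) * expR (mu * omega (enorm x))) * ((P + Q) * young_real lam (mi_size al)))).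
  by rewrite ler_wpM2r ?mulr_ge0 ?young_real_ge0// young_real_pow_le// enorm_ge0.
rewrite -mulrA ler_wpM2l ?expR_ge0// mulrA mulrDr mulrDl; exact: lerD.
Qed.

(** [weight_of_coord_powers] is applied to [|partials w f x|] times its factor, with constants
    uniform in [w]; monomials in a single coordinate are enough. *)
Lemma joint_decay_of_joint_bounds : joint_young_bounds omega u -> joint_decays.
Proof.
move=> h.
have H (f : 'rV[R]_n -> R) : (forall al be x,
    `|mi_pow x be| * `|partials (mi_dirs al) f x| <= xD al be u x) -> joint_decay omega f.
  move=> hf lam mu l0 m0.
  have [lam' [D [l'0 D0 hD]]] := weight_of_coord_powers W n_gt0 m0.
  have [C C0 hC] := h lam' lam l'0 l0; exists (D * C) => w x sw.
  rewrite -mulrA mulrC; apply: hD; first by rewrite mulr_ge0 ?young_real_ge0.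
  move=> j k; pose al := [ffun j => count_mem j w] : {ffun 'I_n -> nat}.
  have alw : mi_dirs al = w by exact: mi_dirs_count.
  have := hC al (mi_nseq k j); rewrite !young_factorE// => /young_sup2P/(_ x).
  rewrite mi_size_nseq -size_mi_dirs alw; apply: le_trans.
  rewrite ler_wpM2r ?young_real_ge0// mulrA ler_wpM2r ?young_real_ge0//.
  by have := hf al (mi_nseq k j) x; rewrite alw mi_pow_nseq normrX.
by split; apply: H => al be x; have [] := xD_ge al be x.
Qed.

(** Fixing one multi-index allows a parameter for which its factor is positive; dividing by it moves
    that factor into the constant. *)
Lemma separate_of_joint_bounds :
  joint_young_bounds omega u -> separate_young_bounds omega u.
Proof.
move=> h; split.
  move=> be lam l0; have [mu m0 y0] := young_real_gt0 W (mi_size be).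
  have [C C0 hC] := h mu lam m0 l0; exists (C / young_real mu (mi_size be)) => [|al]; first exact: divr_gt0.
  have := hC al be; rewrite !young_factorE// => /young_sup2P hx; apply/young_supP => x.
  by rewrite ler_pdivlMr.
move=> al mu m0; have [lam l0 y0] := young_real_gt0 W (mi_size al).
have [C C0 hC] := h mu lam m0 l0; exists (C / young_real lam (mi_size al)) => [|be]; first exact: divr_gt0.
have := hC al be; rewrite !young_factorE// => /young_sup2P hx; apply/young_supP => x.
by rewrite ler_pdivlMr// mulrAC.
Qed.

(** Part (b) without derivatives gives the decay of [u]. Part (a), with monomials of degree 0 and
    [2 * n], bounds the weighted pure derivatives that [decays_trans] needs. *)
Lemma values_of_separate_bounds :
  separate_young_bounds omega u -> weighted_values omega u.
Proof.
move=> [ha hb].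
have H (f : 'rV[R]_n -> R) : rapid f -> (forall al be x,
    `|mi_pow x be| * `|partials (mi_dirs al) f x| <= xD al be u x) ->
    decays f /\ forall th, decays (cos_transform th f).
  move=> rf hf; split.
    apply: (decays_of_powers W n_gt0) => lam l0; have [C C0 hC] := hb 0 lam l0.
    exists C => j k x; have := hC (mi_nseq k j); rewrite young_factorE// => /young_supP/(_ x).
    rewrite mi_size_nseq; apply: le_trans; rewrite ler_wpM2r ?young_real_ge0//.
    by have := hf 0 (mi_nseq k j) x; rewrite mi_dirs0 mi_pow_nseq normrX.
  apply: (decays_trans W n_gt0 rf) => lam l0.
  have [C0 _ hC0] := ha 0 lam l0.
  have /choice[C hC] : forall i : 'I_n, exists C : R, forall k j x,
      `|x 0 i| ^+ (2 * n) * `|partials (nseq k j) f x| * young_real lam k <= C.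
    move=> i; have [C _ hC] := ha (mi_nseq (2 * n) i) lam l0; exists C => k j x.
    have := hC (mi_nseq k j); rewrite young_factorE// => /young_supP/(_ x).
    rewrite mi_size_nseq; apply: le_trans; rewrite ler_wpM2r ?young_real_ge0//.
    by have := hf (mi_nseq k j) (mi_nseq (2 * n) i) x; rewrite mi_dirs_nseq mi_pow_nseq normrX.
  have Cge0 i : 0 <= C i.
    by apply: le_trans (hC i 0%N i 0); rewrite mulr_ge0 ?young_real_ge0// mulr_ge0// exprn_ge0.
  exists (C0 + n%:R ^+ (2 * n) * \sum_i C i) => j k x.
  rewrite -mulrA mulrDl mul1r lerD//.
    have := hC0 (mi_nseq k j); rewrite young_factorE// => /young_supP/(_ x).
    rewrite mi_size_nseq; apply: le_trans; rewrite ler_wpM2r ?young_real_ge0//.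
    by have := hf (mi_nseq k j) 0 x; rewrite mi_dirs_nseq mi_pow0 normr1 mul1r.
  have [i hi] := enorm_le_max x n_gt0.
  apply: (@le_trans _ _ ((n%:R * `|x 0 i|) ^+ (2 * n) * (`|partials (nseq k j) f x| * young_real lam k))).
    by rewrite ler_wpM2r ?mulr_ge0 ?young_real_ge0// lerXn2r ?nnegrE ?enorm_ge0 ?mulr_ge0.
  rewrite exprMn -mulrA ler_wpM2l ?exprn_ge0// mulrA (le_trans (hC i k j x))//.
  by rewrite (bigD1 i)//= lerDl sumr_ge0.
have [d1 t1] := H re rapid_re (fun al be x => proj1 (xD_ge al be x)).
have [d2 t2] := H im rapid_im (fun al be x => proj2 (xD_ge al be x)).
move=> lam l0; split.
  by apply: (weighted_bounded_of_decays d1 d2) => // x; rewrite /re_part /im_part; case: (u x).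
have d3 : decays (re_part (fourier u)) by rewrite fourier_re//; exact: decaysD.
have d4 : decays (im_part (fourier u)).
  by rewrite fourier_im//; apply: decaysD => //; exact: decaysN.
by apply: (weighted_bounded_of_decays d3 d4) => // x; rewrite /re_part /im_part; case: (fourier u x).
Qed.

Lemma total_of_joint_bounds :
  joint_young_bounds omega u -> total_young_bounds omega u.
Proof.
move=> h lam l0; have [C C0 hC] := h lam lam l0 l0; exists C => // al be.
have := hC al be; rewrite !young_factorE// => /young_sup2P hx; apply/young_supP => x.
apply: le_trans (hx x); rewrite -mulrA mi_sizeD ler_wpM2l//; last exact: young_real_addM.
by apply: le_trans (proj1 (xD_ge al be x)); rewrite mulr_ge0.
Qed.

(** Raising both parameters to [mu + lam] only increases the factors, which [young_real_half] then
    merges into one. *)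
Lemma joint_of_total_bounds :
  total_young_bounds omega u -> joint_young_bounds omega u.
Proof.
move=> h mu lam m0 l0; pose M := mu + lam.
have M0 : 0 < M by rewrite addr_gt0.
have [C C0 hC] := h (2 * M) (mulr_gt0 (ltr0Sn _ 1) M0); exists C => // al be.
have M20 : 0 < 2 * M by rewrite mulr_gt0.
have := hC al be; rewrite !young_factorE// => /young_supP hx; apply/young_sup2P => x.
apply: le_trans (hx x); rewrite -mulrA mi_sizeD ler_wpM2l//.
  by apply: le_trans (proj1 (xD_ge al be x)); rewrite mulr_ge0.
apply: (@le_trans _ _ (young_real M (mi_size al) * young_real M (mi_size be))); last exact: young_real_half.
by rewrite ler_pM ?young_real_ge0// young_real_mono// /M ?lerDl ?lerDr ltW.
Qed.

Lemma smooth_fourier : smooth (fourier u).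
Proof.
split; [rewrite fourier_re//|rewrite fourier_im//]; apply: smoothD; rewrite ?smoothN//;
  by [exact: smooth_trans|apply: smoothN; exact: smooth_trans].
Qed.

Lemma derivatives_of_joint_decay : joint_decays -> weighted_derivatives omega u.
Proof.
move=> [jr ji] lam al l0.
have tr th f : rapid f -> joint_decay omega f -> decays (partials (mi_dirs al) (cos_transform th f)).
  by move=> rf jf; exact: decays_partials_trans.
split; apply: weighted_bounded_Dop => //.
- by apply: decays_partials => //; exact: sorted_mi_dirs.
- by apply: decays_partials => //; exact: sorted_mi_dirs.
- rewrite fourier_re// partialsD; [|exact: smooth_trans|exact: smooth_trans].
  by apply: decaysD; exact: tr.
- rewrite fourier_im// partialsD; [|exact: smooth_trans|by apply: smoothN; exact: smooth_trans].
  rewrite partialsN; last exact: smooth_trans.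
  by apply: decaysD; [exact: tr|apply: decaysN; exact: tr].
Qed.

Lemma L1_schwartz : L1 u.
Proof. by split; exact: dominated_integrable. Qed.

End Equivalence.

Theorem theorem4p8 (R : realType) (n : nat) (n_gt0 : (0 < n)%N)
    (omega : R -> R) (u : 'rV[R]_n -> R[i])
    (omega_weight : weight_function omega) (u_schwartz : schwartz u) :
  [<-> weighted_derivatives omega u;
       weighted_monomials omega u;
       weighted_values omega u;
       separate_young_bounds omega u;
       joint_young_bounds omega u;
       total_young_bounds omega u]
  /\
  (S_omega omega u <->
   weighted_derivatives omega u \/ weighted_monomials omega u \/
   weighted_values omega u \/ separate_young_bounds omega u \/
   joint_young_bounds omega u \/ total_young_bounds omega u).
Proof.
(* The joint estimate links the two halves of the cycle: it is reached from the bare values or from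
   the Young bounds, and it yields both the Young bounds and the decay of all derivatives. *)
have h35 : weighted_values omega u -> joint_young_bounds omega u.
  by move=> h; apply: joint_bounds_of_joint_decay => //; exact: joint_decay_of_values.
have h61 : total_young_bounds omega u -> weighted_derivatives omega u.
  move=> h; apply: derivatives_of_joint_decay => //.
  by apply: joint_decay_of_joint_bounds => //; exact: joint_of_total_bounds.
have H : [<-> weighted_derivatives omega u; weighted_monomials omega u;
    weighted_values omega u; separate_young_bounds omega u;
    joint_young_bounds omega u; total_young_bounds omega u].
  tfae => //.
  - exact: monomials_of_derivatives.
  - exact: values_of_monomials.
  - by move=> /h35; exact: separate_of_joint_bounds.
  - by move=> h; apply: h35; exact: values_of_separate_bounds.
  - exact: total_of_joint_bounds.
split => //; split => [[_ _ _ h]|h]; first by left.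
have wd : weighted_derivatives omega u.
  by case: h => [//|[|[|[|[|]]]]] h; [exact: (proj1 (H 1 0)%N) h|exact: (proj1 (H 2 0)%N) h|exact: (proj1 (H 3 0)%N) h|exact: (proj1 (H 4 0)%N) h|exact: (proj1 (H 5 0)%N) h].
by split => //; [exact: L1_schwartz|have [] := u_schwartz|exact: smooth_fourier].
Qed.
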